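(* Let $f=f(x,u,p,q,r)$ be of class $C^1$ and, only at $r=0$, let also $f_p,f_q,f_r$ be of class $C^1$. Assume the parabolicity condition $f_q\cdot f_r<0$ at every argument $(x,u,p,q,r)$. Consider the equation $$f(x,u,u_x,u_{xx},u_t)=0,\qquad x\in(0,1),$$ with separated boundary conditions: at each boundary point $x=\iota\in\{0,1\}$ separately, either the Dirichlet condition $u=0$, or a nonlinear Robin condition $u_x=b^\iota(u)$ with a given function $b^\iota\in C^1$. Let $F$, $F^0$, $F^1$ be the functions associated with $f$ as defined in the context, with $F^0$ well-defined. Then for every bounded set $B\subset\mathbb{R}^2$ there exists a Lagrange function $L=L(x,u,p)$, with $L$, $L_p$, $L_{pp}$ of class $C^1$, such that $$E:=\int_0^1 L(x,u,u_x)\,dx$$ is a Lyapunov function for the equation under the given boundary conditions on solutions with $(u,u_x)\in B$. More precisely, every bounded classical solution $u(t,x)$, $t\in(0,T)$, whose values $(u(t,x),u_x(t,x))$ lie in $B$ satisfies $$\frac{dE}{dt}=-\int_0^1 L_{pp}(x,u,u_x)\,F^1(x,u,u_x,u_t)\,|u_t|^2\,dx ,\qquad t\in(0,T),$$ with strictly positive weight $L_{pp}F^1>0$. In particular, $dE/dt<0$ along nonequilibrium classical solutions.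
   Context: Indices denote partial derivatives, and the arguments are $(x,u,p,q,r)=(x,u,u_x,u_{xx},u_t)$, with $x\in[0,1]$ and $u,p,q,r$ real. Classical solution: a function $u=u(t,x)$ satisfying the equation for $t\in(0,T)$, $x\in(0,1)$, such that $u$, $u_t$, $u_{xx}$ are bounded and continuous for $t\in(0,T)$, $x\in(0,1)$. The initial condition $u(0,x)=u_0(x)$ is approached continuously in the sup-norm in $x$ as $t\searrow0$. The boundary values of $u(t,x)$ and $u_x(t,x)$ exist as continuous limits for $x\to\iota\in\{0,1\}$ and satisfy the boundary condition prescribed at $x=\iota$. Equilibrium: a time-independent solution, i.e. $u_t\equiv0$. The function $F$: since $f_q\neq0$, the equation $f(x,u,p,q,r)=0$ is solved for $q$ by the implicit function theorem, giving $q=F(x,u,p,r)$. The PDE is thus rewritten as $u_{xx}=F(x,u,u_x,u_t)$, and $F_r=-f_r/f_q>0$. For each $(x,u,p)$, the function $F(x,u,p,\cdot)$ need only be defined on a bounded or unbounded open interval of $r$, with limits $\pm\infty$ of $F$ at its boundaries. The functions $F^0,F^1$: $F^0(x,u,p):=F(x,u,p,0)$, which is assumed to be well-defined (that is, $r=0$ lies in the interval of definition of $F(x,u,p,\cdot)$ for all $(x,u,p)$); and $$F^1(x,u,p,r):=\begin{cases}\bigl(F(x,u,p,r)-F^0(x,u,p)\bigr)/r, & r\neq0,\\ F_r(x,u,p,0), & r=0.\end{cases}$$ *)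

(* Defs.v *)
From Stdlib Require Import Reals.
From Coquelicot Require Import Coquelicot.
Open Scope R_scope.

(** * Class [C^1] *)

(** [g] is [C^1] on [D]: Fréchet differentiable relative to [D] at every point
    of [D], with a derivative that is continuous relative to [D].  The filter
    [within D (locally z)] makes differentiation one-sided in [x] at the
    boundary points [x = 0] and [x = 1] of the slabs below.  For these [D]
    (convex, nonempty interior) the derivative is unique, and continuity of
    [w |-> dg w v] for each direction [v] is continuity of the derivative, the
    spaces being finite-dimensional. *)
Definition C1_on {V : NormedModule R_AbsRing} (D : V -> Prop) (g : V -> R) : Prop :=
  exists dg : V -> V -> R,
    forall z, D z ->
      filterdiff g (within D (locally z)) (dg z) /\
      forall v, filterlim (fun w => dg w v) (within D (locally z)) (locally (dg z v)).

Definition C1_xup (g : R -> R -> R -> R) : Prop :=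
  C1_on (fun '(x, _, _) => 0 <= x <= 1)
        (fun '(x, u, p) => g x u p).

Definition C1_xupq (g : R -> R -> R -> R -> R) : Prop :=
  C1_on (fun '(x, _, _, _) => 0 <= x <= 1)
        (fun '(x, u, p, q) => g x u p q).

Definition C1_xupqr (g : R -> R -> R -> R -> R -> R) : Prop :=
  C1_on (fun '(x, _, _, _, _) => 0 <= x <= 1)
        (fun '(x, u, p, q, r) => g x u p q r).

(** * The nonlinearity [f(x,u,p,q,r)] and the functions [F], [F^0], [F^1] *)

Definition f_p (f : R -> R -> R -> R -> R -> R) x u p q r : R :=
  Derive (fun s => f x u s q r) p.
Definition f_q (f : R -> R -> R -> R -> R -> R) x u p q r : R :=
  Derive (fun s => f x u p s r) q.
Definition f_r (f : R -> R -> R -> R -> R -> R) x u p q r : R :=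
  Derive (fun s => f x u p q s) r.

Definition parabolic (f : R -> R -> R -> R -> R -> R) : Prop :=
  forall x u p q r, 0 <= x <= 1 -> f_q f x u p q r * f_r f x u p q r < 0.

(** [r] lies in the domain of definition of [F(x,u,p,.)].  For fixed [(x,u,p)]
    and parabolic [f] of class [C^1], such [r] form an open interval. *)
Definition F_dom (f : R -> R -> R -> R -> R -> R) x u p r : Prop :=
  exists q, f x u p q r = 0.

(** The solution [q] of [f(x,u,p,q,r) = 0].  It is unique on [F_dom], as
    [f_q] has no zero; outside [F_dom] the value is irrelevant. *)
Definition F (f : R -> R -> R -> R -> R -> R) x u p r : R :=
  iota (fun q : R => f x u p q r = 0).

Definition F0 (f : R -> R -> R -> R -> R -> R) x u p : R := F f x u p 0.

Definition F1 (f : R -> R -> R -> R -> R -> R) x u p r : R :=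
  if Req_EM_T r 0 then Derive (fun s => F f x u p s) 0
  else (F f x u p r - F0 f x u p) / r.

(** * Boundary conditions *)

Inductive boundary_condition : Type :=
| Dirichlet
| Robin (b : R -> R).

Definition bc_C1 (bc : boundary_condition) : Prop :=
  match bc with
  | Dirichlet => True
  | Robin b => C1_on (fun _ : R => True) b
  end.

Definition bc_holds (bc : boundary_condition) (v w : R) : Prop :=
  match bc with
  | Dirichlet => v = 0
  | Robin b => w = b v
  end.

(** * Classical solutions [u(t,x)] *)

Definition u_t (u : R -> R -> R) t x : R := Derive (fun s => u s x) t.
Definition u_x (u : R -> R -> R) t x : R := Derive (fun y => u t y) x.
Definition u_xx (u : R -> R -> R) t x : R := Derive (fun y => u_x u t y) x.

Definition bounded_continuous (T : R) (g : R -> R -> R) : Prop :=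
  (exists M, forall t x, 0 < t < T -> 0 < x < 1 -> Rabs (g t x) <= M) /\
  (forall t x, 0 < t < T -> 0 < x < 1 -> continuity_2d_pt g t x).

(** The limits [v t], [w t] of [u(t,x)], [u_x(t,x)], as [x] tends to [iota]
    from inside (0,1), exist, are continuous in [t], and satisfy the boundary
    condition. *)
Definition boundary_limits (T iota : R) (bc : boundary_condition)
    (u : R -> R -> R) : Prop :=
  exists v w : R -> R,
    forall t, 0 < t < T ->
      continuous v t /\ continuous w t /\
      filterlim (fun x => u t x) (within (fun x => 0 < x < 1) (locally iota))
                (locally (v t)) /\
      filterlim (fun x => u_x u t x) (within (fun x => 0 < x < 1) (locally iota))
                (locally (w t)) /\
      bc_holds bc (v t) (w t).

(** Only the values of [u] on [0 <= t < T], [0 < x < 1] matter. *)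
Record classical_solution (f : R -> R -> R -> R -> R -> R)
    (bc0 bc1 : boundary_condition) (T : R) (u0 : R -> R) (u : R -> R -> R) : Prop := {
  cs_ex_t : forall t x, 0 < t < T -> 0 < x < 1 -> ex_derive (fun s => u s x) t;
  cs_ex_x : forall t x, 0 < t < T -> 0 < x < 1 -> ex_derive (fun y => u t y) x;
  cs_ex_xx : forall t x, 0 < t < T -> 0 < x < 1 -> ex_derive (fun y => u_x u t y) x;
  cs_u : bounded_continuous T u;
  cs_u_t : bounded_continuous T (u_t u);
  cs_u_xx : bounded_continuous T (u_xx u);
  cs_eq : forall t x, 0 < t < T -> 0 < x < 1 ->
    f x (u t x) (u_x u t x) (u_xx u t x) (u_t u t x) = 0;
  cs_init : forall x, 0 < x < 1 -> u 0 x = u0 x;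
  cs_init_lim : forall eps : posreal, exists delta : posreal,
    forall t x, 0 < t < T -> t < delta -> 0 < x < 1 -> Rabs (u t x - u0 x) < eps;
  cs_bc0 : boundary_limits T 0 bc0 u;
  cs_bc1 : boundary_limits T 1 bc1 u
}.

(** [u(t,.)] is an equilibrium profile: [u_t] vanishes identically in [x]. *)
Definition equilibrium_at (u : R -> R -> R) (t : R) : Prop :=
  forall x, 0 < x < 1 -> u_t u t x = 0.

(** * Lagrange function and energy *)

Definition L_p (L : R -> R -> R -> R) x u p : R := Derive (fun s => L x u s) p.
Definition L_pp (L : R -> R -> R -> R) x u p : R := Derive (fun s => L_p L x u s) p.

Definition energy_density (L : R -> R -> R -> R) (u : R -> R -> R) t x : R :=
  L x (u t x) (u_x u t x).

Definition energy (L : R -> R -> R -> R) (u : R -> R -> R) t : R :=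
  RInt (energy_density L u t) 0 1.

Definition dissipation_density (f : R -> R -> R -> R -> R -> R)
    (L : R -> R -> R -> R) (u : R -> R -> R) t x : R :=
  L_pp L x (u t x) (u_x u t x) * F1 f x (u t x) (u_x u t x) (u_t u t x)
    * Rabs (u_t u t x) ^ 2.

Definition bounded_set (B : R * R -> Prop) : Prop :=
  exists M, forall u p, B (u, p) -> Rabs u <= M /\ Rabs p <= M.

(* Main.v *)
Require Import Defs.
From Stdlib Require Import Reals Lra Lia Classical ClassicalEpsilon FunctionalExtensionality.
From Coquelicot Require Import Coquelicot.
Open Scope R_scope.

(** For a Lagrange function [L] and a solution [u], an integration by parts in
    [x] gives
    [dE/dt = [L_p u_t]_0^1 + int_0^1 (L_u - L_px - u_x L_pu - L_pp u_xx) u_t dx].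
    Since [u_xx = F^0 + F^1 u_t], the claim follows once
    [L_u - L_px - p L_pu = L_pp F^0] and the boundary term vanishes.

    Derived in [p], this identity becomes a linear transport equation for
    [L_pp] whose characteristics are the solutions of the equilibrium equation
    [u'' = F^0(x,u,u')].  It has a positive solution [L_pp = exp g], where [g]
    solves [g_x + p g_u + F^0 g_p + F^0_p = 0] (theorem [transport]); cutting
    [F^0] off outside the bounded set makes the characteristics global.  Two
    integrations in [p] give [L], and the constants of integration are chosen
    to satisfy the identity itself and to make [L_p] vanish on the Robin
    conditions ([lagrangian_exists]).  Positivity of [F^1] is the monotonicity
    of [F] in [r] ([implicit_data_exists]).

    Two points of regularity need care.  First, [F^0] is only [C^1], with
    [F^0_p] again [C^1] in [(u,p)], and the flow of the characteristics must be
    shown to be [C^1].  Divided differences of the flow solve a linear equation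
    whose coefficients are divided differences of [F^0] and so remain
    continuous when the increment tends to zero; hence continuous dependence
    on parameters ([ode_solution]) already implies differentiability
    ([flow_quotient]).  Second, [u_xt] need not exist, and [u_xx], [u_t] need
    not have limits at the boundary.  The increment of the energy between two
    times is therefore written by a mean value theorem along the segment
    between the two profiles and integrated by parts in [x] there
    ([energy_increment]); then the time step tends to zero by bounded
    convergence ([energy_dissipation]). *)

(** * Continuity of functions of several variables *)

Lemma continuous_eps {U : UniformSpace} (f : U -> R) (z : U) :
  continuous f z <->
  forall eps, 0 < eps -> locally z (fun w => Rabs (f w - f z) < eps).
Proof.
  split.
  - intros H eps He.
    apply (H (fun y => Rabs (y - f z) < eps)).
    exists (mkposreal eps He). intros y Hy. exact Hy.
  - intros H P [eps HP].
    specialize (H eps (cond_pos eps)). unfold filtermap.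
    revert H. apply filter_imp. intros w Hw. apply HP. exact Hw.
Qed.

Lemma continuous_pair {T U V : UniformSpace} (f : T -> U) (g : T -> V) (z : T) :
  continuous f z -> continuous g z -> continuous (fun w => (f w, g w)) z.
Proof.
  intros Hf Hg P [eps HP]. unfold filtermap.
  assert (H1 : locally z (fun w => ball (f z) eps (f w))) by apply (Hf _ (locally_ball (f z) eps)).
  assert (H2 : locally z (fun w => ball (g z) eps (g w))) by apply (Hg _ (locally_ball (g z) eps)).
  generalize (filter_and _ _ H1 H2). apply filter_imp.
  intros w [A B]. apply HP. split; assumption.
Qed.

Lemma continuous_add {U : UniformSpace} (f g : U -> R) z :
  continuous f z -> continuous g z -> continuous (fun w => f w + g w) z.
Proof. intros; apply (continuous_plus (V := R_NormedModule) f g); assumption. Qed.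

Lemma continuous_sub {U : UniformSpace} (f g : U -> R) z :
  continuous f z -> continuous g z -> continuous (fun w => f w - g w) z.
Proof. intros; apply (continuous_minus (V := R_NormedModule) f g); assumption. Qed.

Lemma continuous_neg {U : UniformSpace} (f : U -> R) z :
  continuous f z -> continuous (fun w => - f w) z.
Proof. intros; apply (continuous_opp (V := R_NormedModule) f); assumption. Qed.

Lemma continuous_mul {U : UniformSpace} (f g : U -> R) z :
  continuous f z -> continuous g z -> continuous (fun w => f w * g w) z.
Proof. intros; apply (continuous_mult (K := R_AbsRing) f g); assumption. Qed.

Lemma continuous_cst {U V : UniformSpace} (c : V) (z : U) : continuous (fun _ => c) z.
Proof. apply continuous_const. Qed.

Lemma continuous_fst' {U V W : UniformSpace} (f : U -> V * W) z :
  continuous f z -> continuous (fun w => fst (f w)) z.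
Proof. intros H; apply (continuous_comp f fst); [exact H | destruct (f z); apply continuous_fst]. Qed.

Lemma continuous_snd' {U V W : UniformSpace} (f : U -> V * W) z :
  continuous f z -> continuous (fun w => snd (f w)) z.
Proof. intros H; apply (continuous_comp f snd); [exact H | destruct (f z); apply continuous_snd]. Qed.

Lemma continuous_R {U : UniformSpace} (k : R -> R) (f : U -> R) z :
  continuous k (f z) -> continuous f z -> continuous (fun w => k (f w)) z.
Proof. intros; apply (continuous_comp f k); assumption. Qed.

Lemma continuous_quot {U : UniformSpace} (f g : U -> R) z :
  continuous f z -> continuous g z -> g z <> 0 -> continuous (fun w => f w / g w) z.
Proof.
  intros Hf Hg Hn. apply continuous_mul; [exact Hf|].
  apply (continuous_R Rinv); [|exact Hg].
  apply continuity_pt_filterlim. apply continuity_pt_inv; [|exact Hn].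
  apply derivable_continuous_pt, derivable_pt_id.
Qed.

Definition cont2 {A : UniformSpace} (k : A -> R -> R) : Prop :=
  forall z : A * R, continuous (fun w : A * R => k (fst w) (snd w)) z.

Definition cont3 (h : R -> R -> R -> R) : Prop :=
  forall z : R * R * R,
    continuous (fun w : R * R * R => h (fst (fst w)) (snd (fst w)) (snd w)) z.

Lemma cont2_comp {A U : UniformSpace} (k : A -> R -> R) (a : U -> A) (b : U -> R) z :
  cont2 k -> continuous a z -> continuous b z -> continuous (fun w => k (a w) (b w)) z.
Proof.
  intros Hk Ha Hb.
  apply (continuous_comp (fun w => (a w, b w)) (fun w => k (fst w) (snd w))).
  - apply continuous_pair; assumption.
  - apply Hk.
Qed.

Lemma cont3_comp {U : UniformSpace} (h : R -> R -> R -> R) (a b c : U -> R) z :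
  cont3 h -> continuous a z -> continuous b z -> continuous c z ->
  continuous (fun w => h (a w) (b w) (c w)) z.
Proof.
  intros Hh Ha Hb Hc.
  apply (continuous_comp (fun w => (a w, b w, c w))
           (fun w => h (fst (fst w)) (snd (fst w)) (snd w))).
  - apply (continuous_pair (fun w => (a w, b w)) c); [apply continuous_pair|]; assumption.
  - apply Hh.
Qed.

Definition cont4 {A : UniformSpace} (H : A -> R -> R -> R -> R) : Prop :=
  forall z : A * R * R * R,
    continuous (fun w : A * R * R * R =>
      H (fst (fst (fst w))) (snd (fst (fst w))) (snd (fst w)) (snd w)) z.

Lemma cont4_comp {A U : UniformSpace} (H : A -> R -> R -> R -> R)
    (a : U -> A) (b c d : U -> R) z :
  cont4 H -> continuous a z -> continuous b z -> continuous c z -> continuous d z ->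
  continuous (fun w => H (a w) (b w) (c w) (d w)) z.
Proof.
  intros HH Ha Hb Hc Hd.
  apply (continuous_comp (fun w => (a w, b w, c w, d w))
           (fun w : A * R * R * R =>
      H (fst (fst (fst w))) (snd (fst (fst w))) (snd (fst w)) (snd w))).
  - apply (continuous_pair (fun w => (a w, b w, c w)) d); [|assumption].
    apply (continuous_pair (fun w => (a w, b w)) c); [|assumption].
    apply continuous_pair; assumption.
  - apply HH.
Qed.

Definition cont5 (h : R -> R -> R -> R -> R -> R) : Prop :=
  forall z : R * R * R * R * R, continuous (fun w : R * R * R * R * R =>
    h (fst (fst (fst (fst w)))) (snd (fst (fst (fst w)))) (snd (fst (fst w)))
      (snd (fst w)) (snd w)) z.

Lemma cont5_comp {U : UniformSpace} (h : R -> R -> R -> R -> R -> R) (a b c d e : U -> R) z :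
  cont5 h -> continuous a z -> continuous b z -> continuous c z -> continuous d z ->
  continuous e z -> continuous (fun w => h (a w) (b w) (c w) (d w) (e w)) z.
Proof.
  intros Hh Ha Hb Hc Hd He.
  apply (continuous_comp (fun w => (a w, b w, c w, d w, e w)) (fun w : R * R * R * R * R =>
    h (fst (fst (fst (fst w)))) (snd (fst (fst (fst w)))) (snd (fst (fst w)))
      (snd (fst w)) (snd w))); [|apply Hh].
  apply (continuous_pair (fun w => (a w, b w, c w, d w)) e); [|assumption].
  apply (continuous_pair (fun w => (a w, b w, c w)) d); [|assumption].
  apply (continuous_pair (fun w => (a w, b w)) c); [|assumption].
  apply continuous_pair; assumption.
Qed.

(** Functions on the slab [0 <= x <= 1] are extended to all [x] by freezing
    them at the end points.  This keeps continuity and the derivatives in the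
    other variables; derivatives in [x] survive for [0 < x < 1]. *)
Definition clamp (x : R) : R := Rmax 0 (Rmin x 1).

Lemma clamp_in x : 0 <= clamp x <= 1.
Proof.
  unfold clamp. split; [apply Rmax_l|]. apply Rmax_lub; [lra | apply Rmin_r].
Qed.

Lemma clamp_id x : 0 <= x <= 1 -> clamp x = x.
Proof. intros H. unfold clamp. rewrite Rmin_left, Rmax_right; lra. Qed.

Lemma clamp_idem x : clamp (clamp x) = clamp x.
Proof. apply clamp_id, clamp_in. Qed.

Lemma clamp_cont x : continuous clamp x.
Proof.
  apply continuous_eps. intros eps He. exists (mkposreal eps He). intros y Hy.
  eapply Rle_lt_trans; [|exact Hy].
  change (Rabs (clamp y - clamp x) <= Rabs (y - x)).
  unfold clamp, Rmax, Rmin. destruct (Rle_dec x 1), (Rle_dec y 1);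
  repeat match goal with |- context [Rle_dec ?a ?b] => destruct (Rle_dec a b) end;
    unfold Rabs; repeat match goal with |- context [Rcase_abs ?a] => destruct (Rcase_abs a) end; lra.
Qed.

Lemma continuous_expf {U : UniformSpace} (f : U -> R) z :
  continuous f z -> continuous (fun w => exp (f w)) z.
Proof.
  intros H. apply (continuous_R exp); [|exact H].
  apply continuity_pt_filterlim. apply derivable_continuous_pt, derivable_pt_exp.
Qed.

Lemma continuous_of_derive (f : R -> R) x l : is_derive f x l -> continuous f x.
Proof. intros H. apply (ex_derive_continuous (V := R_NormedModule) f). exists l; exact H. Qed.

Ltac Rring := match goal with |- @eq _ ?a ?b => change (@eq R a b) end; first [lra | ring].

Ltac cont_step :=
  match goal with
  | |- continuous (fun w => w) _ => apply continuous_id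
  | |- continuous (fun w => @?a w + @?b w) _ => apply (continuous_add a b)
  | |- continuous (fun w => @?a w - @?b w) _ => apply (continuous_sub a b)
  | |- continuous (fun w => @?a w * @?b w) _ => apply (continuous_mul a b)
  | |- continuous (fun w => - @?a w) _ => apply (continuous_neg a)
  | |- continuous (fun w => exp (@?a w)) _ => apply (continuous_expf a)
  | |- continuous (fun w => (@?a w, @?b w)) _ => apply (continuous_pair a b)
  | H : cont5 ?h |- continuous (fun w => ?h (@?a w) (@?b w) (@?c w) (@?d w) (@?e w)) _ =>
      apply (cont5_comp h a b c d e _ H)
  | H : cont4 ?h |- continuous (fun w => ?h (@?a w) (@?b w) (@?c w) (@?d w)) _ =>
      apply (cont4_comp h a b c d _ H)
  | |- continuous (fun w => clamp (@?a w)) _ =>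
      apply (continuous_R clamp a); [apply clamp_cont|]
  | H : cont3 ?h |- continuous (fun w => ?h (@?a w) (@?b w) (@?c w)) _ =>
      apply (cont3_comp h a b c _ H)
  | H : cont2 ?h |- continuous (fun w => ?h (@?a w) (@?b w)) _ =>
      apply (cont2_comp h a b _ H)
  | H : cont3 ?h |- continuous (?h ?x ?u) _ =>
      apply (cont3_comp h (fun _ => x) (fun _ => u) (fun w => w) _ H)
  | H : cont2 ?h |- continuous (?h ?x) _ =>
      apply (cont2_comp h (fun _ => x) (fun w => w) _ H)
  | |- continuous (Rmult ?c) _ => apply (continuous_mul (fun _ => c) (fun w => w))
  | |- continuous (Rplus ?c) _ => apply (continuous_add (fun _ => c) (fun w => w))
  | |- continuous fst _ => apply (continuous_fst' (fun w => w))
  | |- continuous snd _ => apply (continuous_snd' (fun w => w))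
  | |- @continuous ?U ?V (fun _ => ?c) ?z => exact (@continuous_cst U V c z)
  | |- continuous (fun w => fst (@?a w)) _ => apply (continuous_fst' a)
  | |- continuous (fun w => snd (@?a w)) _ => apply (continuous_snd' a)
  end.
Ltac cont := cbv beta; repeat (cont_step; cbv beta); try assumption;
  try match goal with H : forall _, continuous ?f _ |- continuous ?f _ => apply H end.

Lemma locally_pair {A B : UniformSpace} (a : A) (b : B) (P : A * B -> Prop) :
  locally (a, b) P <->
  exists d : posreal, forall x y, ball a d x -> ball b d y -> P (x, y).
Proof.
  split.
  - intros [d H]. exists d. intros x y Hx Hy. apply H. split; assumption.
  - intros [d H]. exists d. intros [x y] [Hx Hy]. apply H; assumption.
Qed.

(** * Compactness *)

Lemma pick_posreal {A : Type} (P : A -> posreal -> Prop) (Q : A -> Prop) :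
  (forall x, Q x -> exists d, P x d) ->
  exists f : A -> posreal, forall x, Q x -> P x (f x).
Proof.
  intros H.
  assert (H' : forall x, exists d, Q x -> P x d).
  { intros x. destruct (classic (Q x)) as [q|q].
    - destruct (H x q) as [d Hd]. exists d; auto.
    - exists (mkposreal 1 Rlt_0_1). tauto. }
  exists (fun x => proj1_sig (constructive_indefinite_description _ (H' x))).
  intros x. exact (proj2_sig (constructive_indefinite_description _ (H' x))).
Qed.

(** Tube lemma: finitely many of the product neighbourhoods given by
    continuity cover the segment. *)
Lemma compact_uniform {A : UniformSpace} (k : A -> R -> R) (z0 : A) (a b : R) :
  (forall x, a <= x <= b -> continuous (fun w : A * R => k (fst w) (snd w)) (z0, x)) ->
  forall eps, 0 < eps ->
  locally z0 (fun z => forall x, a <= x <= b -> Rabs (k z x - k z0 x) < eps).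
Proof.
  intros H eps He.
  destruct (pick_posreal
    (fun x (d : posreal) => forall z y, ball z0 d z -> ball x d y ->
        Rabs (k z y - k z0 x) < eps / 2) (fun x => a <= x <= b)) as [dl Hdl].
  { intros x Hx.
    assert (He2 : 0 < eps / 2) by lra.
    destruct (proj1 (locally_pair _ _ _) (proj1 (continuous_eps _ _) (H x Hx) _ He2))
      as [d Hd].
    exists d. intros z y Hz Hy. exact (Hd z y Hz Hy). }
  destruct (compactness_value_1d a b dl) as [d Hd].
  exists d. intros z Hz x Hx.
  apply NNPP. intros Hn. apply (Hd x Hx). intros [t [Ht [Hxt Hdt]]]. apply Hn.
  assert (A1 := Hdl t Ht z x (ball_le _ _ _ Hdt _ Hz) Hxt).
  assert (A2 := Hdl t Ht z0 x (ball_center z0 (dl t)) Hxt).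
  replace (k z x - k z0 x) with ((k z x - k z0 t) - (k z0 x - k z0 t)) by ring.
  eapply Rle_lt_trans; [apply Rabs_triang|]. rewrite Rabs_Ropp. lra.
Qed.

(** Around each point choose a cube of radius [d] on which [|h| <= 1/d]; by
    compactness the radii can be bounded below, hence [h] above. *)
Lemma cont3_bounded (h : R -> R -> R -> R) (M : R) :
  cont3 h -> exists K, 0 <= K /\
    forall x u p : R, 0 <= x <= 1 -> Rabs u <= M -> Rabs p <= M -> Rabs (h x u p) <= K.
Proof.
  intros Hh.
  destruct (pick_posreal
    (fun (z : Compactness.Tn 3 R) (d : posreal) => let '(x, (u, (p, tt))) := z in
       (forall x' u' p', Rabs (x' - x) < d -> Rabs (u' - u) < d -> Rabs (p' - p) < d ->
          Rabs (h x' u' p') <= / d)) (fun _ => True)) as [dl Hdl].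
  { intros [x [u [p []]]] _.
    destruct (proj1 (continuous_eps _ _) (Hh (x, u, p)) 1 Rlt_0_1) as [d Hd].
    assert (Hpos : 0 < / (1 + Rabs (h x u p))).
    { apply Rinv_0_lt_compat. assert (T := Rabs_pos (h x u p)). lra. }
    assert (Hm : 0 < Rmin d (/ (1 + Rabs (h x u p)))).
    { apply Rmin_pos; [apply cond_pos | exact Hpos]. }
    exists (mkposreal _ Hm). simpl. intros x' u' p' H1 H2 H3.
    assert (L := Rmin_l d (/ (1 + Rabs (h x u p)))).
    assert (A : Rabs (h x' u' p' - h x u p) < 1).
    { apply (Hd (x', u', p')). repeat split; simpl; eapply Rlt_le_trans; eauto. }
    assert (B : 1 + Rabs (h x u p) <= / Rmin d (/ (1 + Rabs (h x u p)))).
    { rewrite <- (Rinv_inv (1 + Rabs (h x u p))) at 1.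
      apply Rinv_le_contravar; [exact Hm | apply Rmin_r]. }
    replace (h x' u' p') with ((h x' u' p' - h x u p) + h x u p) by ring.
    eapply Rle_trans; [apply Rabs_triang|]. lra. }
  destruct (compactness_value 3 (0, (-M, (-M, tt))) (1, (M, (M, tt))) dl) as [d Hd].
  exists (/ d). split; [apply Rlt_le, Rinv_0_lt_compat, cond_pos|].
  intros x u p Hx Hu Hp. apply Rabs_le_between in Hu. apply Rabs_le_between in Hp.
  apply NNPP. intros Hn. apply (Hd (x, (u, (p, tt)))).
  { simpl. auto. }
  intros [[t1 [t2 [t3 []]]] [_ [Hc Hdt]]]. simpl in Hc. apply Hn.
  specialize (Hdl (t1, (t2, (t3, tt))) I). simpl in Hdl.
  eapply Rle_trans; [apply Hdl; apply Hc|].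
  apply Rinv_le_contravar; [apply cond_pos | exact Hdt].
Qed.

(** * Integrals depending on parameters *)

Lemma continuous_slice {A : UniformSpace} (k : A -> R -> R) z x :
  continuous (fun w : A * R => k (fst w) (snd w)) (z, x) -> continuous (k z) x.
Proof.
  intros H. apply (continuous_comp (fun y => (z, y)) (fun w : A * R => k (fst w) (snd w))).
  - apply continuous_pair; [apply continuous_cst | apply continuous_id].
  - exact H.
Qed.

Lemma cont2_ex_RInt {A : UniformSpace} (k : A -> R -> R) z a b :
  cont2 k -> ex_RInt (k z) a b.
Proof.
  intros H. apply (ex_RInt_continuous (V := R_CompleteNormedModule)).
  intros x _. apply continuous_slice, H.
Qed.

Lemma ex_RInt_cont (f : R -> R) a b : (forall x, continuous f x) -> ex_RInt f a b.
Proof. intros H. apply (ex_RInt_continuous (V := R_CompleteNormedModule)). auto. Qed.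

Lemma RInt_sub (f g : R -> R) a b : ex_RInt f a b -> ex_RInt g a b ->
  RInt (fun x => f x - g x) a b = RInt f a b - RInt g a b.
Proof. intros. apply (RInt_minus (V := R_CompleteNormedModule) f g); assumption. Qed.

Lemma RInt_mul_l (f : R -> R) c a b : ex_RInt f a b ->
  RInt (fun x => c * f x) a b = c * RInt f a b.
Proof. intros. apply (RInt_scal (V := R_CompleteNormedModule) f); assumption. Qed.

Lemma ex_RInt_sub (f g : R -> R) a b : ex_RInt f a b -> ex_RInt g a b ->
  ex_RInt (fun x => f x - g x) a b.
Proof. intros. apply (ex_RInt_minus (V := R_CompleteNormedModule) f g); assumption. Qed.

Lemma continuous_RInt_unit {A : UniformSpace} (k : A -> R -> R) (z0 : A) :
  cont2 k -> continuous (fun z => RInt (k z) 0 1) z0.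
Proof.
  intros Hk. apply continuous_eps. intros eps He.
  assert (He2 : 0 < eps / 2) by lra.
  generalize (compact_uniform k z0 0 1 (fun x _ => Hk (z0, x)) _ He2).
  apply filter_imp. intros z Hz.
  rewrite <- RInt_sub by (apply cont2_ex_RInt, Hk).
  eapply Rle_lt_trans; [apply (abs_RInt_le_const _ _ _ (eps / 2))|]; try lra.
  - apply ex_RInt_sub; apply cont2_ex_RInt, Hk.
  - intros t Ht. left. apply Hz, Ht.
Qed.

Lemma RInt_rescale (f : R -> R) t : (forall x, continuous f x) ->
  RInt f 0 t = t * RInt (fun y => f (t * y)) 0 1.
Proof.
  intros Hf.
  rewrite <- RInt_mul_l.
  2:{ apply ex_RInt_cont. intros x. apply (continuous_R f); [apply Hf|].
      cont. }
  replace (RInt f 0 t) with (RInt f (t * 0 + 0) (t * 1 + 0)) by (f_equal; ring).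
  rewrite <- (RInt_comp_lin (V := R_CompleteNormedModule) f t 0 0 1)
    by (apply ex_RInt_cont, Hf).
  apply RInt_ext. intros x _. rewrite Rplus_0_r. reflexivity.
Qed.

(** Rescaling to the unit interval turns the moving end point into a parameter
    of the integrand. *)
Lemma cont2_RInt {A : UniformSpace} (k : A -> R -> R) :
  cont2 k -> cont2 (fun (z : A) t => RInt (k z) 0 t).
Proof.
  intros Hk [z0 t0].
  apply (continuous_ext (fun w : A * R =>
     snd w * RInt (fun y => k (fst w) (snd w * y)) 0 1)).
  { intros [z t]. simpl. symmetry. apply RInt_rescale.
    intros x. apply continuous_slice, Hk. }
  apply continuous_mul; [apply continuous_snd'; apply continuous_id|].
  apply (continuous_RInt_unit (fun (w : A * R) y => k (fst w) (snd w * y))).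
  intros z. cont.
Qed.

Lemma is_derive_RInt_0 (f : R -> R) t :
  (forall x, continuous f x) -> is_derive (fun t => RInt f 0 t) t (f t).
Proof.
  intros Hf. apply (is_derive_RInt (V := R_NormedModule) f (fun t => RInt f 0 t) 0).
  - apply filter_forall. intros b. apply (RInt_correct (V := R_CompleteNormedModule)).
    apply ex_RInt_cont, Hf.
  - apply Hf.
Qed.

Lemma is_derive_RInt_under (f fx : R -> R -> R) a b x :
  locally x (fun y => forall t, is_derive (fun s => f s t) y (fx y t)) ->
  (forall t, continuous (fun w : R * R => fx (fst w) (snd w)) (x, t)) ->
  (forall y t, continuous (f y) t) ->
  is_derive (fun y => RInt (f y) a b) x (RInt (fx x) a b).
Proof.
  intros Hd Hc Hf.
  rewrite (RInt_ext (fx x) (fun t => Derive (fun s => f s t) x)).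
  2:{ intros t _. symmetry. apply is_derive_unique. apply (locally_singleton _ _ Hd). }
  apply (is_derive_RInt_param f a b x).
  - revert Hd. apply filter_imp. intros y Hy t _. eexists; apply Hy.
  - intros t _.
    apply (continuity_2d_pt_ext_loc fx).
    + destruct Hd as [d Hd]. exists d. intros u v Hu _. symmetry.
      apply is_derive_unique. apply Hd. exact Hu.
    + apply continuity_2d_pt_filterlim. apply Hc.
  - apply filter_forall. intros y. apply ex_RInt_cont, Hf.
Qed.

(** * Divided differences and total differentials *)

(** Hadamard's form of the divided difference, which is also defined and
    continuous on the diagonal [a = b]. *)
Definition slope (f' : R -> R) (a b : R) : R := RInt (fun y => f' (a + y * (b - a))) 0 1.

Lemma slope_eq (f f' : R -> R) a b :
  (forall x, is_derive f x (f' x)) -> (forall x, continuous f' x) ->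
  f b - f a = (b - a) * slope f' a b.
Proof.
  intros Hd Hc. unfold slope.
  rewrite <- RInt_mul_l.
  2:{ apply ex_RInt_cont. intros x. apply (continuous_R f'); [apply Hc|]. cont. }
  symmetry. apply is_RInt_unique.
  replace (f b - f a) with (minus (f (a + 1 * (b - a))) (f (a + 0 * (b - a)))).
  2:{ replace (a + 1 * (b - a)) with b by ring.
      replace (a + 0 * (b - a)) with a by ring. reflexivity. }
  apply (is_RInt_derive (V := R_CompleteNormedModule) (fun y => f (a + y * (b - a)))).
  - intros x _.
    apply (is_derive_comp f (fun y => a + y * (b - a))); [apply Hd|].
    auto_derive; [trivial | ring].
  - intros x _. apply continuous_mul; [cont|]. apply (continuous_R f'); [apply Hc|]. cont.
Qed.

Lemma slope_le (f' : R -> R) K a b :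
  (forall x, continuous f' x) -> (forall x, Rabs (f' x) <= K) -> Rabs (slope f' a b) <= K.
Proof.
  intros Hc HK. unfold slope. replace K with ((1 - 0) * K) by ring.
  apply abs_RInt_le_const; [lra | | intros; apply HK].
  apply ex_RInt_cont. intros x. apply (continuous_R f'); [apply Hc|]. cont.
Qed.

Lemma continuous_slope {U : UniformSpace} (f' : U -> R -> R) (a b : U -> R) z :
  cont2 f' -> (forall z, continuous a z) -> (forall z, continuous b z) ->
  continuous (fun w => slope (f' w) (a w) (b w)) z.
Proof.
  intros Hf Ha Hb. unfold slope.
  apply (continuous_RInt_unit (fun w y => f' w (a w + y * (b w - a w)))).
  intros [z' y']. apply (cont2_comp f'); [exact Hf | cont |].
  apply continuous_add; [apply (continuous_comp fst a); [cont | apply Ha]|].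
  apply continuous_mul; [cont|].
  apply continuous_sub; [apply (continuous_comp fst b) | apply (continuous_comp fst a)];
    auto; cont.
Qed.

(** A divided difference that extends continuously to [h = 0] yields the
    derivative there; derivatives of flows and of the energy are found in this
    form. *)
Lemma is_derive_of_quotient (k q : R -> R) :
  continuous q 0 -> (forall h, k h - k 0 = h * q h) -> is_derive k 0 (q 0).
Proof.
  intros Hq Hk. split; [apply is_linear_scal_l|].
  intros x Hx.
  assert (E := is_filter_lim_locally_unique (V := AbsRing_NormedModule R_AbsRing) _ _ Hx).
  simpl in E. subst x.
  intros eps.
  generalize (proj1 (continuous_eps _ _) Hq eps (cond_pos eps)).
  apply filter_imp. intros h Hh.
  unfold minus, plus, opp, scal; simpl; unfold mult; simpl.
  unfold norm; simpl; unfold abs; simpl.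
  replace (k h + - k 0 + - ((h + - 0) * q 0)) with ((q h - q 0) * (h + - 0))
    by (specialize (Hk h); nra).
  rewrite Rabs_mult. apply Rmult_le_compat_r; [apply Rabs_pos | lra].
Qed.

Lemma is_derive_shift (k : R -> R) x l :
  is_derive (fun h => k (x + h)) 0 l -> is_derive k x l.
Proof.
  intros H.
  apply (is_derive_ext (fun y => (fun h => k (x + h)) (y - x))).
  { intros y. simpl. f_equal. ring. }
  replace l with (scal 1 l) by (unfold scal; simpl; unfold mult; simpl; apply Rmult_1_l).
  apply (is_derive_comp (fun h => k (x + h)) (fun y => y - x)).
  - replace (x - x) with 0 by ring. exact H.
  - auto_derive; [trivial | ring].
Qed.

Lemma is_derive_eps (k : R -> R) t l :
  is_derive k t l <->
  forall eps, 0 < eps ->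
    locally t (fun y => Rabs (k y - k t - l * (y - t)) <= eps * Rabs (y - t)).
Proof.
  split.
  - intros [_ H] eps He.
    generalize (H t (fun P HP => HP) (mkposreal eps He)). apply filter_imp. intros y Hy.
    unfold minus, plus, opp, scal in Hy; simpl in Hy; unfold mult in Hy; simpl in Hy.
    unfold norm in Hy; simpl in Hy; unfold abs in Hy; simpl in Hy.
    replace (k y - k t - l * (y - t)) with (k y + - k t + - ((y + - t) * l)) by ring.
    exact Hy.
  - intros H. split; [apply is_linear_scal_l|].
    intros x Hx.
    assert (E := is_filter_lim_locally_unique (V := AbsRing_NormedModule R_AbsRing) _ _ Hx).
    simpl in E. subst x. intros eps.
    generalize (H eps (cond_pos eps)). apply filter_imp. intros y Hy.
    unfold minus, plus, opp, scal; simpl; unfold mult; simpl.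
    unfold norm; simpl; unfold abs; simpl.
    replace (k y + - k t + - ((y + - t) * l)) with (k y - k t - l * (y - t)) by ring.
    exact Hy.
Qed.

Lemma MVT_open (f df : R -> R) a b :
  (forall x, Rmin a b < x < Rmax a b -> is_derive f x (df x)) ->
  (forall x, continuous f x) ->
  exists c, Rmin a b <= c <= Rmax a b /\ f b - f a = df c * (b - a).
Proof.
  intros Hd Hc. apply MVT_gen; [exact Hd|].
  intros x _. apply continuity_pt_filterlim. apply Hc.
Qed.

Lemma between_Rabs a b c : Rmin a b <= c <= Rmax a b -> Rabs (c - a) <= Rabs (b - a).
Proof.
  unfold Rmin, Rmax. destruct (Rle_dec a b); intros [H1 H2].
  - rewrite !Rabs_pos_eq; lra.
  - rewrite !Rabs_left1; lra.
Qed.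

(** The mean value theorem in one variable after the other.  It
    differentiates strictly between two points, so that derivatives in [x] are
    used only inside the interval [J] of admissible first coordinates. *)
Lemma total_differential (J : R -> Prop) (h hx hu hp : R -> R -> R -> R) :
  cont3 h -> cont3 hx -> cont3 hu -> cont3 hp ->
  (forall x x' y u p, J x -> J x' -> Rmin x x' < y < Rmax x x' ->
     is_derive (fun s => h s u p) y (hx y u p)) ->
  (forall x u p : R, J x -> is_derive (fun s => h x s p) u (hu x u p)) ->
  (forall x u p : R, J x -> is_derive (fun s => h x u s) p (hp x u p)) ->
  forall x u p : R, J x -> forall eps, 0 < eps -> exists d, 0 < d /\
    forall x' u' p', J x' -> Rabs (x' - x) < d -> Rabs (u' - u) < d -> Rabs (p' - p) < d ->
      Rabs (h x' u' p' - h x u p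
            - (hx x u p * (x' - x) + hu x u p * (u' - u) + hp x u p * (p' - p)))
      <= eps * (Rabs (x' - x) + Rabs (u' - u) + Rabs (p' - p)).
Proof.
  intros Ch Cx Cu Cp Dx Du Dp x u p Jx eps He.
  assert (N : forall k, cont3 k -> exists d, 0 < d /\ forall x' u' p',
     Rabs (x' - x) < d -> Rabs (u' - u) < d -> Rabs (p' - p) < d ->
     Rabs (k x' u' p' - k x u p) < eps).
  { intros k Ck. destruct (proj1 (continuous_eps _ _) (Ck (x, u, p)) eps He) as [d Hd].
    exists d. split; [apply cond_pos|]. intros x' u' p' H1 H2 H3.
    apply (Hd (x', u', p')). split; [split|]; assumption. }
  destruct (N hx Cx) as [d1 [P1 N1]]. destruct (N hu Cu) as [d2 [P2 N2]].
  destruct (N hp Cp) as [d3 [P3 N3]].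
  exists (Rmin d1 (Rmin d2 d3)).
  split; [repeat apply Rmin_pos; assumption|].
  intros x' u' p' Jx' Hx Hu Hp.
  assert (L1 := Rmin_l d1 (Rmin d2 d3)). assert (L2 := Rmin_r d1 (Rmin d2 d3)).
  assert (L3 := Rmin_l d2 d3). assert (L4 := Rmin_r d2 d3).
  destruct (MVT_open (fun s => h s u' p') (fun s => hx s u' p') x x') as [cx [Bx Ex]].
  { intros y Hy. apply (Dx x x'); assumption. }
  { intros y. cont. }
  destruct (MVT_open (fun s => h x s p') (fun s => hu x s p') u u') as [cu [Bu Eu]].
  { intros y _. apply Du, Jx. }
  { intros y. cont. }
  destruct (MVT_open (fun s => h x u s) (fun s => hp x u s) p p') as [cp [Bp Ep]].
  { intros y _. apply Dp, Jx. }
  { intros y. cont. }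
  apply between_Rabs in Bx. apply between_Rabs in Bu. apply between_Rabs in Bp.
  assert (Z : forall y, Rabs (y - y) = 0) by (intros y; rewrite Rminus_diag; apply Rabs_R0).
  assert (M1 : Rabs (hx cx u' p' - hx x u p) < eps) by (apply N1; lra).
  assert (M2 : Rabs (hu x cu p' - hu x u p) < eps) by (apply N2; rewrite ?Z; lra).
  assert (M3 : Rabs (hp x u cp - hp x u p) < eps) by (apply N3; rewrite ?Z; lra).
  replace (h x' u' p' - h x u p
            - (hx x u p * (x' - x) + hu x u p * (u' - u) + hp x u p * (p' - p)))
    with ((hx cx u' p' - hx x u p) * (x' - x) + (hu x cu p' - hu x u p) * (u' - u)
          + (hp x u cp - hp x u p) * (p' - p)) by lra.
  eapply Rle_trans; [apply Rabs_triang|].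
  eapply Rle_trans; [apply Rplus_le_compat_r, Rabs_triang|].
  rewrite !Rabs_mult, !Rmult_plus_distr_l.
  repeat apply Rplus_le_compat; (apply Rmult_le_compat_r; [apply Rabs_pos | lra]).
Qed.

Lemma chain3 (h hx hu hp : R -> R -> R -> R) (a b c : R -> R) t a' b' c' :
  cont3 h -> cont3 hx -> cont3 hu -> cont3 hp ->
  (forall x u p : R, is_derive (fun s => h s u p) x (hx x u p)) ->
  (forall x u p : R, is_derive (fun s => h x s p) u (hu x u p)) ->
  (forall x u p : R, is_derive (fun s => h x u s) p (hp x u p)) ->
  is_derive a t a' -> is_derive b t b' -> is_derive c t c' ->
  is_derive (fun s => h (a s) (b s) (c s)) t
    (hx (a t) (b t) (c t) * a' + hu (a t) (b t) (c t) * b' + hp (a t) (b t) (c t) * c').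
Proof.
  intros Ch Cx Cu Cp Dx Du Dp Da Db Dc. apply is_derive_eps. intros eps He.
  set (X := hx (a t) (b t) (c t)). set (U := hu (a t) (b t) (c t)).
  set (P := hp (a t) (b t) (c t)).
  set (m := Rabs a' + Rabs b' + Rabs c' + 3 + Rabs X + Rabs U + Rabs P).
  assert (Hm : 3 <= m).
  { unfold m. assert (T := Rabs_pos). generalize (T a') (T b') (T c') (T X) (T U) (T P). lra. }
  set (e := Rmin 1 (eps / m)).
  assert (He1 : e <= 1) by apply Rmin_l.
  assert (He2 : e * m <= eps).
  { apply (Rmult_le_reg_r (/ m)); [apply Rinv_0_lt_compat; lra|].
    rewrite Rmult_assoc, Rinv_r, Rmult_1_r by lra. apply Rmin_r. }
  assert (He0 : 0 < e).
  { apply Rmin_pos; [lra | apply Rdiv_lt_0_compat; lra]. }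
  destruct (total_differential (fun _ => True) h hx hu hp Ch Cx Cu Cp) with
    (x := a t) (u := b t) (p := c t) (eps := e) as [d [Hd HD]]; auto.
  assert (K : forall k k', is_derive k t k' ->
     locally t (fun y => Rabs (k y - k t) < d /\ Rabs (k y - k t - k' * (y - t)) <= e * Rabs (y - t))).
  { intros k k' Dk. apply filter_and.
    - apply (continuous_eps k t); [eapply continuous_of_derive; exact Dk | exact Hd].
    - apply is_derive_eps; assumption. }
  generalize (filter_and _ _ (K a a' Da) (filter_and _ _ (K b b' Db) (K c c' Dc))).
  apply filter_imp. intros y [[A1 A2] [[B1 B2] [C1 C2]]].
  specialize (HD _ _ _ I A1 B1 C1). fold X U P in HD.
  set (r := Rabs (y - t)) in *.
  assert (Hr : 0 <= r) by apply Rabs_pos.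
  assert (G : forall k', forall q, Rabs (q - k' * (y - t)) <= e * r -> Rabs q <= (Rabs k' + 1) * r).
  { intros k' q Hq. replace q with ((q - k' * (y - t)) + k' * (y - t)) by ring.
    eapply Rle_trans; [apply Rabs_triang|]. rewrite Rabs_mult. fold r. nra. }
  assert (GA := G a' _ A2). assert (GB := G b' _ B2). assert (GC := G c' _ C2).
  set (qa := a y - a t) in *. set (qb := b y - b t) in *. set (qc := c y - c t) in *.
  set (hh := h (a y) (b y) (c y) - h (a t) (b t) (c t)) in *.
  replace (hh - (X * a' + U * b' + P * c') * (y - t)) with
    ((hh - (X * qa + U * qb + P * qc)) + X * (qa - a' * (y - t)) + U * (qb - b' * (y - t))
       + P * (qc - c' * (y - t))) by ring.
  eapply Rle_trans; [apply Rabs_triang|].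
  eapply Rle_trans; [apply Rplus_le_compat_r, Rabs_triang|].
  eapply Rle_trans; [apply Rplus_le_compat_r, Rplus_le_compat_r, Rabs_triang|].
  rewrite !Rabs_mult.
  assert (S1 : Rabs X * Rabs (qa - a' * (y - t)) <= Rabs X * (e * r))
    by (apply Rmult_le_compat_l; [apply Rabs_pos | assumption]).
  assert (S2 : Rabs U * Rabs (qb - b' * (y - t)) <= Rabs U * (e * r))
    by (apply Rmult_le_compat_l; [apply Rabs_pos | assumption]).
  assert (S3 : Rabs P * Rabs (qc - c' * (y - t)) <= Rabs P * (e * r))
    by (apply Rmult_le_compat_l; [apply Rabs_pos | assumption]).
  assert (S4 : e * (Rabs qa + Rabs qb + Rabs qc)
     <= e * ((Rabs a' + 1) * r + (Rabs b' + 1) * r + (Rabs c' + 1) * r))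
    by (apply Rmult_le_compat_l; lra).
  assert (S5 : e * m * r <= eps * r) by (apply Rmult_le_compat_r; assumption).
  unfold m in S5. lra.
Qed.

Lemma chain2 (h hu hp : R -> R -> R) (b c : R -> R) t b' c' :
  cont2 h -> cont2 hu -> cont2 hp ->
  (forall u p, is_derive (fun s => h s p) u (hu u p)) ->
  (forall u p, is_derive (fun s => h u s) p (hp u p)) ->
  is_derive b t b' -> is_derive c t c' ->
  is_derive (fun s => h (b s) (c s)) t (hu (b t) (c t) * b' + hp (b t) (c t) * c').
Proof.
  intros Ch Cu Cp Du Dp Db Dc.
  replace (hu (b t) (c t) * b' + hp (b t) (c t) * c')
    with (0 * 0 + hu (b t) (c t) * b' + hp (b t) (c t) * c') by ring.
  apply (chain3 (fun _ => h) (fun _ _ _ => 0) (fun _ => hu) (fun _ => hp) (fun _ => 0)); auto.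
  1, 2, 3, 4: intros z; cont.
  - intros x u p. apply (is_derive_const (h u p)).
  - apply (is_derive_const (0 : R)).
Qed.

Lemma norm_triple (a b c : R) :
  let n := norm (V := prod_NormedModule _
      (prod_NormedModule _ R_NormedModule R_NormedModule) R_NormedModule) (a, b, c) in
  Rabs a <= n /\ Rabs b <= n /\ Rabs c <= n.
Proof.
  assert (A1 := proj1 (norm_prod (U := prod_NormedModule _ R_NormedModule R_NormedModule)
                         (V := R_NormedModule) (a, b) c)).
  assert (A2 := proj1 (norm_prod (U := R_NormedModule) (V := R_NormedModule) a b)).
  assert (B1 := Rle_trans _ _ _ (Rmax_l _ _) A1). assert (B2 := Rle_trans _ _ _ (Rmax_r _ _) A1).
  split; [|split]; [| |exact B2]; (eapply Rle_trans; [|exact B1]); (eapply Rle_trans; [|exact A2]).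
  - apply (Rmax_l (Rabs a) (Rabs b)).
  - apply (Rmax_r (Rabs a) (Rabs b)).
Qed.

(** The total differential relative to the slab is one-sided at [x = 0] and
    [x = 1]; it is obtained from the interior derivatives in [x] because these
    extend continuously to the boundary as [hx]. *)
Lemma C1_xup_of_partials (h hx hu hp : R -> R -> R -> R) :
  cont3 h -> cont3 hx -> cont3 hu -> cont3 hp ->
  (forall x u p : R, 0 < x < 1 -> is_derive (fun s => h s u p) x (hx x u p)) ->
  (forall x u p : R, 0 <= x <= 1 -> is_derive (fun s => h x s p) u (hu x u p)) ->
  (forall x u p : R, 0 <= x <= 1 -> is_derive (fun s => h x u s) p (hp x u p)) ->
  C1_xup h.
Proof.
  intros Ch Cx Cu Cp Dx Du Dp.
  exists (fun z v => hx (fst (fst z)) (snd (fst z)) (snd z) * fst (fst v)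
            + hu (fst (fst z)) (snd (fst z)) (snd z) * snd (fst v)
            + hp (fst (fst z)) (snd (fst z)) (snd z) * snd v).
  intros [[x u] p] Jx. split.
  2:{ intros v Q HQ.
      assert (HC : continuous (fun z : R * R * R =>
         hx (fst (fst z)) (snd (fst z)) (snd z) * fst (fst v)
            + hu (fst (fst z)) (snd (fst z)) (snd z) * snd (fst v)
            + hp (fst (fst z)) (snd (fst z)) (snd z) * snd v) (x, u, p)).
      { cont; apply continuous_cst. }
      generalize (HC Q HQ). unfold filtermap, within. apply filter_imp. auto. }
  split.
  { apply Build_is_linear; simpl.
    - intros [[v1 v2] v3] [[w1 w2] w3]. unfold plus; simpl. unfold plus; simpl. ring.
    - intros k [[v1 v2] v3]. unfold scal; simpl. unfold scal; simpl. unfold mult; simpl. ring.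
    - exists (Rabs (hx x u p) + Rabs (hu x u p) + Rabs (hp x u p) + 1). split.
      + generalize (Rabs_pos (hx x u p)) (Rabs_pos (hu x u p)) (Rabs_pos (hp x u p)). lra.
      + intros [[v1 v2] v3]. simpl.
        destruct (norm_triple v1 v2 v3) as [N1 [N2 N3]].
        set (n := norm _) in N1, N2, N3. change (norm (v1, v2, v3)) with n.
        match goal with |- norm ?q <= _ => change (norm q) with (Rabs q) end.
        assert (Hn : 0 <= n) by (generalize (Rabs_pos v3); lra).
        eapply Rle_trans; [apply Rabs_triang|].
        eapply Rle_trans; [apply Rplus_le_compat_r, Rabs_triang|].
        rewrite !Rabs_mult.
        assert (Rabs (hx x u p) * Rabs v1 <= Rabs (hx x u p) * n)
          by (apply Rmult_le_compat_l; [apply Rabs_pos | lra]).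
        assert (Rabs (hu x u p) * Rabs v2 <= Rabs (hu x u p) * n)
          by (apply Rmult_le_compat_l; [apply Rabs_pos | lra]).
        assert (Rabs (hp x u p) * Rabs v3 <= Rabs (hp x u p) * n)
          by (apply Rmult_le_compat_l; [apply Rabs_pos | lra]).
        lra. }
  intros z Hz.
  assert (Hz' : (x, u, p) = z).
  { symmetry. apply (eq_close (V := prod_NormedModule _
      (prod_NormedModule _ R_NormedModule R_NormedModule) R_NormedModule)).
    intros e. assert (T := Hz _ (locally_ball z e)).
    exact (locally_singleton _ _ T Jx). }
  subst z. intros eps.
  assert (He : 0 < eps / 3) by (generalize (cond_pos eps); lra).
  destruct (total_differential (fun x => 0 <= x <= 1) h hx hu hp Ch Cx Cu Cp) with
    (x := x) (u := u) (p := p) (eps := eps / 3) as [d [Hd HD]]; auto.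
  { intros y y' y'' v w Hy Hy' Hyy. apply Dx.
    assert (T1 := Rmin_glb y y' 0). assert (T2 := Rmax_lub y y' 1). lra. }
  exists (mkposreal d Hd). intros [[x' u'] p'] [[B1 B2] B3] Jx'.
  specialize (HD x' u' p' Jx' B1 B2 B3).
  match goal with |- norm ?q <= _ => change (norm q) with (Rabs q) end.
  unfold minus, plus, opp; simpl. unfold plus, opp; simpl.
  eapply Rle_trans; [right; apply f_equal|eapply Rle_trans; [exact HD|]].
  { unfold Rminus. ring. }
  destruct (norm_triple (x' + - x) (u' + - u) (p' + - p)) as [N1 [N2 N3]].
  set (n := norm _) in N1, N2, N3.
  match goal with |- _ <= _ * ?q => change q with n end.
  unfold Rminus.
  replace (eps * n) with (eps / 3 * (n + n + n)) by field.
  apply Rmult_le_compat_l; lra.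
Qed.

(** * Ordinary differential equations depending on a parameter *)

(** Integration divides the weighted norm [sup |f(s)| exp(-a|s|)] by [a]; for
    large [a] this makes the Picard iteration a contraction on the whole line. *)
Lemma RInt_exp_bound (f : R -> R) c a t :
  0 < a -> (forall x, continuous f x) ->
  (forall s, Rabs (f s) <= c * exp (a * Rabs s)) ->
  Rabs (RInt f 0 t) <= c / a * exp (a * Rabs t).
Proof.
  intros Ha Hf Hb.
  assert (Hc : 0 <= c).
  { specialize (Hb 0). rewrite Rabs_R0, Rmult_0_r, exp_0 in Hb.
    assert (T := Rabs_pos (f 0)). lra. }
  assert (Hca : 0 <= c / a) by (apply Rdiv_le_0_compat; lra).
  (* the two signs of [t] differ only by the sign of the exponent *)
  assert (Hmain : forall e lo hi, (e = 1 \/ e = -1) -> lo <= hi ->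
     (forall s, lo <= s <= hi -> Rabs s = e * s) ->
     Rabs (RInt f lo hi) <= c / a * e * (exp (a * (e * hi)) - exp (a * (e * lo)))).
  { intros e lo hi He Hl Hs.
    assert (Hi : is_RInt (fun s => c * exp (a * (e * s))) lo hi
        (c / a * e * (exp (a * (e * hi)) - exp (a * (e * lo))))).
    { replace (c / a * e * (exp (a * (e * hi)) - exp (a * (e * lo))))
        with (minus (c / a * e * exp (a * (e * hi))) (c / a * e * exp (a * (e * lo)))).
      2:{ unfold minus, plus, opp; simpl; ring. }
      apply (is_RInt_derive (V := R_CompleteNormedModule)
        (fun s => c / a * e * exp (a * (e * s)))).
      - intros x _. auto_derive; [trivial|].
        destruct He as [-> | ->]; field; lra.
      - intros x _. apply continuous_mul; [apply (continuous_cst c)|].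
        apply continuous_expf. cont. }
    rewrite <- (is_RInt_unique _ _ _ _ Hi).
    eapply Rle_trans; [apply abs_RInt_le; [exact Hl | apply ex_RInt_cont, Hf]|].
    apply RInt_le; [exact Hl | | eexists; exact Hi |].
    - apply ex_RInt_cont. intros x. apply (continuous_R Rabs); [|apply Hf].
      apply continuity_pt_filterlim, Rcontinuity_abs.
    - intros x Hx. rewrite <- Hs by lra. apply Hb. }
  destruct (Rle_dec 0 t) as [Ht|Ht].
  - eapply Rle_trans; [apply (Hmain 1 0 t); [auto | exact Ht |]|].
    + intros s Hs. rewrite Rabs_pos_eq; lra.
    + rewrite (Rabs_pos_eq t Ht). rewrite !Rmult_1_l, !Rmult_1_r, Rmult_0_r, exp_0.
      apply Rmult_le_compat_l; [exact Hca | lra].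
  - rewrite <- (opp_RInt_swap (V := R_CompleteNormedModule))
      by (apply ex_RInt_cont, Hf).
    unfold opp; simpl. rewrite Rabs_Ropp.
    eapply Rle_trans; [apply (Hmain (-1) t 0); [auto | lra |]|].
    + intros s Hs. rewrite Rabs_left1; lra.
    + rewrite (Rabs_left1 t) by lra.
      replace (a * (-1 * 0)) with 0 by ring. rewrite exp_0.
      replace (a * (-1 * t)) with (a * - t) by ring.
      assert (T := exp_pos (a * - t)). nra.
Qed.

Lemma geometric_limit (a : nat -> R) c :
  (forall n, Rabs (a (S n) - a n) <= c * / 2 ^ n) ->
  forall n, Rabs (real (Lim_seq a) - a n) <= 2 * c * / 2 ^ n.
Proof.
  intros H.
  assert (P2 : forall n, 0 < / 2 ^ n) by (intros n; apply Rinv_0_lt_compat, pow_lt; lra).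
  assert (Hk : forall n k, Rabs (a (n + k)%nat - a n) <= 2 * c * (/ 2 ^ n - / 2 ^ (n + k))).
  { intros n k. induction k as [|k IH].
    - rewrite Nat.add_0_r. replace (a n - a n) with 0 by ring. rewrite Rabs_R0. lra.
    - rewrite Nat.add_succ_r. specialize (H (n + k)%nat).
      assert (E : / 2 ^ (n + k) = 2 * / 2 ^ S (n + k)).
      { simpl. rewrite Rinv_mult. field. apply pow_nonzero; lra. }
      replace (a (S (n + k)) - a n) with ((a (S (n + k)) - a (n + k)%nat) + (a (n + k)%nat - a n))
        by ring.
      eapply Rle_trans; [apply Rabs_triang|]. rewrite E in *. lra. }
  assert (Hc : 0 <= c).
  { specialize (H O). simpl in H. assert (T := Rabs_pos (a 1%nat - a 0%nat)). lra. }
  assert (Hk' : forall n k, Rabs (a (n + k)%nat - a n) <= 2 * c * / 2 ^ n).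
  { intros n k. eapply Rle_trans; [apply Hk|].
    assert (T := P2 (n + k)%nat). nra. }
  assert (Hlim : is_lim_seq a (Finite (real (Lim_seq a)))).
  { apply Lim_seq_correct'. apply ex_lim_seq_cauchy_corr. intros eps.
    assert (Hg : is_lim_seq (fun n => 2 * c * (/ 2) ^ n) (2 * c * 0)).
    { apply (is_lim_seq_scal_l _ (2 * c) 0). apply is_lim_seq_geom. rewrite Rabs_pos_eq; lra. }
    rewrite Rmult_0_r in Hg.
    apply is_lim_seq_spec in Hg.
    destruct (Hg (mkposreal _ (is_pos_div_2 eps))) as [N HN]. exists N.
    specialize (HN N (le_n N)). simpl in HN. rewrite Rminus_0_r, pow_inv in HN.
    apply Rle_lt_trans with (1 := Rle_abs _) in HN.
    intros n m Hn Hm.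
    assert (A := Hk' N (n - N)%nat). assert (B := Hk' N (m - N)%nat).
    replace (N + (n - N))%nat with n in A by lia.
    replace (N + (m - N))%nat with m in B by lia.
    replace (a n - a m) with ((a n - a N) - (a m - a N)) by ring.
    eapply Rle_lt_trans; [apply Rabs_triang|]. rewrite Rabs_Ropp. lra. }
  intros n.
  assert (Hl2 : is_lim_seq (fun k => Rabs (a (n + k)%nat - a n)) (Rabs (real (Lim_seq a) - a n))).
  { apply (is_lim_seq_abs _ (Finite (real (Lim_seq a) - a n))).
    apply is_lim_seq_minus'; [|apply is_lim_seq_const].
    apply (is_lim_seq_ext (fun k => a (k + n)%nat)); [intros; f_equal; lia|].
    apply is_lim_seq_incr_n. exact Hlim. }
  apply (is_lim_seq_le _ _ (Finite _) (Finite (2 * c * / 2 ^ n)) (Hk' n) Hl2).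
  apply is_lim_seq_const.
Qed.

(** Right-hand side of [U' = P], [P' = H z s U P] with parameter [z] and time
    [s]; the constant [K] serves for all parameters and times, so that
    solutions are global. *)
Record lipschitz_field {A : UniformSpace} (H : A -> R -> R -> R -> R) (K : R) : Prop := {
  lf_cont : cont4 H;
  lf_lip : forall z s u p u' p',
    Rabs (H z s u p - H z s u' p') <= K * (Rabs (u - u') + Rabs (p - p'));
  lf_zero : forall z s, Rabs (H z s 0 0) <= K
}.

Fixpoint picard {A : UniformSpace} (H : A -> R -> R -> R -> R) (u0 p0 : A -> R)
    (n : nat) (z : A) (t : R) : R * R :=
  match n with
  | O => (u0 z, p0 z)
  | S m =>
      (u0 z + RInt (fun s => snd (picard H u0 p0 m z s)) 0 t,
       p0 z + RInt (fun s => H z s (fst (picard H u0 p0 m z s))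
                                   (snd (picard H u0 p0 m z s))) 0 t)
  end.

Lemma lf_nonneg {A : UniformSpace} (H : A -> R -> R -> R -> R) K (z : A) :
  lipschitz_field H K -> 0 <= K.
Proof. intros L. eapply Rle_trans; [apply Rabs_pos | apply (lf_zero H K L z 0)]. Qed.

Lemma lf_growth {A : UniformSpace} (H : A -> R -> R -> R -> R) K z s u p :
  lipschitz_field H K -> Rabs (H z s u p) <= K * (1 + Rabs u + Rabs p).
Proof.
  intros L. assert (A1 := lf_lip _ _ L z s u p 0 0). assert (A2 := lf_zero _ _ L z s).
  rewrite !Rminus_0_r in A1.
  replace (H z s u p) with ((H z s u p - H z s 0 0) + H z s 0 0) by ring.
  eapply Rle_trans; [apply Rabs_triang|]. lra.
Qed.

Lemma picard_cont {A : UniformSpace} (H : A -> R -> R -> R -> R) u0 p0 :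
  cont4 H -> (forall z, continuous u0 z) -> (forall z, continuous p0 z) ->
  forall n, cont2 (fun z t => fst (picard H u0 p0 n z t)) /\
            cont2 (fun z t => snd (picard H u0 p0 n z t)).
Proof.
  intros HH Hu Hp n.
  assert (Hu' : cont2 (fun (z : A) (_ : R) => u0 z)).
  { intros w. apply (continuous_comp fst u0); [cont | apply Hu]. }
  assert (Hp' : cont2 (fun (z : A) (_ : R) => p0 z)).
  { intros w. apply (continuous_comp fst p0); [cont | apply Hp]. }
  induction n as [|n [IH1 IH2]].
  - split; assumption.
  - split; intros w; simpl; apply continuous_add.
    + apply Hu'.
    + apply (cont2_RInt (fun z s => snd (picard H u0 p0 n z s)) IH2 w).
    + apply Hp'.
    + apply (cont2_RInt (fun z s => H z s (fst (picard H u0 p0 n z s))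
                                   (snd (picard H u0 p0 n z s)))).
      intros v. apply (cont4_comp H); [exact HH | cont | cont | apply IH1 | apply IH2].
Qed.

Lemma picard_slices {A : UniformSpace} (H : A -> R -> R -> R -> R) u0 p0 z n :
  cont4 H -> (forall z, continuous u0 z) -> (forall z, continuous p0 z) ->
  forall x, continuous (fun t => fst (picard H u0 p0 n z t)) x /\
    continuous (fun t => snd (picard H u0 p0 n z t)) x /\
    continuous (fun s => H z s (fst (picard H u0 p0 n z s)) (snd (picard H u0 p0 n z s))) x.
Proof.
  intros HH Hu Hp x. destruct (picard_cont H u0 p0 HH Hu Hp n) as [C1 C2].
  assert (H1 := continuous_slice _ z x (C1 (z, x))). assert (H2 := continuous_slice _ z x (C2 (z, x))).
  cbv beta in H1, H2. split; [exact H1|]. split; [exact H2|].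
  apply (cont4_comp H); [exact HH | cont | cont | exact H1 | exact H2].
Qed.

(** With the weight [a = 2(1+K)] every iteration halves the distance. *)
Lemma picard_step {A : UniformSpace} (H : A -> R -> R -> R -> R) K u0 p0 :
  lipschitz_field H K -> (forall z, continuous u0 z) -> (forall z, continuous p0 z) ->
  forall n z t,
    Rabs (fst (picard H u0 p0 (S n) z t) - fst (picard H u0 p0 n z t)) +
    Rabs (snd (picard H u0 p0 (S n) z t) - snd (picard H u0 p0 n z t))
    <= (1 + Rabs (u0 z) + Rabs (p0 z)) * / 2 ^ n * exp (2 * (1 + K) * Rabs t).
Proof.
  intros L Hu Hp n z.
  assert (HK := lf_nonneg H K z L).
  assert (HC := fun n => picard_slices H u0 p0 z n (lf_cont _ _ L) Hu Hp).
  assert (HC1 := fun n x => proj1 (HC n x)). assert (HC2 := fun n x => proj1 (proj2 (HC n x))).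
  assert (HC3 := fun n x => proj2 (proj2 (HC n x))). clear HC.
  set (c := 1 + Rabs (u0 z) + Rabs (p0 z)).
  assert (Pu := Rabs_pos (u0 z)). assert (Pp := Rabs_pos (p0 z)).
  assert (He : forall s, 1 <= exp (2 * (1 + K) * Rabs s)).
  { intros s.
    assert (T := exp_ineq1_le (2 * (1 + K) * Rabs s)).
    assert (T2 := Rabs_pos s). nra. }
  induction n as [|n IH]; intros t.
  - simpl picard. simpl fst. simpl snd. simpl pow. rewrite Rinv_1, Rmult_1_r.
    set (I1 := RInt _ 0 t). set (I2 := RInt _ 0 t).
    replace (u0 z + I1 - u0 z) with I1 by Rring.
    replace (p0 z + I2 - p0 z) with I2 by Rring.
    assert (B1 : Rabs I1 <= c / (2 * (1 + K)) * exp (2 * (1 + K) * Rabs t)).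
    { apply RInt_exp_bound; [lra | intros; apply continuous_cst |].
      intros s. specialize (He s). unfold c. nra. }
    assert (B2 : Rabs I2 <= K * c / (2 * (1 + K)) * exp (2 * (1 + K) * Rabs t)).
    { apply RInt_exp_bound; [lra | intros; apply (HC3 O) |].
      intros s. specialize (He s). simpl.
      eapply Rle_trans; [apply (lf_growth H K); exact L|]. fold c.
      assert (0 <= K * c) by (unfold c; nra). nra. }
    eapply Rle_trans; [apply Rplus_le_compat; [apply B1 | apply B2]|].
    rewrite <- Rmult_plus_distr_r. apply Rmult_le_compat_r; [left; apply exp_pos|].
    replace (c / (2 * (1 + K)) + K * c / (2 * (1 + K))) with (c / 2) by (field; lra).
    unfold c; lra.
  - set (d := c * / 2 ^ n) in IH.
    assert (B1 : Rabs (fst (picard H u0 p0 (S (S n)) z t) - fst (picard H u0 p0 (S n) z t))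
       <= d / (2 * (1 + K)) * exp (2 * (1 + K) * Rabs t)).
    { change (fst (picard H u0 p0 (S (S n)) z t)) with
        (u0 z + RInt (fun s => snd (picard H u0 p0 (S n) z s)) 0 t).
      change (fst (picard H u0 p0 (S n) z t)) with
        (u0 z + RInt (fun s => snd (picard H u0 p0 n z s)) 0 t).
      replace (u0 z + RInt (fun s => snd (picard H u0 p0 (S n) z s)) 0 t -
         (u0 z + RInt (fun s => snd (picard H u0 p0 n z s)) 0 t))
       with (RInt (fun s => snd (picard H u0 p0 (S n) z s) - snd (picard H u0 p0 n z s)) 0 t).
      2:{ rewrite RInt_sub; [Rring | apply ex_RInt_cont, HC2 | apply ex_RInt_cont, HC2]. }
      apply RInt_exp_bound; [lra | |].
      - intros x. apply continuous_sub; apply HC2.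
      - intros s. specialize (IH s).
        assert (T := Rabs_pos (fst (picard H u0 p0 (S n) z s) - fst (picard H u0 p0 n z s))).
        lra. }
    assert (B2 : Rabs (snd (picard H u0 p0 (S (S n)) z t) - snd (picard H u0 p0 (S n) z t))
       <= K * d / (2 * (1 + K)) * exp (2 * (1 + K) * Rabs t)).
    { change (snd (picard H u0 p0 (S (S n)) z t)) with
        (p0 z + RInt (fun s => H z s (fst (picard H u0 p0 (S n) z s))
              (snd (picard H u0 p0 (S n) z s))) 0 t).
      change (snd (picard H u0 p0 (S n) z t)) with
        (p0 z + RInt (fun s => H z s (fst (picard H u0 p0 n z s))
              (snd (picard H u0 p0 n z s))) 0 t).
      match goal with |- Rabs (p0 z + RInt ?f 0 t - (p0 z + RInt ?g 0 t)) <= _ =>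
        replace (p0 z + RInt f 0 t - (p0 z + RInt g 0 t))
          with (RInt (fun s => f s - g s) 0 t) end.
      2:{ rewrite RInt_sub; [Rring | apply ex_RInt_cont, HC3 | apply ex_RInt_cont, HC3]. }
      apply RInt_exp_bound; [lra | |].
      - intros x. apply continuous_sub; apply HC3.
      - intros s. specialize (IH s). cbv beta.
        eapply Rle_trans; [apply (lf_lip H K L)|].
        rewrite Rmult_assoc. apply Rmult_le_compat_l; [exact HK | exact IH]. }
    eapply Rle_trans; [apply Rplus_le_compat; [apply B1 | apply B2]|].
    rewrite <- Rmult_plus_distr_r. apply Rmult_le_compat_r; [left; apply exp_pos|].
    right. unfold d. simpl pow. field. split; [apply pow_nonzero; lra | lra].
Qed.

(** Picard's theorem with parameters.  The iterates converge at a geometric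
    rate in the weighted norm, locally uniformly in the parameter, so that the
    solution is continuous in parameter and time together.  The parameter
    space is arbitrary because the theorem serves twice: for the flow, with
    the initial data as parameter, and for its divided differences, where the
    increment of the data is a further parameter. *)
Theorem ode_solution {A : UniformSpace} (H : A -> R -> R -> R -> R) K (u0 p0 : A -> R) :
  lipschitz_field H K -> (forall z, continuous u0 z) -> (forall z, continuous p0 z) ->
  exists U P : A -> R -> R,
    cont2 U /\ cont2 P /\
    forall z, U z 0 = u0 z /\ P z 0 = p0 z /\
      forall t, is_derive (U z) t (P z t) /\ is_derive (P z) t (H z t (U z t) (P z t)).
Proof.
  intros L Hu Hp.
  assert (HC := picard_cont H u0 p0 (lf_cont _ _ L) Hu Hp).
  assert (Hstep := picard_step H K u0 p0 L Hu Hp).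
  set (c := fun z => 1 + Rabs (u0 z) + Rabs (p0 z)).
  assert (Hcpos : forall z, 0 <= c z).
  { intros z. unfold c. assert (T1 := Rabs_pos (u0 z)). assert (T2 := Rabs_pos (p0 z)). lra. }
  set (e := fun t => exp (2 * (1 + K) * Rabs t)).
  assert (Hce : cont2 (fun z t => 2 * (c z * e t))).
  { intros w.
    assert (Hab : forall (f : A * R -> R), continuous f w -> continuous (fun v => Rabs (f v)) w).
    { intros f Hf. apply (continuous_R Rabs); [|exact Hf].
      apply continuity_pt_filterlim, Rcontinuity_abs. }
    unfold c, e. cont; apply Hab; cont.
    - apply (continuous_comp fst u0); [cont | apply Hu].
    - apply (continuous_comp fst p0); [cont | apply Hp]. }
  assert (Hlim : forall Y : nat -> A -> R -> R,
    (forall n, cont2 (Y n)) ->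
    (forall n z t, Rabs (Y (S n) z t - Y n z t) <= c z * e t * / 2 ^ n) ->
    exists Z : A -> R -> R, cont2 Z /\
      forall n z t, Rabs (Z z t - Y n z t) <= 2 * (c z * e t) * / 2 ^ n).
  { intros Y HY HYs. exists (fun z t => real (Lim_seq (fun n => Y n z t))).
    assert (HZ : forall n z t, Rabs (real (Lim_seq (fun n => Y n z t)) - Y n z t)
                  <= 2 * (c z * e t) * / 2 ^ n).
    { intros n z t. apply (geometric_limit (fun n => Y n z t)). intros m. apply HYs. }
    split; [|exact HZ].
    intros [z0 t0]. apply continuous_eps. intros eps Heps.
    set (m := 2 * (c z0 * e t0) + 1).
    assert (Hm : 0 < m).
    { unfold m. assert (T := exp_pos (2 * (1 + K) * Rabs t0)).
      assert (T2 := Hcpos z0). fold (e t0) in T. nra. }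
    destruct (pow_lt_1_zero (/ 2)) with (y := eps / (4 * m)) as [n Hn].
    { rewrite Rabs_pos_eq; lra. }
    { apply Rdiv_lt_0_compat; lra. }
    specialize (Hn n (le_n n)). rewrite pow_inv in Hn.
    rewrite Rabs_pos_eq in Hn by (left; apply Rinv_0_lt_compat, pow_lt; lra).
    assert (Hn' : m * / 2 ^ n < eps / 4).
    { apply Rmult_lt_compat_l with (r := m) in Hn; [|exact Hm].
      replace (m * (eps / (4 * m))) with (eps / 4) in Hn by (field; lra). exact Hn. }
    assert (P2 : 0 < / 2 ^ n) by (apply Rinv_0_lt_compat, pow_lt; lra).
    assert (He4 : 0 < eps / 4) by lra.
    generalize (filter_and _ _ (proj1 (continuous_eps _ _) (Hce (z0, t0)) 1 Rlt_0_1)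
                 (proj1 (continuous_eps _ _) (HY n (z0, t0)) _ He4)).
    apply filter_imp. intros [z t] [V1 V2].
    assert (Z1 := HZ n z t). assert (Z2 := HZ n z0 t0).
    simpl in V1, V2. apply Rabs_def2 in V1. destruct V1.
    assert (W1 : 2 * (c z * e t) * / 2 ^ n <= m * / 2 ^ n).
    { apply Rmult_le_compat_r; [lra | unfold m; lra]. }
    assert (W2 : 2 * (c z0 * e t0) * / 2 ^ n <= m * / 2 ^ n).
    { apply Rmult_le_compat_r; [lra | unfold m; lra]. }
    set (z1 := real (Lim_seq (fun n => Y n z t))) in *.
    set (z2 := real (Lim_seq (fun n => Y n z0 t0))) in *.
    apply Rabs_le_between in Z1. apply Rabs_le_between in Z2. apply Rabs_def2 in V2.
    destruct Z1, Z2, V2.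
    change (Rabs (z1 - z2) < eps). apply Rabs_def1; lra. }
  destruct (Hlim (fun n z t => fst (picard H u0 p0 n z t))) as [U [HU HUn]].
  { intros n; apply HC. }
  { intros n z t. specialize (Hstep n z t).
    assert (T := Rabs_pos (snd (picard H u0 p0 (S n) z t) - snd (picard H u0 p0 n z t))).
    unfold c, e. lra. }
  destruct (Hlim (fun n z t => snd (picard H u0 p0 n z t))) as [P [HP HPn]].
  { intros n; apply HC. }
  { intros n z t. specialize (Hstep n z t).
    assert (T := Rabs_pos (fst (picard H u0 p0 (S n) z t) - fst (picard H u0 p0 n z t))).
    unfold c, e. lra. }
  exists U, P. split; [exact HU|]. split; [exact HP|]. intros z.
  assert (HK := lf_nonneg H K z L).
  assert (HUc : forall t, continuous (U z) t) by (intros; apply continuous_slice, HU).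
  assert (HPc : forall t, continuous (P z) t) by (intros; apply continuous_slice, HP).
  assert (HHc : forall t, continuous (fun s => H z s (U z s) (P z s)) t).
  { intros t. apply (cont4_comp H); [apply L | cont | cont | apply HUc | apply HPc]. }
  assert (HS := fun n => picard_slices H u0 p0 z n (lf_cont _ _ L) Hu Hp).
  assert (HC1 := fun n x => proj1 (HS n x)). assert (HC2 := fun n x => proj1 (proj2 (HS n x))).
  assert (HC3 := fun n x => proj2 (proj2 (HS n x))). clear HS.
  assert (Hzero : forall a m, (forall n, Rabs a <= m * / 2 ^ n) -> a = 0).
  { intros a m Ha. apply Rabs_eq_0. apply Rle_antisym; [|apply Rabs_pos].
    apply le_epsilon. intros eps Heps. rewrite Rplus_0_l.
    assert (Hm : 0 <= m). { specialize (Ha O). simpl in Ha. assert (T := Rabs_pos a). lra. }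
    destruct (pow_lt_1_zero (/ 2)) with (y := eps / (m + 1)) as [n Hn].
    { rewrite Rabs_pos_eq; lra. }
    { apply Rdiv_lt_0_compat; lra. }
    specialize (Hn n (le_n n)). rewrite pow_inv in Hn.
    assert (P2 : 0 < / 2 ^ n) by (apply Rinv_0_lt_compat, pow_lt; lra).
    rewrite Rabs_pos_eq in Hn by lra.
    apply Rmult_lt_compat_l with (r := m + 1) in Hn; [|lra].
    replace ((m + 1) * (eps / (m + 1))) with eps in Hn by (field; lra).
    specialize (Ha n). lra. }
  assert (Hpass : forall (X f : R -> R) x0 (Xn fn : nat -> R -> R) (m1 : R -> R) m2,
    (forall x, continuous f x) -> (forall n x, continuous (fn n) x) ->
    (forall n t, Rabs (X t - Xn (S n) t) <= m1 t * / 2 ^ S n) -> (forall t, 0 <= m1 t) ->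
    (forall n t, Xn (S n) t = x0 + RInt (fn n) 0 t) ->
    (forall n s, Rabs (f s - fn n s) <= m2 * / 2 ^ n * e s) ->
    forall t, X t = x0 + RInt f 0 t).
  { intros X f x0 Xn fn m1 m2 Cf Cfn HX Hm1 HXn Hf t. apply Rminus_diag_uniq.
    apply (Hzero _ (m1 t + m2 / (2 * (1 + K)) * e t)). intros n.
    assert (A1 := HX n t). rewrite HXn in A1. specialize (Hm1 t).
    assert (A2 : Rabs (RInt (fun s => f s - fn n s) 0 t) <= m2 * / 2 ^ n / (2 * (1 + K)) * e t).
    { apply RInt_exp_bound; [lra | intros; apply continuous_sub; auto | apply Hf]. }
    rewrite RInt_sub in A2 by (apply ex_RInt_cont; auto).
    replace (X t - (x0 + RInt f 0 t))
      with ((X t - (x0 + RInt (fn n) 0 t)) - (RInt f 0 t - RInt (fn n) 0 t)) by ring.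
    eapply Rle_trans; [apply Rabs_triang|]. rewrite Rabs_Ropp.
    assert (P2 : 0 < 2 ^ n) by (apply pow_lt; lra).
    assert (E1 : m1 t * / 2 ^ S n <= m1 t * / 2 ^ n).
    { apply Rmult_le_compat_l; [exact Hm1|]. apply Rinv_le_contravar; [exact P2 | simpl; lra]. }
    replace ((m1 t + m2 / (2 * (1 + K)) * e t) * / 2 ^ n)
      with (m1 t * / 2 ^ n + m2 * / 2 ^ n / (2 * (1 + K)) * e t) by (field; lra).
    lra. }
  assert (Hm1 : forall t, 0 <= 2 * (c z * e t)).
  { intros t. assert (T := exp_pos (2 * (1 + K) * Rabs t)). fold (e t) in T.
    specialize (Hcpos z). nra. }
  assert (HUe : forall t, U z t = u0 z + RInt (P z) 0 t).
  { apply (Hpass _ _ _ (fun n t => fst (picard H u0 p0 n z t))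
      (fun n s => snd (picard H u0 p0 n z s)) (fun t => 2 * (c z * e t)) (2 * c z)); auto.
    intros n s. assert (T := HPn n z s). lra. }
  assert (HPe : forall t, P z t = p0 z + RInt (fun s => H z s (U z s) (P z s)) 0 t).
  { apply (Hpass _ _ _ (fun n t => snd (picard H u0 p0 n z t))
      (fun n s => H z s (fst (picard H u0 p0 n z s)) (snd (picard H u0 p0 n z s)))
      (fun t => 2 * (c z * e t)) (K * (4 * c z))); auto.
    intros n s. assert (T := HPn n z s). assert (T' := HUn n z s).
    eapply Rle_trans; [apply (lf_lip H K L)|].
    rewrite !Rmult_assoc. apply Rmult_le_compat_l; [exact HK | lra]. }
  split; [rewrite HUe, RInt_point; unfold zero; simpl; ring|].
  split; [rewrite HPe, RInt_point; unfold zero; simpl; ring|].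
  intros t. split.
  - apply (is_derive_ext (fun t => u0 z + RInt (P z) 0 t)); [intros; symmetry; apply HUe|].
    replace (P z t) with (plus 0 (P z t)) by (unfold plus; simpl; ring).
    apply (is_derive_plus (V := R_NormedModule)); [apply (is_derive_const (u0 z))|].
    apply is_derive_RInt_0. exact HPc.
  - apply (is_derive_ext (fun t => p0 z + RInt (fun s => H z s (U z s) (P z s)) 0 t));
      [intros; symmetry; apply HPe|].
    replace (H z t (U z t) (P z t)) with (plus 0 (H z t (U z t) (P z t)))
      by (unfold plus; simpl; ring).
    apply (is_derive_plus (V := R_NormedModule)); [apply (is_derive_const (p0 z))|].
    apply (is_derive_RInt_0 (fun s => H z s (U z s) (P z s))). exact HHc.
Qed.

Lemma is_derive_eq (f : R -> R) x l l' : is_derive f x l -> l = l' -> is_derive f x l'.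
Proof. intros H <-; exact H. Qed.

(** Gronwall's argument for the squared distance [E] of two solutions, whose
    derivative is bounded by [(1+3K) E]. *)
Lemma ode_unique (H : R -> R -> R -> R) K (U P U' P' : R -> R) :
  0 <= K ->
  (forall s u p u' p', Rabs (H s u p - H s u' p') <= K * (Rabs (u - u') + Rabs (p - p'))) ->
  (forall t, is_derive U t (P t) /\ is_derive P t (H t (U t) (P t))) ->
  (forall t, is_derive U' t (P' t) /\ is_derive P' t (H t (U' t) (P' t))) ->
  U 0 = U' 0 -> P 0 = P' 0 -> forall t, U t = U' t /\ P t = P' t.
Proof.
  intros HK HL S1 S2 E1 E2.
  set (C := 1 + 3 * K).
  set (E := fun t => (U t - U' t) ^ 2 + (P t - P' t) ^ 2).
  set (dE := fun t => 2 * (U t - U' t) * (P t - P' t)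
      + 2 * (P t - P' t) * (H t (U t) (P t) - H t (U' t) (P' t))).
  assert (HE : forall t, is_derive E t (dE t)).
  { intros t. destruct (S1 t) as [A1 A2]. destruct (S2 t) as [B1 B2].
    unfold E, dE. auto_derive.
    - repeat split; eexists; eassumption.
    - replace (Derive (fun x => U x) t) with (P t) by (symmetry; apply is_derive_unique, A1).
      replace (Derive (fun x => U' x) t) with (P' t) by (symmetry; apply is_derive_unique, B1).
      replace (Derive (fun x => P x) t) with (H t (U t) (P t))
        by (symmetry; apply is_derive_unique, A2).
      replace (Derive (fun x => P' x) t) with (H t (U' t) (P' t))
        by (symmetry; apply is_derive_unique, B2).
      ring. }
  assert (Hb : forall t, Rabs (dE t) <= C * E t).
  { intros t. unfold dE, E, C. specialize (HL t (U t) (P t) (U' t) (P' t)).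
    set (a := U t - U' t) in *. set (b := P t - P' t) in *.
    set (q := H t (U t) (P t) - H t (U' t) (P' t)) in *.
    eapply Rle_trans; [apply Rabs_triang|]. rewrite !Rabs_mult, (Rabs_pos_eq 2) by lra.
    rewrite <- (pow2_abs a), <- (pow2_abs b).
    assert (Pa := Rabs_pos a). assert (Pb := Rabs_pos b).
    set (x := Rabs a) in *. set (y := Rabs b) in *.
    assert (T : y * Rabs q <= y * (K * (x + y))) by (apply Rmult_le_compat_l; assumption).
    assert (0 <= (x - y) ^ 2) by apply pow2_ge_0.
    assert (0 <= K * (x - y) ^ 2) by (apply Rmult_le_pos; [exact HK | apply pow2_ge_0]).
    assert (0 <= K * x ^ 2) by (apply Rmult_le_pos; [exact HK | apply pow2_ge_0]).
    nra. }
  assert (E00 : E 0 = 0) by (unfold E; rewrite E1, E2; ring).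
  assert (Epos : forall t, 0 <= E t).
  { intros t. unfold E. generalize (pow2_ge_0 (U t - U' t)) (pow2_ge_0 (P t - P' t)). lra. }
  (* [E exp(-Ct)] decreases and [E exp(Ct)] increases *)
  assert (Hd : forall c t, is_derive (fun t => E t * exp (c * t)) t
             ((dE t + c * E t) * exp (c * t))).
  { intros c t. auto_derive; [eexists; apply HE|].
    replace (Derive (fun x => E x) t) with (dE t) by (symmetry; apply is_derive_unique, HE). ring. }
  assert (Ez : forall t, E t = 0).
  { intros t. apply Rle_antisym; [|apply Epos].
    set (c := if Rle_dec 0 t then - C else C).
    destruct (MVT_open (fun t => E t * exp (c * t)) (fun t => (dE t + c * E t) * exp (c * t)) 0 t)
      as [s [Hs Es]].
    { intros x _. apply Hd. }
    { intros x. eapply continuous_of_derive, Hd. }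
    rewrite E00, Rmult_0_l, !Rminus_0_r in Es.
    assert (Hp := exp_pos (c * t)). assert (Hq := exp_pos (c * s)).
    specialize (Hb s). apply Rabs_le_between in Hb.
    assert (Hneg : (dE s + c * E s) * exp (c * s) * t <= 0).
    { unfold c in *. destruct (Rle_dec 0 t).
      - assert (0 <= - ((dE s + - C * E s) * exp (- C * s)) * t)
          by (apply Rmult_le_pos; [|lra]; nra). lra.
      - assert (0 <= ((dE s + C * E s) * exp (C * s)) * (- t))
          by (apply Rmult_le_pos; [|lra]; nra). lra. }
    nra. }
  intros t. specialize (Ez t). unfold E in Ez.
  assert (A := pow2_ge_0 (U t - U' t)). assert (B := pow2_ge_0 (P t - P' t)).
  assert (A0 : (U t - U' t) ^ 2 = 0) by lra. assert (B0 : (P t - P' t) ^ 2 = 0) by lra.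
  split; apply Rminus_diag_uniq; (eapply Rsqr_0_uniq; unfold Rsqr; nra).
Qed.

(** At [h = 0] the interval of integration is a point, so that the dependence
    of the integrand on [h] does not contribute to the derivative. *)
Lemma is_derive_RInt_moving (c : R -> R -> R) e :
  cont2 c -> is_derive (fun h => RInt (c h) 0 (e * h)) 0 (e * c 0 0).
Proof.
  intros Hc.
  assert (Q : is_derive (fun h => RInt (c h) 0 (e * h)) 0
      ((fun h => e * RInt (fun y => c h (e * h * y)) 0 1) 0)).
  { apply (is_derive_of_quotient _ (fun h => e * RInt (fun y => c h (e * h * y)) 0 1)).
    - apply continuous_mul; [apply (continuous_cst e)|].
      apply (continuous_RInt_unit (fun h y => c h (e * h * y))).
      intros z. cont.
    - intros h. rewrite Rmult_0_r, RInt_point. unfold zero; simpl.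
      rewrite RInt_rescale by (intros x; apply continuous_slice, Hc). Rring. }
  eapply is_derive_eq; [exact Q|]. cbv beta. f_equal.
  rewrite (RInt_ext _ (fun _ => c 0 0)).
  - rewrite RInt_const. unfold scal; simpl; unfold mult; simpl. Rring.
  - intros x _. f_equal. ring.
Qed.

(** The regularity of the coefficients of the transport equation: [C^1] in the
    state [(u,p)], continuous in [x], which is the time along characteristics. *)
Record C1_up (h hu hp : R -> R -> R -> R) : Prop := {
  up_c : cont3 h; up_cu : cont3 hu; up_cp : cont3 hp;
  up_du : forall x u p : R, is_derive (fun s => h x s p) u (hu x u p);
  up_dp : forall x u p : R, is_derive (fun s => h x u s) p (hp x u p)
}.

(** Moving first [p], then [u], splits an increment into two divided
    differences, which are continuous in both end points. *)
Lemma C1_up_increment h hu hp : C1_up h hu hp ->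
  exists a b : R -> R -> R -> R -> R -> R, cont5 a /\ cont5 b /\
    (forall x u p u' p' : R,
      h x u' p' - h x u p = a x u p u' p' * (u' - u) + b x u p u' p' * (p' - p)) /\
    (forall K, (forall x u p : R, Rabs (hu x u p) <= K) ->
       forall x u p u' p' : R, Rabs (a x u p u' p') <= K) /\
    (forall K, (forall x u p : R, Rabs (hp x u p) <= K) ->
       forall x u p u' p' : R, Rabs (b x u p u' p') <= K).
Proof.
  intros [Ch Cu Cp Du Dp].
  exists (fun x u p u' p' => slope (fun v => hu x v p') u u'),
    (fun x u p u' p' => slope (fun v => hp x u v) p p').
  split; [|split; [|split; [|split]]].
  - intros z. apply (continuous_slope (fun (w : R * R * R * R * R) v =>
      hu (fst (fst (fst (fst w)))) v (snd w))); intros w; cont.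
  - intros z. apply (continuous_slope (fun (w : R * R * R * R * R) v =>
      hp (fst (fst (fst (fst w)))) (snd (fst (fst (fst w)))) v)); intros w; cont.
  - intros x u p u' p'.
    assert (A := slope_eq (fun v => h x v p') (fun v => hu x v p') u u').
    assert (B := slope_eq (fun v => h x u v) (fun v => hp x u v) p p').
    cbv beta in A, B.
    rewrite Rmult_comm, <- A, Rmult_comm, <- B; [ring | | | | ]; auto; intros y; cont.
  - intros K HK x u p u' p'. apply slope_le; [intros y; cont | intros; apply HK].
  - intros K HK x u p u' p'. apply slope_le; [intros y; cont | intros; apply HK].
Qed.

(** Solutions depend differentiably on the initial data: the divided
    difference of two solutions solves a linear equation whose coefficients,
    being divided differences of [G], remain continuous when the two solutions
    merge; by continuous dependence on parameters so does the divided
    difference. *)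
Lemma flow_quotient (G Gu Gp : R -> R -> R -> R) K (U P : R * R * R -> R -> R) d1 d2 :
  C1_up G Gu Gp ->
  0 <= K ->
  (forall x u p : R, Rabs (Gu x u p) <= K) -> (forall x u p : R, Rabs (Gp x u p) <= K) ->
  cont2 U -> cont2 P ->
  (forall z, U z 0 = snd (fst z) /\ P z 0 = snd z /\ forall t, is_derive (U z) t (P z t) /\
     is_derive (P z) t (G (fst (fst z) + t) (U z t) (P z t))) ->
  exists a b : R * R * R * R -> R -> R, cont2 a /\ cont2 b /\
    (forall w, a w 0 = d1 /\ b w 0 = d2) /\
    forall x u p h t : R,
      U (x, u + h * d1, p + h * d2) t - U (x, u, p) t = h * a (x, u, p, h) t /\
      P (x, u + h * d1, p + h * d2) t - P (x, u, p) t = h * b (x, u, p, h) t.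
Proof.
  intros HG HK Bu Bp CU CP HS.
  pose (z' := fun w : R * R * R * R =>
    (fst (fst (fst w)), snd (fst (fst w)) + snd w * d1, snd (fst w) + snd w * d2)).
  assert (Cz' : forall w, continuous z' w).
  { intros w. unfold z'.
    apply (continuous_pair (fun w : R * R * R * R =>
       (fst (fst (fst w)), snd (fst (fst w)) + snd w * d1))); [apply continuous_pair|]; cont;
    apply continuous_cst. }
  destruct (C1_up_increment G Gu Gp HG) as [ga [gb [Cga [Cgb [Einc [Bga Bgb]]]]]].
  specialize (Bga K Bu). specialize (Bgb K Bp).
  pose (al := fun (w : R * R * R * R) s =>
    ga (fst (fst (fst w)) + s) (U (fst w) s) (P (fst w) s) (U (z' w) s) (P (z' w) s)).
  pose (be := fun (w : R * R * R * R) s =>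
    gb (fst (fst (fst w)) + s) (U (fst w) s) (P (fst w) s) (U (z' w) s) (P (z' w) s)).
  assert (Czc : forall (V : UniformSpace) (k : V -> R * R * R * R) v, continuous k v ->
     continuous (fun y => z' (k y)) v).
  { intros V k v Hk. apply (continuous_comp k z'); [exact Hk | apply Cz']. }
  assert (Ca : cont2 al) by (intros w; unfold al; cont; apply Czc; cont).
  assert (Cb : cont2 be) by (intros w; unfold be; cont; apply Czc; cont).
  assert (Ba : forall w s, Rabs (al w s) <= K) by (intros; apply Bga).
  assert (Bb : forall w s, Rabs (be w s) <= K) by (intros; apply Bgb).
  assert (Hlin : forall w s a b a' b',
     Rabs (al w s * a + be w s * b - (al w s * a' + be w s * b'))
       <= K * (Rabs (a - a') + Rabs (b - b'))).
  { intros w s a b a' b'.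
    replace (al w s * a + be w s * b - (al w s * a' + be w s * b'))
      with (al w s * (a - a') + be w s * (b - b')) by ring.
    eapply Rle_trans; [apply Rabs_triang|]. rewrite !Rabs_mult, Rmult_plus_distr_l.
    apply Rplus_le_compat; (apply Rmult_le_compat_r; [apply Rabs_pos | auto]). }
  destruct (ode_solution (fun w s a b => al w s * a + be w s * b) K (fun _ => d1) (fun _ => d2))
    as [a [b [Ha [Hb Hab]]]].
  { split.
    - intros w. cont.
    - exact Hlin.
    - intros w s. rewrite !Rmult_0_r, Rplus_0_r, Rabs_R0. exact HK. }
  { intros; apply continuous_cst. }
  { intros; apply continuous_cst. }
  exists a, b. split; [exact Ha|]. split; [exact Hb|]. split.
  { intros w. destruct (Hab w) as [A1 [A2 _]]. auto. }
  intros x u p h.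
  set (w := (x, u, p, h)).
  destruct (HS (x, u, p)) as [I1 [I2 HS1]].
  destruct (HS (x, u + h * d1, p + h * d2)) as [J1 [J2 HS2]].
  destruct (Hab w) as [A1 [A2 A3]]. simpl in I1, I2, J1, J2, HS1, HS2.
  apply (ode_unique (fun s a b => al w s * a + be w s * b) K
    (fun t => U (x, u + h * d1, p + h * d2) t - U (x, u, p) t)
    (fun t => P (x, u + h * d1, p + h * d2) t - P (x, u, p) t)
    (fun t => h * a w t) (fun t => h * b w t) HK (Hlin w)).
  - intros t. destruct (HS1 t) as [B1 B2]. destruct (HS2 t) as [B3 B4]. split.
    + apply (is_derive_minus (V := R_NormedModule)); assumption.
    + eapply is_derive_eq; [apply (is_derive_minus (V := R_NormedModule)); eassumption|].
      unfold minus, plus, opp; simpl.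
      match goal with |- ?l + - ?r = _ => change (l + - r) with (l - r) end.
      rewrite Einc. reflexivity.
  - intros t. destruct (A3 t) as [B1 B2]. split.
    + apply (is_derive_scal (a w) t h). exact B1.
    + eapply is_derive_eq; [apply (is_derive_scal (b w) t h); exact B2|].
      unfold scal; simpl; unfold mult; simpl. ring.
  - rewrite I1, J1, A1. ring.
  - rewrite I2, J2, A2. ring.
Qed.

(** * The transport equation *)

(** Characteristics of the transport equation
    [g_x + p g_u + G g_p + S = 0], [g = 0] at [x = 0], are the solutions of
    [u'' = G(x,u,u')]; [g] is minus the integral of [S] along the
    characteristic back to [x = 0].  The derivatives in [(u,p)] come from those
    of the flow.  The derivative in [x] is obtained from the invariance of the
    construction along characteristics, [G] and [S] being only continuous in
    [x]. *)
Theorem transport (G Gu Gp S Su Sp : R -> R -> R -> R) K :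
  C1_up G Gu Gp -> C1_up S Su Sp ->
  (forall x u p : R, Rabs (G x u p) <= K) ->
  (forall x u p : R, Rabs (Gu x u p) <= K) -> (forall x u p : R, Rabs (Gp x u p) <= K) ->
  exists g gu gp : R -> R -> R -> R,
    C1_up g gu gp /\
    forall x u p : R, is_derive (fun s => g s u p) x (- (p * gu x u p + G x u p * gp x u p + S x u p)).
Proof.
  intros HG HS BG Bu Bp.
  assert (HK : 0 <= K) by (eapply Rle_trans; [apply Rabs_pos | apply (BG 0 0 0)]).
  assert (CG := up_c _ _ _ HG). assert (CGu := up_cu _ _ _ HG). assert (CGp := up_cp _ _ _ HG).
  assert (CS := up_c _ _ _ HS). assert (CSu := up_cu _ _ _ HS). assert (CSp := up_cp _ _ _ HS).
  assert (HLip : forall x u p u' p',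
     Rabs (G x u p - G x u' p') <= K * (Rabs (u - u') + Rabs (p - p'))).
  { intros x u p u' p'. destruct (C1_up_increment G Gu Gp HG) as [ga [gb [_ [_ [E [Ba Bb]]]]]].
    rewrite E. eapply Rle_trans; [apply Rabs_triang|]. rewrite !Rabs_mult, Rmult_plus_distr_l.
    apply Rplus_le_compat; (apply Rmult_le_compat_r; [apply Rabs_pos | auto]). }
  assert (Hflow : exists U P : R * R * R -> R -> R, cont2 U /\ cont2 P /\
    forall z : R * R * R, U z 0 = snd (fst z) /\ P z 0 = snd z /\
      forall t, is_derive (U z) t (P z t) /\
        is_derive (P z) t (G (fst (fst z) + t) (U z t) (P z t))).
  { apply (ode_solution (fun (z : R * R * R) s u p => G (fst (fst z) + s) u p) K
      (fun z => snd (fst z)) (fun z => snd z)).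
    - split.
      + intros w. cont.
      + intros z s u p u' p'. apply HLip.
      + intros z s. apply BG.
    - intros z. cont.
    - intros z. cont. }
  destruct Hflow as [U [P [CU [CP HUP]]]].
  assert (HQ := fun d1 d2 => flow_quotient G Gu Gp K U P d1 d2 HG HK Bu Bp CU CP HUP).
  pose (g := fun x u p => RInt (fun s => S (x + s) (U (x, u, p) s) (P (x, u, p) s)) 0 (- x)).
  assert (CSUP : cont2 (fun (z : R * R * R) s => S (fst (fst z) + s) (U z s) (P z s))).
  { intros w. cont. }
  assert (Cg : cont3 g).
  { intros z.
    apply (continuous_ext (fun z : R * R * R => RInt (fun s =>
       S (fst (fst z) + s) (U z s) (P z s)) 0 (- fst (fst z)))).
    { intros [[x u] p]. reflexivity. }
    assert (CI := cont2_RInt _ CSUP). cbv beta in CI.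
    apply (cont2_comp _ (fun z : R * R * R => z) (fun z => - fst (fst z)) z CI); cont. }
  assert (Hdir : forall d1 d2, exists gd : R -> R -> R -> R, cont3 gd /\
     forall x u p : R, is_derive (fun h => g x (u + h * d1) (p + h * d2)) 0 (gd x u p)).
  { intros d1 d2. destruct (HQ d1 d2) as [a [b [Ca [Cb [_ Hab]]]]].
    pose (z' := fun w : R * R * R * R =>
      (fst (fst (fst w)), snd (fst (fst w)) + snd w * d1, snd (fst w) + snd w * d2)).
    assert (Czc : forall (V : UniformSpace) (k : V -> R * R * R * R) v, continuous k v ->
       continuous (fun y => z' (k y)) v).
    { intros V k v Hk. unfold z'.
      apply (continuous_pair (fun y =>
       (fst (fst (fst (k y))), snd (fst (fst (k y))) + snd (k y) * d1)));
        [apply continuous_pair|]; cont; apply continuous_cst. }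
    destruct (C1_up_increment S Su Sp HS) as [sa [sb [Csa [Csb [Einc _]]]]].
    pose (ig := fun (w : R * R * R * R) s =>
      sa (fst (fst (fst w)) + s) (U (fst w) s) (P (fst w) s) (U (z' w) s) (P (z' w) s) * a w s +
      sb (fst (fst (fst w)) + s) (U (fst w) s) (P (fst w) s) (U (z' w) s) (P (z' w) s) * b w s).
    assert (Cig : cont2 ig) by (intros w; unfold ig; cont; apply Czc; cont).
    assert (CI := cont2_RInt _ Cig). cbv beta in CI.
    exists (fun x u p => RInt (ig (x, u, p, 0)) 0 (- x)). split.
    - intros z.
      apply (continuous_ext (fun z : R * R * R => RInt (ig (z, 0)) 0 (- fst (fst z)))).
      { intros [[x u] p]. reflexivity. }
      apply (cont2_comp _ (fun z : R * R * R => (z, 0)) (fun z : R * R * R => - fst (fst z)) z CI); cont.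
    - intros x u p.
      apply (is_derive_of_quotient (fun h => g x (u + h * d1) (p + h * d2))
         (fun h => RInt (ig (x, u, p, h)) 0 (- x))).
      + apply (cont2_comp _ (fun h => (x, u, p, h)) (fun _ => - x) 0 CI).
        * apply continuous_pair; cont; apply continuous_cst.
        * apply (continuous_cst (- x)).
      + intros h. rewrite !Rmult_0_l, !Rplus_0_r. unfold g.
        rewrite <- RInt_mul_l by (apply cont2_ex_RInt, Cig).
        rewrite <- RInt_sub.
        2:{ apply (cont2_ex_RInt _ (x, u + h * d1, p + h * d2) 0 (- x) CSUP). }
        2:{ apply (cont2_ex_RInt _ (x, u, p) 0 (- x) CSUP). }
        apply RInt_ext. intros s _.
        rewrite Einc.
        destruct (Hab x u p h s) as [E1 E2].
        etransitivity; [exact (f_equal2 Rplus (f_equal (Rmult _) E1) (f_equal (Rmult _) E2))|].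
        unfold ig, z'. simpl. Rring. }
  destruct (Hdir 1 0) as [gu [Cgu Dgu]]. destruct (Hdir 0 1) as [gp [Cgp Dgp]].
  assert (Hgu : forall x u p : R, is_derive (fun s => g x s p) u (gu x u p)).
  { intros x u p. apply is_derive_shift.
    apply (is_derive_ext (fun h => g x (u + h * 1) (p + h * 0))); [|apply Dgu].
    intros h. f_equal; ring. }
  assert (Hgp : forall x u p : R, is_derive (fun s => g x u s) p (gp x u p)).
  { intros x u p. apply is_derive_shift.
    apply (is_derive_ext (fun h => g x (u + h * 0) (p + h * 1))); [|apply Dgp].
    intros h. f_equal; ring. }
  exists g, gu, gp. split; [split; assumption|].
  intros x u p. apply is_derive_shift.
  pose (uh := fun h : R => U (x + h, u, p) (- h)). pose (ph := fun h : R => P (x + h, u, p) (- h)).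
  (* the characteristic through [(x+h,u,p)] passes through [(x,uh,ph)] *)
  assert (Hsemi : forall h t : R, U (x + h, u, p) (t - h) = U (x, uh h, ph h) t /\
                              P (x + h, u, p) (t - h) = P (x, uh h, ph h) t).
  { intros h. destruct (HUP (x + h, u, p)) as [_ [_ S1]].
    destruct (HUP (x, uh h, ph h)) as [I1 [I2 S2]]. simpl in I1, I2, S1, S2.
    apply (ode_unique (fun s a b => G (x + s) a b) K
      (fun t => U (x + h, u, p) (t - h)) (fun t => P (x + h, u, p) (t - h))); auto.
    - intros t. destruct (S1 (t - h)) as [B1 B2].
      assert (Hs : forall (k : R -> R) l, is_derive k (t - h) l ->
         is_derive (fun t => k (t - h)) t l).
      { intros k l Hk. eapply is_derive_eq.
        - apply (is_derive_comp k (fun t => t - h)); [exact Hk|]. auto_derive; reflexivity.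
        - unfold scal; simpl; unfold mult; simpl. ring. }
      split; [apply (Hs (U (x + h, u, p))); exact B1|].
      replace (G (x + t)) with (G (x + h + (t - h))) by (f_equal; ring).
      apply (Hs (P (x + h, u, p))). exact B2.
    - rewrite I1. unfold uh. f_equal. ring.
    - rewrite I2. unfold ph. f_equal. ring. }
  assert (Cuh : forall h, continuous uh h).
  { intros h. unfold uh. apply (cont2_comp U (fun h => (x + h, u, p)) (fun h => - h) h CU); [|cont].
    apply continuous_pair; [apply continuous_pair; cont|]; apply continuous_cst. }
  assert (Cph : forall h, continuous ph h).
  { intros h. unfold ph. apply (cont2_comp P (fun h => (x + h, u, p)) (fun h => - h) h CP); [|cont].
    apply continuous_pair; [apply continuous_pair; cont|]; apply continuous_cst. }
  assert (Hg : forall h, g (x + h) u p =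
     g x (uh h) (ph h) - RInt (fun t => S (x + t) (U (x, uh h, ph h) t) (P (x, uh h, ph h) t)) 0 (1 * h)).
  { intros h. unfold g. rewrite Rmult_1_l.
    set (f := fun t => S (x + t) (U (x, uh h, ph h) t) (P (x, uh h, ph h) t)).
    assert (Cf : forall a b, ex_RInt f a b).
    { intros a b. apply (cont2_ex_RInt _ (x, uh h, ph h) a b CSUP). }
    rewrite <- (RInt_Chasles (V := R_CompleteNormedModule) f 0 h (- x)) by apply Cf.
    unfold plus; simpl.
    match goal with |- ?L = ?A + ?B - ?A' => change A' with A; transitivity B; [|Rring] end.
    assert (Cf2 : ex_RInt (fun s => S (x + h + s) (U (x + h, u, p) s) (P (x + h, u, p) s))
        (1 * h + - h) (1 * (- x) + - h)).
    { apply (cont2_ex_RInt _ (x + h, u, p) _ _ CSUP). }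
    replace (RInt (fun s => S (x + h + s) (U (x + h, u, p) s) (P (x + h, u, p) s)) 0 (- (x + h)))
      with (RInt (fun s => S (x + h + s) (U (x + h, u, p) s) (P (x + h, u, p) s))
        (1 * h + - h) (1 * (- x) + - h)) by (f_equal; ring).
    rewrite <- (RInt_comp_lin (V := R_CompleteNormedModule) _ 1 (- h) h (- x)) by exact Cf2.
    apply RInt_ext. intros t _. unfold scal; simpl; unfold mult; simpl. unfold f.
    destruct (Hsemi h t) as [E1 E2]. rewrite <- E1, <- E2.
    replace (1 * t + - h) with (t - h) by ring.
    replace (x + h + (t - h)) with (x + t) by ring. Rring. }
  apply (is_derive_ext (fun h => g x (uh h) (ph h) -
     RInt (fun t => S (x + t) (U (x, uh h, ph h) t) (P (x, uh h, ph h) t)) 0 (1 * h))).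
  { intros h. symmetry. apply Hg. }
  destruct (HUP (x + 0, u, p)) as [I1 [I2 _]]. simpl in I1, I2.
  assert (E0 : uh 0 = u) by (unfold uh; rewrite Ropp_0; exact I1).
  assert (F0 : ph 0 = p) by (unfold ph; rewrite Ropp_0; exact I2).
  assert (Duh : is_derive uh 0 (- p)).
  { apply (is_derive_ext (fun h => u + RInt (fun s => P (x + h, u, p) s) 0 (-1 * h))).
    { intros h. destruct (HUP (x + h, u, p)) as [J1 [_ S1]]. simpl in J1, S1.
      unfold uh. replace (-1 * h) with (- h) by ring.
      rewrite (is_RInt_unique _ 0 (- h) (minus (U (x + h, u, p) (- h)) (U (x + h, u, p) 0))).
      - rewrite J1. unfold minus, plus, opp; simpl. Rring.
      - apply (is_RInt_derive (V := R_CompleteNormedModule)); intros s _; [apply S1|].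
        apply continuous_slice, CP. }
    eapply is_derive_eq.
    - apply (is_derive_plus (V := R_NormedModule)); [apply (is_derive_const u)|].
      apply (is_derive_RInt_moving (fun h s => P (x + h, u, p) s) (-1)).
      intros w. cont.
    - rewrite I2. unfold plus, zero; simpl. Rring. }
  assert (Dph : is_derive ph 0 (- G x u p)).
  { pose (c := fun h s => G (x + h + s) (U (x + h, u, p) s) (P (x + h, u, p) s)).
    assert (Cc : cont2 c).
    { intros w. unfold c. cont. }
    apply (is_derive_ext (fun h => p + RInt (c h) 0 (-1 * h))).
    { intros h. destruct (HUP (x + h, u, p)) as [_ [J1 S1]]. simpl in J1, S1.
      unfold ph. replace (-1 * h) with (- h) by ring.
      rewrite (is_RInt_unique _ 0 (- h) (minus (P (x + h, u, p) (- h)) (P (x + h, u, p) 0))).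
      - rewrite J1. unfold minus, plus, opp; simpl. Rring.
      - apply (is_RInt_derive (V := R_CompleteNormedModule)); intros s _; [apply S1|].
        apply continuous_slice, Cc. }
    eapply is_derive_eq.
    - apply (is_derive_plus (V := R_NormedModule)); [apply (is_derive_const p)|].
      apply (is_derive_RInt_moving c (-1) Cc).
    - unfold c. rewrite I1, I2, !Rplus_0_r. unfold plus, zero; simpl. Rring. }
  pose (c := fun h t => S (x + t) (U (x, uh h, ph h) t) (P (x, uh h, ph h) t)).
  assert (Cc : cont2 c).
  { intros w. unfold c.
    assert (T1 : continuous (fun w : R * R => uh (fst w)) w)
      by (apply (continuous_comp fst uh); [cont | apply Cuh]).
    assert (T2 : continuous (fun w : R * R => ph (fst w)) w)
      by (apply (continuous_comp fst ph); [cont | apply Cph]).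
    cont. }
  eapply is_derive_eq.
  - apply (is_derive_minus (V := R_NormedModule)).
    + apply (chain2 (g x) (gu x) (gp x) uh ph 0 (- p) (- G x u p)); auto.
      1, 2, 3: intros w; cont.
    + apply (is_derive_RInt_moving c 1 Cc).
  - unfold c. rewrite E0, F0.
    destruct (HUP (x, u, p)) as [J1 [J2 _]]. simpl in J1, J2.
    rewrite J1, J2, !Rplus_0_r. unfold minus, plus, opp; simpl. Rring.
Qed.

(** * The implicit function [F] *)

(** Restricting the relative differential to a line that stays in [D] near the
    point gives an ordinary two-sided derivative. *)
Lemma C1_on_directional {V : NormedModule R_AbsRing} (D : V -> Prop) (g : V -> R) (l : V -> R)
    (z v : V) (path : R -> V) s0 :
  filterdiff g (within D (locally z)) l ->
  (forall s, path s = plus z (scal (s - s0) v)) ->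
  locally s0 (fun s => D (path s)) ->
  is_derive (fun s => g (path s)) s0 (l v).
Proof.
  intros [Hl Hg] Hpath HD.
  assert (E0 : path s0 = z).
  { rewrite Hpath. rewrite Rminus_diag.
    change (plus z (scal zero v) = z). rewrite scal_zero_l. apply plus_zero_r. }
  assert (Cp : continuous path s0).
  { apply (continuous_ext (fun s => plus z (scal (s - s0) v))).
    { intros s. symmetry. apply Hpath. }
    apply (continuous_plus (fun _ => z)); [apply continuous_const|].
    apply (continuous_scal_l (fun s => s - s0) v). cont. }
  apply is_derive_eps. intros eps He.
  assert (Hn : 0 <= norm v) by apply norm_ge_0.
  assert (He' : 0 < eps / (norm v + 1)) by (apply Rdiv_lt_0_compat; lra).
  assert (Hz : is_filter_lim (within D (locally z)) z).
  { intros P HP. unfold within. revert HP. apply filter_imp. auto. }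
  assert (T := Hg z Hz (mkposreal _ He')). unfold within in T.
  rewrite <- E0 in T. apply Cp in T. unfold filtermap in T.
  generalize (filter_and _ _ T HD). apply filter_imp. intros s [A B].
  specialize (A B). simpl in A. rewrite E0.
  assert (Em : minus (path s) (path s0) = scal (s - s0) v).
  { rewrite E0, Hpath. unfold minus. rewrite plus_comm, plus_assoc, plus_opp_l. apply plus_zero_l. }
  rewrite Em, (linear_scal l Hl), E0 in A.
  eapply Rle_trans; [|eapply Rle_trans; [exact A|]].
  - right. change (norm (minus (minus (g (path s)) (g z)) (scal (s - s0) (l v))))
      with (Rabs (g (path s) + - g z + - ((s - s0) * l v))). f_equal. ring.
  - assert (N := norm_scal (s - s0) v). change (abs (s - s0)) with (Rabs (s - s0)) in N.
    apply Rle_trans with (eps / (norm v + 1) * (Rabs (s - s0) * norm v)).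
    + apply Rmult_le_compat_l; [lra | exact N].
    + replace (eps / (norm v + 1) * (Rabs (s - s0) * norm v))
        with (eps * Rabs (s - s0) * (norm v / (norm v + 1))) by (field; lra).
      rewrite <- (Rmult_1_r (eps * Rabs (s - s0))) at 2.
      apply Rmult_le_compat_l; [apply Rmult_le_pos; [lra | apply Rabs_pos]|].
      apply (Rmult_le_reg_r (norm v + 1)); [lra|].
      unfold Rdiv. rewrite Rmult_assoc, Rinv_l; lra.
Qed.

Lemma C1_on_continuous {U : UniformSpace} {V : NormedModule R_AbsRing} (D : V -> Prop)
    (g : V -> R) (l : V -> R) (cm : U -> V) (w : U) :
  continuous cm w -> (forall w', D (cm w')) ->
  filterdiff g (within D (locally (cm w))) l ->
  continuous (fun w' => g (cm w')) w.
Proof.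
  intros Hcm HD [Hl Hg].
  destruct (linear_norm l Hl) as [M [HM Hlin]].
  apply continuous_eps. intros eps He.
  assert (Hz : is_filter_lim (within D (locally (cm w))) (cm w)).
  { intros P HP. unfold within. revert HP. apply filter_imp. auto. }
  assert (T := Hg _ Hz (mkposreal 1 Rlt_0_1)). unfold within in T.
  assert (He' : 0 < eps / (M + 1)) by (apply Rdiv_lt_0_compat; lra).
  assert (B : locally (cm w) (ball_norm (cm w) (mkposreal _ He'))).
  { apply locally_le_locally_norm. apply locally_norm_ball_norm. }
  generalize (Hcm _ (filter_and _ _ T B)). unfold filtermap. apply filter_imp.
  intros w' [A1 A2]. specialize (A1 (HD w')). simpl in A1, A2.
  specialize (Hlin (minus (cm w') (cm w))).
  unfold ball_norm in A2. simpl in A2.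
  set (n := norm (minus (cm w') (cm w))) in *.
  change (norm (minus (minus (g (cm w')) (g (cm w))) (l (minus (cm w') (cm w)))))
    with (Rabs (g (cm w') + - g (cm w) + - l (minus (cm w') (cm w)))) in A1.
  change (norm (l (minus (cm w') (cm w)))) with (Rabs (l (minus (cm w') (cm w)))) in Hlin.
  replace (g (cm w') - g (cm w)) with ((g (cm w') + - g (cm w) + - l (minus (cm w') (cm w)))
     + l (minus (cm w') (cm w))) by ring.
  eapply Rle_lt_trans; [apply Rabs_triang|].
  apply Rle_lt_trans with ((M + 1) * n); [lra|].
  apply Rmult_lt_compat_l with (r := M + 1) in A2; [|lra].
  replace ((M + 1) * (eps / (M + 1))) with eps in A2 by (field; lra). exact A2.
Qed.

Lemma within_continuous {U V : UniformSpace} (D : V -> Prop) (k : V -> R) (cm : U -> V) (w : U) :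
  continuous cm w -> (forall w', D (cm w')) ->
  filterlim k (within D (locally (cm w))) (locally (k (cm w))) ->
  continuous (fun w' => k (cm w')) w.
Proof.
  intros Hcm HD Hk P HP.
  generalize (Hcm _ (Hk P HP)). unfold filtermap, within. apply filter_imp. auto.
Qed.

Lemma locally_between lo hi t : lo < t < hi -> locally t (fun s => lo < s < hi).
Proof.
  intros H. apply (locally_interval _ t (Finite lo) (Finite hi)); simpl; try tauto.
Qed.

Lemma affine5 (x u p q r s a b c d e : R) :
  plus (x, u, p, q, r) (scal s (a, b, c, d, e))
  = (x + s * a, u + s * b, p + s * c, q + s * d, r + s * e).
Proof. reflexivity. Qed.

Lemma affine4 (x u p q s a b c d : R) :
  plus (x, u, p, q) (scal s (a, b, c, d)) = (x + s * a, u + s * b, p + s * c, q + s * d).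
Proof. reflexivity. Qed.

Ltac tuple_eq :=
  repeat match goal with |- (_, _) = (_, _) => apply f_equal2 end; ring.

(** [C1_on] only provides a differential; the partial derivatives are its
    values on the coordinate vectors, frozen for [x] outside [[0,1]] like the
    function itself. *)
Lemma C1_xupqr_partials (f : R -> R -> R -> R -> R -> R) :
  C1_xupqr f ->
  exists fx fu fp fq fr : R -> R -> R -> R -> R -> R,
    (cont5 fx /\ cont5 fu /\ cont5 fp /\ cont5 fq /\ cont5 fr) /\
    cont5 (fun x u p q r => f (clamp x) u p q r) /\
    forall x u p q r : R,
      (0 < x < 1 -> is_derive (fun s => f (clamp s) u p q r) x (fx x u p q r)) /\
      is_derive (fun s => f (clamp x) s p q r) u (fu x u p q r) /\
      is_derive (fun s => f (clamp x) u s q r) p (fp x u p q r) /\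
      is_derive (fun s => f (clamp x) u p s r) q (fq x u p q r) /\
      is_derive (fun s => f (clamp x) u p q s) r (fr x u p q r).
Proof.
  intros [df Hdf].
  pose (D := fun z : R * R * R * R * R => let '(x, _, _, _, _) := z in 0 <= x <= 1).
  pose (k := fun (v : R * R * R * R * R) (x u p q r : R) => df (clamp x, u, p, q, r) v).
  assert (Ck : forall v, cont5 (k v)).
  { intros v z.
    apply (within_continuous D (fun w => df w v) (fun w : R * R * R * R * R =>
      (clamp (fst (fst (fst (fst w)))), snd (fst (fst (fst w))), snd (fst (fst w)),
      snd (fst w), snd w)) z).
    - cont.
    - intros w. apply clamp_in.
    - apply Hdf. apply clamp_in. }
  exists (k (1, 0, 0, 0, 0)), (k (0, 1, 0, 0, 0)), (k (0, 0, 1, 0, 0)), (k (0, 0, 0, 1, 0)),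
    (k (0, 0, 0, 0, 1)).
  split; [repeat split; apply Ck|].
  assert (Hd : forall x u p q r : R, filterdiff (fun '(x, u, p, q, r) => f x u p q r)
      (within D (locally (clamp x, u, p, q, r))) (df (clamp x, u, p, q, r))).
  { intros x u p q r. apply Hdf. apply clamp_in. }
  split.
  { intros z.
    apply (C1_on_continuous D (fun '(x, u, p, q, r) => f x u p q r)
      (df (clamp (fst (fst (fst (fst z)))), snd (fst (fst (fst z))), snd (fst (fst z)),
      snd (fst z), snd z)) (fun w : R * R * R * R * R =>
      (clamp (fst (fst (fst (fst w)))), snd (fst (fst (fst w))), snd (fst (fst w)),
      snd (fst w), snd w)) z).
    - cont.
    - intros w. apply clamp_in.
    - apply Hd. }
  intros x u p q r.
  assert (Hp := fun path v s0 => C1_on_directional D (fun '(x, u, p, q, r) => f x u p q r)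
     _ (clamp x, u, p, q, r) v path s0 (Hd x u p q r)).
  split; [|split; [|split; [|split]]].
  - intros Hx.
    apply (is_derive_ext_loc (fun s => f s u p q r)).
    { generalize (locally_between 0 1 x Hx). apply filter_imp.
      intros y Hy. rewrite clamp_id by lra. reflexivity. }
    apply (Hp (fun s => (s, u, p, q, r)) (1, 0, 0, 0, 0)).
    + intros s. etransitivity; [|symmetry; apply affine5].
      rewrite clamp_id by lra. tuple_eq.
    + generalize (locally_between 0 1 x Hx). apply filter_imp. unfold D. intros y Hy. lra.
  - apply (Hp (fun s => (clamp x, s, p, q, r)) (0, 1, 0, 0, 0));
      [intros s; etransitivity; [|symmetry; apply affine5]; tuple_eq|].
    apply filter_forall; intros; apply clamp_in.
  - apply (Hp (fun s => (clamp x, u, s, q, r)) (0, 0, 1, 0, 0));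
      [intros s; etransitivity; [|symmetry; apply affine5]; tuple_eq|].
    apply filter_forall; intros; apply clamp_in.
  - apply (Hp (fun s => (clamp x, u, p, s, r)) (0, 0, 0, 1, 0));
      [intros s; etransitivity; [|symmetry; apply affine5]; tuple_eq|].
    apply filter_forall; intros; apply clamp_in.
  - apply (Hp (fun s => (clamp x, u, p, q, s)) (0, 0, 0, 0, 1));
      [intros s; etransitivity; [|symmetry; apply affine5]; tuple_eq|].
    apply filter_forall; intros; apply clamp_in.
Qed.

Lemma C1_xupq_partials (f : R -> R -> R -> R -> R) :
  C1_xupq f ->
  exists fu fp fq : R -> R -> R -> R -> R,
    (cont4 fu /\ cont4 fp /\ cont4 fq) /\
    cont4 (fun x u p q => f (clamp x) u p q) /\
    forall x u p q : R,
      is_derive (fun s => f (clamp x) s p q) u (fu x u p q) /\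
      is_derive (fun s => f (clamp x) u s q) p (fp x u p q) /\
      is_derive (fun s => f (clamp x) u p s) q (fq x u p q).
Proof.
  intros [df Hdf].
  pose (D := fun z : R * R * R * R => let '(x, _, _, _) := z in 0 <= x <= 1).
  pose (k := fun (v : R * R * R * R) (x u p q : R) => df (clamp x, u, p, q) v).
  assert (Ck : forall v, cont4 (k v)).
  { intros v z.
    apply (within_continuous D (fun w => df w v) (fun w : R * R * R * R =>
      (clamp (fst (fst (fst w))), snd (fst (fst w)), snd (fst w), snd w)) z).
    - cont.
    - intros w. apply clamp_in.
    - apply Hdf. apply clamp_in. }
  exists (k (0, 1, 0, 0)), (k (0, 0, 1, 0)), (k (0, 0, 0, 1)).
  split; [repeat split; apply Ck|].
  assert (Hd : forall x u p q : R, filterdiff (fun '(x, u, p, q) => f x u p q)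
      (within D (locally (clamp x, u, p, q))) (df (clamp x, u, p, q))).
  { intros x u p q. apply Hdf. apply clamp_in. }
  split.
  { intros z.
    apply (C1_on_continuous D (fun '(x, u, p, q) => f x u p q)
      (df (clamp (fst (fst (fst z))), snd (fst (fst z)), snd (fst z), snd z))
      (fun w : R * R * R * R =>
      (clamp (fst (fst (fst w))), snd (fst (fst w)), snd (fst w), snd w)) z).
    - cont.
    - intros w. apply clamp_in.
    - apply Hd. }
  intros x u p q.
  assert (Hp := fun path v s0 => C1_on_directional D (fun '(x, u, p, q) => f x u p q)
     _ (clamp x, u, p, q) v path s0 (Hd x u p q)).
  split; [|split].
  - apply (Hp (fun s => (clamp x, s, p, q)) (0, 1, 0, 0));
      [intros s; etransitivity; [|symmetry; apply affine4]; tuple_eq|].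
    apply filter_forall; intros; apply clamp_in.
  - apply (Hp (fun s => (clamp x, u, s, q)) (0, 0, 1, 0));
      [intros s; etransitivity; [|symmetry; apply affine4]; tuple_eq|].
    apply filter_forall; intros; apply clamp_in.
  - apply (Hp (fun s => (clamp x, u, p, s)) (0, 0, 0, 1));
      [intros s; etransitivity; [|symmetry; apply affine4]; tuple_eq|].
    apply filter_forall; intros; apply clamp_in.
Qed.

Lemma increasing_of_derive_pos (k k' : R -> R) :
  (forall q, is_derive k q (k' q)) -> (forall q, 0 < k' q) ->
  forall a b, a < b -> k a < k b.
Proof.
  intros Hd Hp a b Hab.
  destruct (MVT_open k k' a b) as [c [_ E]].
  - intros; apply Hd.
  - intros x. eapply continuous_of_derive, Hd.
  - specialize (Hp c). assert (0 < k' c * (b - a)) by (apply Rmult_lt_0_compat; lra). lra.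
Qed.

(** The sign change of [phi z0] across [q0] persists for nearby [z]. *)
Lemma increasing_root_persists {A : UniformSpace} (phi : A -> R -> R) (z0 : A) q0 :
  (forall q, continuous (fun z => phi z q) z0) ->
  (forall z q, continuous (phi z) q) ->
  (forall a b, a < b -> phi z0 a < phi z0 b) ->
  phi z0 q0 = 0 ->
  forall eps, 0 < eps ->
    locally z0 (fun z => exists q, Rabs (q - q0) < eps /\ phi z q = 0).
Proof.
  intros Cz Cq Hi H0 eps He.
  assert (L : phi z0 (q0 - eps / 2) < 0) by (rewrite <- H0; apply Hi; lra).
  assert (U : 0 < phi z0 (q0 + eps / 2)) by (rewrite <- H0; apply Hi; lra).
  assert (L' : 0 < - phi z0 (q0 - eps / 2)) by lra.
  generalize (filter_and _ _ (proj1 (continuous_eps _ _) (Cz (q0 - eps / 2)) _ L')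
                             (proj1 (continuous_eps _ _) (Cz (q0 + eps / 2)) _ U)).
  apply filter_imp. intros z [A1 A2]. apply Rabs_def2 in A1. apply Rabs_def2 in A2.
  destruct (IVT_gen (phi z) (q0 - eps / 2) (q0 + eps / 2) 0) as [q [Hq Eq]].
  - intros q. apply continuity_pt_filterlim, Cq.
  - rewrite Rmin_left, Rmax_right; lra.
  - exists q. split; [|exact Eq].
    rewrite Rmin_left, Rmax_right in Hq by lra. apply Rabs_def1; lra.
Qed.

(** From [phi (y, Q y) = 0 = phi (y0, Q y0)], the mean value theorem in [y] and
    in [q] expresses the difference quotient of [Q] as [- phi_y / phi_q] at two
    nearby points.  One variable [y] is enough: it will be each of [x], [u],
    [p] and [r] in turn. *)
Lemma implicit_derive (phi phiy phiq : R -> R -> R) (Q : R -> R) y0 :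
  locally y0 (fun y => forall q, is_derive (fun s => phi s q) y (phiy y q)) ->
  (forall q y, continuous (fun s => phi s q) y) ->
  (forall y q, is_derive (phi y) q (phiq y q)) ->
  cont2 phiy -> cont2 phiq ->
  continuous Q y0 -> locally y0 (fun y => phi y (Q y) = 0) ->
  phiq y0 (Q y0) <> 0 -> is_derive Q y0 (- (phiy y0 (Q y0) / phiq y0 (Q y0))).
Proof.
  intros Dy Cphi Dq Cy Cq CQ H0 Hn. apply is_derive_eps. intros eps He.
  set (q0 := Q y0) in *.
  pose (k := fun w : (R * R) * (R * R) =>
    - (phiy (fst (fst w)) (snd (fst w)) / phiq (fst (snd w)) (snd (snd w)))).
  assert (Ck : continuous k ((y0, q0), (y0, q0))).
  { unfold k. apply continuous_neg. apply continuous_quot; [cont | cont | exact Hn]. }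
  assert (Ck2 : continuous (fun w : (R * R) * (R * R) => phiq (fst (snd w)) (snd (snd w)))
     ((y0, q0), (y0, q0))) by cont.
  assert (Hn' : 0 < Rabs (phiq y0 q0)) by (apply Rabs_pos_lt; exact Hn).
  destruct (filter_and _ _ (proj1 (continuous_eps _ _) Ck eps He)
     (proj1 (continuous_eps _ _) Ck2 _ Hn')) as [d Hd].
  destruct (filter_and _ _ Dy H0) as [d2 Hd2].
  assert (Hdd : 0 < Rmin d d2) by (apply Rmin_pos; apply cond_pos).
  assert (HL : locally y0 (fun y => Rabs (y - y0) < Rmin d d2)).
  { exists (mkposreal _ Hdd). intros y Hy. exact Hy. }
  generalize (filter_and _ _ HL (proj1 (continuous_eps _ _) CQ d (cond_pos d))).
  apply filter_imp. fold q0. intros y [Hy HQ].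
  assert (Hy1 := Rlt_le_trans _ _ _ Hy (Rmin_l _ _)).
  assert (Hy2 := Rlt_le_trans _ _ _ Hy (Rmin_r _ _)).
  destruct (MVT_open (fun s => phi s q0) (fun s => phiy s q0) y0 y) as [c [Bc Ec]].
  { intros x Hx. apply Hd2. change (Rabs (x - y0) < d2).
    eapply Rle_lt_trans; [|exact Hy2]. apply between_Rabs. lra. }
  { intros x. apply Cphi. }
  destruct (MVT_open (phi y) (phiq y) q0 (Q y)) as [e [Be Ee]].
  { intros x _. apply Dq. }
  { intros x. eapply continuous_of_derive, Dq. }
  apply between_Rabs in Bc. apply between_Rabs in Be.
  assert (P0 : phi y0 q0 = 0) by (apply (Hd2 y0), ball_center).
  assert (P1 : phi y (Q y) = 0) by (apply (Hd2 y); exact Hy2).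
  assert (Hball : ball ((y0, q0), (y0, q0)) d ((c, q0), (y, e))).
  { split; (split; simpl).
    - change (Rabs (c - y0) < d). lra.
    - apply ball_center.
    - exact Hy1.
    - change (Rabs (e - q0) < d). lra. }
  destruct (Hd _ Hball) as [K1 K2]. unfold k in K1. simpl in K1, K2.
  assert (Hq : phiq y e <> 0).
  { intros Hz. rewrite Hz in K2. rewrite Rminus_0_l, Rabs_Ropp in K2. lra. }
  assert (EQ : Q y - q0 = - (phiy c q0 / phiq y e) * (y - y0)).
  { apply (Rmult_eq_reg_l (phiq y e)); [|exact Hq].
    replace (phiq y e * (- (phiy c q0 / phiq y e) * (y - y0))) with (- (phiy c q0 * (y - y0)))
      by (field; exact Hq). lra. }
  rewrite EQ, <- Rmult_minus_distr_r, Rabs_mult.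
  apply Rmult_le_compat_r; [apply Rabs_pos | left; exact K1].
Qed.

(** A sign change would give a zero on the segment to the origin. *)
Lemma cont5_constant_sign (h : R -> R -> R -> R -> R -> R) :
  cont5 h -> (forall x u p q r : R, h x u p q r <> 0) ->
  exists sg, sg <> 0 /\ forall x u p q r : R, 0 < sg * h x u p q r.
Proof.
  intros Ch Hn. exists (h 0 0 0 0 0). split; [apply Hn|].
  intros x u p q r.
  destruct (Rlt_le_dec 0 (h 0 0 0 0 0 * h x u p q r)) as [H|H]; [exact H|exfalso].
  pose (k := fun t => h (t * x) (t * u) (t * p) (t * q) (t * r)).
  destruct (IVT_gen k 0 1 0) as [t [_ Et]].
  - intros t. apply continuity_pt_filterlim. unfold k. change (continuous
      (fun t => h (t * x) (t * u) (t * p) (t * q) (t * r)) t). cont.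
  - unfold k. rewrite !Rmult_0_l, !Rmult_1_l.
    assert (N1 := Hn 0 0 0 0 0). assert (N2 := Hn x u p q r).
    set (a := h 0 0 0 0 0) in *. set (b := h x u p q r) in *.
    unfold Rmin, Rmax. destruct (Rle_dec a b); split; nra.
  - exact (Hn _ _ _ _ _ Et).
Qed.

(** What the construction of [L] and the dissipation identity use about the
    solution [q = F(x,u,p,r)] of [f = 0]: [F^0] is [C^1], its derivative [F_p]
    is [C^1] in [(u,p)], and [F^1] is positive. *)
Record implicit_data (f : R -> R -> R -> R -> R -> R)
    (Fx Fu Fp Fpu Fpp : R -> R -> R -> R) : Prop := {
  id_c : cont3 (fun x u p => F0 f (clamp x) u p);
  id_cx : cont3 Fx; id_cu : cont3 Fu; id_cp : cont3 Fp;
  id_cpu : cont3 Fpu; id_cpp : cont3 Fpp;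
  id_dx : forall x u p : R, 0 < x < 1 -> is_derive (fun s => F0 f (clamp s) u p) x (Fx x u p);
  id_du : forall x u p : R, is_derive (fun s => F0 f (clamp x) s p) u (Fu x u p);
  id_dp : forall x u p : R, is_derive (fun s => F0 f (clamp x) u s) p (Fp x u p);
  id_dpu : forall x u p : R, is_derive (fun s => Fp x s p) u (Fpu x u p);
  id_dpp : forall x u p : R, is_derive (fun s => Fp x u s) p (Fpp x u p);
  id_unique : forall x u p q r : R, 0 <= x <= 1 -> f x u p q r = 0 -> F f x u p r = q;
  id_F1 : forall x u p r : R, 0 <= x <= 1 -> F_dom f x u p r -> 0 < F1 f x u p r
}.

(** Normalized by a constant sign, [f] increases in [q] and decreases in [r].
    Hence [q] is unique, and it increases with [r] along [f = 0], which is
    [F^1 > 0].  A second derivative of [F^0] exists where one derivative is in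
    [p], because [F^0_p = - f_p / f_q] at [r = 0] is built from functions
    assumed to be [C^1]. *)
Theorem implicit_data_exists (f : R -> R -> R -> R -> R -> R) :
  C1_xupqr f ->
  C1_xupq (fun x u p q => f_p f x u p q 0) ->
  C1_xupq (fun x u p q => f_q f x u p q 0) ->
  parabolic f ->
  (forall x u p, 0 <= x <= 1 -> F_dom f x u p 0) ->
  exists Fx Fu Fp Fpu Fpp, implicit_data f Fx Fu Fp Fpu Fpp.
Proof.
  intros Hf Hfp Hfq Hpar Hdom.
  destruct (C1_xupqr_partials f Hf) as [fx [fu [fp [fq [fr [[Cx [Cu [Cp [Cq Cr]]]] [Cf Hd]]]]]]].
  destruct (C1_xupq_partials _ Hfp) as [au [ap [aq [[Cau [Cap Caq]] [Ca Hda]]]]].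
  destruct (C1_xupq_partials _ Hfq) as [bu [bp [bq [[Cbu [Cbp Cbq]] [Cb Hdb]]]]].
  cbv beta in Hda, Hdb, Ca, Cb.
  assert (Dx : forall x u p q r : R, 0 < x < 1 ->
    is_derive (fun s => f (clamp s) u p q r) x (fx x u p q r)) by apply Hd.
  assert (Du : forall x u p q r : R,
    is_derive (fun s => f (clamp x) s p q r) u (fu x u p q r)) by apply Hd.
  assert (Dp : forall x u p q r : R,
    is_derive (fun s => f (clamp x) u s q r) p (fp x u p q r)) by apply Hd.
  assert (Dq : forall x u p q r : R,
    is_derive (fun s => f (clamp x) u p s r) q (fq x u p q r)) by apply Hd.
  assert (Dr : forall x u p q r : R,
    is_derive (fun s => f (clamp x) u p q s) r (fr x u p q r)) by apply Hd.
  clear Hd.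
  assert (Efp : forall x u p q r : R, f_p f (clamp x) u p q r = fp x u p q r).
  { intros x u p q r. apply is_derive_unique. apply Dp. }
  assert (Efq : forall x u p q r : R, f_q f (clamp x) u p q r = fq x u p q r).
  { intros x u p q r. apply is_derive_unique. apply Dq. }
  assert (Efr : forall x u p q r : R, f_r f (clamp x) u p q r = fr x u p q r).
  { intros x u p q r. apply is_derive_unique. apply Dr. }
  assert (Hqr : forall x u p q r : R, fq x u p q r * fr x u p q r < 0).
  { intros x u p q r. rewrite <- Efq, <- Efr. apply Hpar, clamp_in. }
  assert (Hq0 : forall x u p q r : R, fq x u p q r <> 0).
  { intros x u p q r E. specialize (Hqr x u p q r). rewrite E in Hqr. lra. }
  destruct (cont5_constant_sign fq Cq Hq0) as [sg [Hsg Hpos]].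
  assert (Hneg : forall x u p q r : R, sg * fr x u p q r < 0).
  { intros x u p q r. specialize (Hqr x u p q r). specialize (Hpos x u p q r).
    set (A := fq x u p q r) in *. set (B := fr x u p q r) in *.
    destruct (Rlt_le_dec (sg * B) 0) as [H|H]; [exact H|exfalso].
    assert (0 <= (sg * A) * (sg * B)) by (apply Rmult_le_pos; lra).
    assert (0 < sg * sg) by nra.
    assert (0 < (sg * sg) * - (A * B)) by (apply Rmult_lt_0_compat; lra). nra. }
  assert (Cf' : forall x u p r q : R, continuous (fun s => f (clamp x) u p s r) q).
  { intros x u p r q. exact (continuous_of_derive _ _ _ (Dq x u p q r)). }
  assert (Inc : forall x u p r a b : R, a < b ->
     sg * f (clamp x) u p a r < sg * f (clamp x) u p b r).
  { intros x u p r a b Hab.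
    assert (T := increasing_of_derive_pos (fun q => sg * f (clamp x) u p q r)
       (fun q => sg * fq x u p q r)).
    cbv beta in T. apply T; [| |exact Hab].
    - intros q. apply (is_derive_scal (fun q => f (clamp x) u p q r)). apply Dq.
    - intros q. apply Hpos. }
  assert (Dec : forall x u p q a b : R, a < b ->
     sg * f (clamp x) u p q b < sg * f (clamp x) u p q a).
  { intros x u p q a b Hab.
    assert (T := increasing_of_derive_pos (fun r => - sg * f (clamp x) u p q r)
       (fun r => - sg * fr x u p q r)).
    cbv beta in T. assert (- sg * f (clamp x) u p q a < - sg * f (clamp x) u p q b); [|lra].
    apply T; [| |exact Hab].
    - intros r. apply (is_derive_scal (fun r => f (clamp x) u p q r)). apply Dr.
    - intros r. specialize (Hneg x u p q r). lra. }
  assert (Uniq : forall x u p r a b : R, f (clamp x) u p a r = 0 -> f (clamp x) u p b r = 0 -> a = b).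
  { intros x u p r a b Ha Hb.
    destruct (Rtotal_order a b) as [H|[H|H]]; [|exact H|];
      apply (Inc x u p r) in H; rewrite Ha, Hb in H; lra. }
  assert (HF : forall x u p q r : R, f (clamp x) u p q r = 0 -> F f (clamp x) u p r = q).
  { intros x u p q r H. apply (Uniq x u p r); [|exact H].
    apply (iota_correct (V := R_CompleteNormedModule) (fun q => f (clamp x) u p q r = 0)).
    exists q. split; [exact H|]. intros q' H'. apply (Uniq x u p r); assumption. }
  pose (Q := fun x u p : R => F0 f (clamp x) u p).
  assert (HQ0 : forall x u p : R, f (clamp x) u p (Q x u p) 0 = 0).
  { intros x u p. destruct (Hdom (clamp x) u p (clamp_in x)) as [q Hq].
    unfold Q, F0. rewrite (HF x u p q 0 Hq). exact Hq. }
  assert (CQ : cont3 Q).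
  { intros [[x u] p]. apply continuous_eps. intros eps He.
    assert (T := increasing_root_persists
      (fun (z : R * R * R) q => sg * f (clamp (fst (fst z))) (snd (fst z)) (snd z) q 0)
      (x, u, p) (Q x u p)).
    cbv beta in T. simpl fst in T. simpl snd in T.
    assert (T' := fun a b c d => T a b c d eps He).
    generalize (T' ltac:(intros q; apply continuous_mul; [apply (continuous_cst sg)|];
        apply (cont5_comp _ (fun z : R * R * R => fst (fst z)) (fun z => snd (fst z))
          (fun z => snd z) (fun _ => q) (fun _ => 0) (x, u, p) Cf); cont)
      ltac:(intros z q; apply continuous_mul; [apply (continuous_cst sg) | apply Cf'])
      (Inc x u p 0) ltac:(rewrite HQ0; ring)).
    apply filter_imp. intros [[x' u'] p'] [q [Hq Eq]]. simpl in *.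
    replace (Q x' u' p') with q; [exact Hq|].
    symmetry. apply HF. nra. }
  pose (A := fun x u p : R => fp x u p (Q x u p) 0).
  pose (B := fun x u p : R => fq x u p (Q x u p) 0).
  assert (CA : cont3 A) by (intros z; unfold A; cont).
  assert (CB : cont3 B) by (intros z; unfold B; cont).
  assert (HB : forall x u p : R, B x u p <> 0) by (intros; apply Hq0).
  pose (Fu := fun x u p : R => - (fu x u p (Q x u p) 0 / B x u p)).
  pose (Fp := fun x u p : R => - (A x u p / B x u p)).
  pose (Fx := fun x u p : R => - (fx x u p (Q x u p) 0 / B x u p)).
  assert (Cquot : forall k : R -> R -> R -> R, cont3 k -> cont3 (fun x u p => - (k x u p / B x u p))).
  { intros k Ck z. apply continuous_neg. apply continuous_quot; [cont | cont | apply HB]. }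
  assert (CFu : cont3 Fu).
  { apply (Cquot (fun x u p => fu x u p (Q x u p) 0)). intros z. cont. }
  assert (CFp : cont3 Fp) by (apply Cquot, CA).
  assert (CFx : cont3 Fx).
  { apply (Cquot (fun x u p => fx x u p (Q x u p) 0)). intros z. cont. }
  assert (DFu : forall x u p : R, is_derive (fun s => Q x s p) u (Fu x u p)).
  { intros x u p.
    apply (implicit_derive (fun s q => f (clamp x) s p q 0) (fun s q => fu x s p q 0)
      (fun s q => fq x s p q 0) (fun s => Q x s p) u).
    - apply filter_forall. intros y q. apply Du.
    - intros q y. exact (continuous_of_derive _ _ _ (Du x y p q 0)).
    - intros y q. apply Dq.
    - intros z. cont.
    - intros z. cont.
    - cont.
    - apply filter_forall. intros y. apply HQ0.
    - apply Hq0. }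
  assert (DFp : forall x u p : R, is_derive (fun s => Q x u s) p (Fp x u p)).
  { intros x u p.
    apply (implicit_derive (fun s q => f (clamp x) u s q 0) (fun s q => fp x u s q 0)
      (fun s q => fq x u s q 0) (fun s => Q x u s) p).
    - apply filter_forall. intros y q. apply Dp.
    - intros q y. exact (continuous_of_derive _ _ _ (Dp x u y q 0)).
    - intros y q. apply Dq.
    - intros z. cont.
    - intros z. cont.
    - cont.
    - apply filter_forall. intros y. apply HQ0.
    - apply Hq0. }
  assert (DFx : forall x u p : R, 0 < x < 1 -> is_derive (fun s => Q s u p) x (Fx x u p)).
  { intros x u p Hx.
    apply (implicit_derive (fun s q => f (clamp s) u p q 0) (fun s q => fx s u p q 0)
      (fun s q => fq s u p q 0) (fun s => Q s u p) x).
    - generalize (locally_between 0 1 x Hx). apply filter_imp. intros y Hy q. apply Dx, Hy.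
    - intros q y. apply (cont5_comp _ (fun s => s) (fun _ => u) (fun _ => p)
        (fun _ => q) (fun _ => 0) y Cf); cont.
    - intros y q. apply Dq.
    - intros z. cont.
    - intros z. cont.
    - cont.
    - apply filter_forall. intros y. apply HQ0.
    - apply Hq0. }
  assert (Dsub : forall k ku kp kq : R -> R -> R -> R -> R, cont4 k -> cont4 ku -> cont4 kp -> cont4 kq ->
     (forall x u p q : R, is_derive (fun s => k x s p q) u (ku x u p q) /\
       is_derive (fun s => k x u s q) p (kp x u p q) /\ is_derive (fun s => k x u p s) q (kq x u p q)) ->
     forall x u p : R,
     is_derive (fun s => k x s p (Q x s p)) u (ku x u p (Q x u p) + kq x u p (Q x u p) * Fu x u p) /\
     is_derive (fun s => k x u s (Q x u s)) p (kp x u p (Q x u p) + kq x u p (Q x u p) * Fp x u p)).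
  { intros k ku kp kq Ck Cku Ckp Ckq Dk x u p.
    assert (T := chain3 (k x) (ku x) (kp x) (kq x)). split.
    - eapply is_derive_eq.
      { apply (T (fun s => s) (fun _ => p) (fun s => Q x s p) u 1 0 (Fu x u p)); auto.
        1, 2, 3, 4: intros z; cont.
        1, 2, 3: intros; apply Dk.
        - apply (is_derive_id (K := R_AbsRing)).
        - apply (is_derive_const p). }
      cbv beta. Rring.
    - eapply is_derive_eq.
      { apply (T (fun _ => u) (fun s => s) (fun s => Q x u s) p 0 1 (Fp x u p)); auto.
        1, 2, 3, 4: intros z; cont.
        1, 2, 3: intros; apply Dk.
        - apply (is_derive_const u).
        - apply (is_derive_id (K := R_AbsRing)). }
      cbv beta. Rring. }
  assert (DA : forall x u p : R,
     is_derive (fun s => A x s p) u (au x u p (Q x u p) + aq x u p (Q x u p) * Fu x u p) /\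
     is_derive (fun s => A x u s) p (ap x u p (Q x u p) + aq x u p (Q x u p) * Fp x u p)).
  { intros x u p. destruct (Dsub _ au ap aq Ca Cau Cap Caq Hda x u p) as [D1 D2].
    split; [revert D1 | revert D2]; apply is_derive_ext; intros s; apply Efp. }
  assert (DB : forall x u p : R,
     is_derive (fun s => B x s p) u (bu x u p (Q x u p) + bq x u p (Q x u p) * Fu x u p) /\
     is_derive (fun s => B x u s) p (bp x u p (Q x u p) + bq x u p (Q x u p) * Fp x u p)).
  { intros x u p. destruct (Dsub _ bu bp bq Cb Cbu Cbp Cbq Hdb x u p) as [D1 D2].
    split; [revert D1 | revert D2]; apply is_derive_ext; intros s; apply Efq. }
  pose (qd := fun a' b' : R -> R -> R -> R => fun x u p : R =>
     - ((a' x u p * B x u p - A x u p * b' x u p) / (B x u p * B x u p))).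
  assert (Cqd : forall a' b', cont3 a' -> cont3 b' -> cont3 (qd a' b')).
  { intros a' b' Ca' Cb' z. unfold qd. apply continuous_neg. apply continuous_quot; [cont | cont |].
    apply Rmult_integral_contrapositive_currified; apply HB. }
  assert (Dqd : forall (a b : R -> R) t a' b', is_derive a t a' -> is_derive b t b' -> b t <> 0 ->
     is_derive (fun s => - (a s / b s)) t (- ((a' * b t - a t * b') / (b t * b t)))).
  { intros a b t a' b' Da Db Hb.
    apply (is_derive_opp (fun s => a s / b s)).
    eapply is_derive_eq; [apply (is_derive_div a b t a' b'); assumption|].
    match goal with |- @eq _ ?l ?r => change (@eq R l r) end. field. exact Hb. }
  pose (Fpu := qd (fun x u p => au x u p (Q x u p) + aq x u p (Q x u p) * Fu x u p)
                  (fun x u p => bu x u p (Q x u p) + bq x u p (Q x u p) * Fu x u p)).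
  pose (Fpp := qd (fun x u p => ap x u p (Q x u p) + aq x u p (Q x u p) * Fp x u p)
                  (fun x u p => bp x u p (Q x u p) + bq x u p (Q x u p) * Fp x u p)).
  exists Fx, Fu, Fp, Fpu, Fpp.
  split; try assumption.
  - apply Cqd; intros z; cont.
  - apply Cqd; intros z; cont.
  - intros x u p. apply (Dqd (fun s => A x s p) (fun s => B x s p)); [apply DA | apply DB | apply HB].
  - intros x u p. apply (Dqd (fun s => A x u s) (fun s => B x u s)); [apply DA | apply DB | apply HB].
  - intros x u p q r Hx H. rewrite <- (clamp_id x Hx). apply HF. rewrite clamp_id by exact Hx. exact H.
  - intros x u p r Hx [q Hq]. rewrite <- (clamp_id x Hx) in Hq |- *.
    specialize (HQ0 x u p). set (q0 := Q x u p) in *.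
    unfold F1. destruct (Req_EM_T r 0) as [Er|Nr].
    + (* [F_r(x,u,p,0) = - f_r / f_q], [F] being defined for [r] near [0] *)
      assert (T := fun eps He => increasing_root_persists
        (fun r q => sg * f (clamp x) u p q r) 0 q0
        ltac:(intros q'; apply continuous_mul; [apply (continuous_cst sg)|];
           exact (continuous_of_derive _ _ _ (Dr x u p q' 0)))
        ltac:(intros r' q'; apply continuous_mul; [apply (continuous_cst sg) | apply Cf'])
        (Inc x u p 0) ltac:(cbv beta; rewrite HQ0; ring) eps He).
      assert (HD : is_derive (fun s => F f (clamp x) u p s) 0 (- (fr x u p q0 0 / fq x u p q0 0))).
      { assert (E0 : F f (clamp x) u p 0 = q0) by (apply HF, HQ0).
        rewrite <- E0.
        apply (implicit_derive (fun s q => f (clamp x) u p q s) (fun s q => fr x u p q s)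
          (fun s q => fq x u p q s) (fun s => F f (clamp x) u p s) 0).
        - apply filter_forall. intros y q'. apply Dr.
        - intros q' y. exact (continuous_of_derive _ _ _ (Dr x u p q' y)).
        - intros y q'. apply Dq.
        - intros z. cont.
        - intros z. cont.
        - apply continuous_eps. intros eps He. rewrite E0.
          generalize (T eps He). apply filter_imp. intros s [q' [B1 B2]].
          rewrite (HF x u p q' s); [exact B1 | nra].
        - generalize (T 1 Rlt_0_1). apply filter_imp. intros s [q' [B1 B2]].
          rewrite (HF x u p q' s); nra.
        - apply Hq0. }
      match goal with |- 0 < ?l =>
        replace l with (- (fr x u p q0 0 / fq x u p q0 0))
          by (symmetry; apply is_derive_unique; exact HD) end.
      specialize (Hqr x u p q0 0). specialize (Hq0 x u p q0 0).
      set (a := fr x u p q0 0) in *. set (b := fq x u p q0 0) in *.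
      replace (- (a / b)) with (- (b * a) * (/ b * / b)) by (field; exact Hq0).
      apply Rmult_lt_0_compat; [lra|].
      assert (/ b <> 0) by (apply Rinv_neq_0_compat; exact Hq0). nra.
    + rewrite (HF x u p q r Hq). change (F0 f (clamp x) u p) with q0.
      assert (M : forall r1 r2 q1 q2, r1 < r2 -> f (clamp x) u p q1 r1 = 0 ->
        f (clamp x) u p q2 r2 = 0 -> q1 < q2).
      { intros r1 r2 q1 q2 Hr H1 H2. apply Rnot_le_lt. intros Hle.
        assert (D1 := Dec x u p q2 r1 r2 Hr). rewrite H2 in D1.
        destruct Hle as [Hlt|Heq].
        - assert (I1 := Inc x u p r1 q2 q1 Hlt). rewrite H1 in I1. lra.
        - subst q2. rewrite H1 in D1. lra. }
      destruct (Rtotal_order r 0) as [H|[H|H]]; [|contradiction|].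
      * assert (q < q0) by (apply (M r 0); assumption).
        replace ((q - q0) / r) with ((q0 - q) / - r) by (field; lra).
        apply Rdiv_lt_0_compat; lra.
      * assert (q0 < q) by (apply (M 0 r); assumption).
        apply Rdiv_lt_0_compat; lra.
Qed.

(** * The Lagrange function *)

(** A bounded [C^1] function that is the identity on [[-M,M]].  Composed with
    it, the coefficients become bounded together with their derivatives, which
    makes all characteristics global, and nothing changes on the set of values
    that the solutions take. *)
Lemma saturation_exists M : 0 <= M ->
  exists sg sg' : R -> R,
    (forall y, continuous sg' y) /\ (forall y, is_derive sg y (sg' y)) /\
    (forall y, Rabs (sg y) <= M + 1) /\ (forall y, Rabs (sg' y) <= 1) /\
    (forall y, Rabs y <= M -> sg y = y /\ sg' y = 1).
Proof.
  intros HM.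
  pose (sg' := fun s => clamp (M + 1 - Rabs s)). pose (sg := fun y => RInt sg' 0 y).
  assert (Cs : forall y, continuous sg' y).
  { intros y. apply (continuous_R clamp); [apply clamp_cont|].
    apply continuous_sub; [apply (continuous_cst (M + 1))|].
    apply continuity_pt_filterlim, Rcontinuity_abs. }
  assert (Ds : forall y, is_derive sg y (sg' y)) by (intros; apply is_derive_RInt_0, Cs).
  assert (B1 : forall y, 0 <= sg' y <= 1) by (intros; apply clamp_in).
  assert (Z : sg 0 = 0) by apply (RInt_point (V := R_CompleteNormedModule)).
  assert (Hmvt : forall a b, exists c, Rmin a b <= c <= Rmax a b /\ sg b - sg a = sg' c * (b - a)).
  { intros a b. apply MVT_open; [intros; apply Ds | intros; eapply continuous_of_derive, Ds]. }
  assert (Hlip : forall y, Rabs (sg y) <= Rabs y).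
  { intros y. destruct (Hmvt 0 y) as [c [_ E]]. rewrite Z, !Rminus_0_r in E.
    rewrite E, Rabs_mult, (Rabs_pos_eq (sg' c)) by apply B1.
    specialize (B1 c). assert (T := Rabs_pos y). nra. }
  assert (Hout : forall a y, Rabs a = M + 1 -> (a <= y /\ 0 <= a \/ y <= a /\ a <= 0) -> sg y = sg a).
  { intros a y Ha Hy. destruct (Hmvt a y) as [c [Hc E]].
    assert (Hc0 : sg' c = 0).
    { unfold sg', clamp. rewrite Rmin_left, Rmax_left; [reflexivity| |].
      - unfold Rmin, Rmax in Hc. destruct (Rle_dec a y), Hy; unfold Rabs in *;
          destruct (Rcase_abs a), (Rcase_abs c); lra.
      - unfold Rmin, Rmax in Hc. destruct (Rle_dec a y), Hy; unfold Rabs in *;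
          destruct (Rcase_abs a), (Rcase_abs c); lra. }
    rewrite Hc0 in E. lra. }
  exists sg, sg'. split; [exact Cs|]. split; [exact Ds|]. split; [|split].
  - intros y. destruct (Rle_dec (Rabs y) (M + 1)) as [H|H].
    + eapply Rle_trans; [apply Hlip | exact H].
    + destruct (Rle_dec 0 y).
      * rewrite Rabs_pos_eq in H by lra. assert (A : Rabs (M + 1) = M + 1) by (apply Rabs_pos_eq; lra).
        rewrite (Hout (M + 1) y); [|exact A|left; lra].
        eapply Rle_trans; [apply Hlip|]. lra.
      * rewrite Rabs_left in H by lra.
        assert (A : Rabs (- (M + 1)) = M + 1) by (rewrite Rabs_Ropp; apply Rabs_pos_eq; lra).
        rewrite (Hout (- (M + 1)) y); [|exact A|right; lra].
        eapply Rle_trans; [apply Hlip|]. lra.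
  - intros y. rewrite Rabs_pos_eq; apply B1.
  - intros y Hy.
    assert (One : forall c, Rabs c <= M -> sg' c = 1).
    { intros c Hc. unfold sg', clamp. rewrite Rmin_right, Rmax_right; lra. }
    split; [|apply One, Hy].
    destruct (Hmvt 0 y) as [c [Hc E]]. apply between_Rabs in Hc. rewrite !Rminus_0_r in Hc.
    rewrite Z, One in E; lra.
Qed.

Record C1_xup_everywhere (h hx hu hp : R -> R -> R -> R) : Prop := {
  ev_c : cont3 h; ev_cx : cont3 hx; ev_cu : cont3 hu; ev_cp : cont3 hp;
  ev_dx : forall x u p : R, is_derive (fun s => h s u p) x (hx x u p);
  ev_du : forall x u p : R, is_derive (fun s => h x s p) u (hu x u p);
  ev_dp : forall x u p : R, is_derive (fun s => h x u s) p (hp x u p)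
}.

Lemma C1_xup_everywhere_on h hx hu hp : C1_xup_everywhere h hx hu hp -> C1_xup h.
Proof. intros []. apply (C1_xup_of_partials h hx hu hp); auto. Qed.

Lemma cont3_primitive (h : R -> R -> R -> R) :
  cont3 h -> cont3 (fun x u p => RInt (h x u) 0 p).
Proof.
  intros Ch z.
  assert (C2 : cont2 (fun (z : R * R) s => h (fst z) (snd z) s)) by (intros w; cont).
  assert (CI := cont2_RInt _ C2). cbv beta in CI.
  apply (cont2_comp _ (fun z : R * R * R => fst z) (fun z : R * R * R => snd z) z CI); cont.
Qed.

Lemma primitive_C1 h hx hu hp :
  C1_xup_everywhere h hx hu hp ->
  C1_xup_everywhere (fun x u p => RInt (h x u) 0 p) (fun x u p => RInt (hx x u) 0 p)
    (fun x u p => RInt (hu x u) 0 p) h.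
Proof.
  intros [Ch Cx Cu Cp Dx Du Dp]. split; auto; try (apply cont3_primitive; assumption).
  - intros x u p. apply (is_derive_RInt_under (fun y s => h y u s) (fun y s => hx y u s)).
    + apply filter_forall. intros y t. apply Dx.
    + intros t. cont.
    + intros y t. cont.
  - intros x u p. apply (is_derive_RInt_under (fun y s => h x y s) (fun y s => hu x y s)).
    + apply filter_forall. intros y t. apply Du.
    + intros t. cont.
    + intros y t. cont.
  - intros x u p. apply is_derive_RInt_0. intros y. cont.
Qed.

(** The boundary term [L_p u_t] of [dE/dt] vanishes: because [u_t = 0] under a
    Dirichlet condition, because [L_p = 0] under a Robin condition. *)
Definition natural_boundary (bc : boundary_condition) (iota : R) (Lp : R -> R -> R -> R) : Prop :=
  match bc with
  | Dirichlet => True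
  | Robin b => forall v, Lp iota v (b v) = 0
  end.

(** A Lagrange function suited to solutions with [|u|, |u_x| <= M].  The
    identity [lg_el] says that
    [L_u - d/dx L_p = - L_pp (u_xx - F^0)] along any function [u(x)] in that
    box, so that the stationary equation is the Euler-Lagrange equation up to
    the positive factor [L_pp]. *)
Record lagrangian (f : R -> R -> R -> R -> R -> R) (bc0 bc1 : boundary_condition) (M : R)
    (L Lu Lp Lpx Lpu Lpp : R -> R -> R -> R) : Prop := {
  lg_C1 : C1_xup L;
  lg_C1p : C1_xup_everywhere Lp Lpx Lpu Lpp;
  lg_C1pp : C1_xup Lpp;
  lg_up : C1_up L Lu Lp;
  lg_pos : forall x u p : R, 0 < Lpp x u p;
  lg_el : forall x u p : R, 0 < x < 1 -> Rabs u <= M -> Rabs p <= M ->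
    Lu x u p - Lpx x u p - p * Lpu x u p = Lpp x u p * F0 f x u p;
  lg_bc0 : natural_boundary bc0 0 Lp;
  lg_bc1 : natural_boundary bc1 1 Lp
}.
Arguments lg_C1p {_ _ _ _ _ _ _ _ _ _} _.
Arguments lg_up {_ _ _ _ _ _ _ _ _ _} _.
Arguments lg_pos {_ _ _ _ _ _ _ _ _ _} _.
Arguments lg_el {_ _ _ _ _ _ _ _ _ _} _.
Arguments lg_bc0 {_ _ _ _ _ _ _ _ _ _} _.
Arguments lg_bc1 {_ _ _ _ _ _ _ _ _ _} _.

(** Any function [c(u)] may be added to [J = int_0^p L_pp] without changing
    [L_pp]; the choice [c(u) = - J(iota,u,b(u))] makes the natural boundary
    condition of the variational problem the prescribed one. *)
Lemma boundary_correction (bc : boundary_condition) (iota : R) J Jx Ju Jp :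
  bc_C1 bc -> C1_xup_everywhere J Jx Ju Jp ->
  exists c c' : R -> R, (forall u, continuous c' u) /\ (forall u, is_derive c u (c' u)) /\
    match bc with Dirichlet => True | Robin b => forall v, J iota v (b v) + c v = 0 end.
Proof.
  intros Hbc [Ch Cx Cu Cp Dx Du Dp]. destruct bc as [|b].
  - exists (fun _ => 0), (fun _ => 0). split; [|split; [|exact I]].
    + intros u. apply (continuous_cst 0).
    + intros u. apply (is_derive_const (0 : R)).
  - destruct Hbc as [db Hdb].
    assert (Db : forall u : R, is_derive b u (db u 1)).
    { intros u. apply (C1_on_directional (fun _ : R => True) b (db u) u 1 (fun s : R => s) u).
      - apply Hdb. exact I.
      - intros s. change (s = u + (s - u) * 1). ring.
      - apply filter_forall. auto. }
    assert (Cdb : forall u : R, continuous (fun w => db w 1) u).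
    { intros u. apply (within_continuous (fun _ : R => True) (fun w => db w 1) (fun w : R => w)).
      - apply continuous_id.
      - auto.
      - apply Hdb. exact I. }
    assert (Cb : forall u : R, continuous b u).
    { intros u. exact (continuous_of_derive _ _ _ (Db u)). }
    exists (fun u => - J iota u (b u)),
      (fun u => - (Ju iota u (b u) + Jp iota u (b u) * db u 1)). split; [|split].
    + intros u. cont.
    + intros u. apply (is_derive_opp (fun u => J iota u (b u))).
      eapply is_derive_eq.
      * apply (chain3 J Jx Ju Jp (fun _ => iota) (fun s => s) b u 0 1 (db u 1)); auto.
        -- apply (is_derive_const (iota : R)).
        -- apply (is_derive_id (K := R_AbsRing)).
      * Rring.
    + intros v. ring.
Qed.

(** Differentiating the identity [L_u - L_px - p L_pu = L_pp F^0] in [p] leaves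
    the linear equation [w_x + p w_u + (F^0 w)_p = 0] for [w = L_pp], which the
    transport theorem solves by [w = exp g].  Integrating [w] twice in [p]
    recovers the identity up to its value at [p = 0], which fixes the
    [p]-independent part of [L] as [int_0^u F^0(x,v,0) w(x,v,0) dv].  Adding
    [d/dx Phi(x,u)], with [Phi_u = (1-x) c0(u) + x c1(u)], does not affect the
    identity and adjusts both boundary conditions. *)
Theorem lagrangian_exists f bc0 bc1 Fx Fu Fp Fpu Fpp M :
  implicit_data f Fx Fu Fp Fpu Fpp -> bc_C1 bc0 -> bc_C1 bc1 -> 0 <= M ->
  exists L Lu Lp Lpx Lpu Lpp, lagrangian f bc0 bc1 M L Lu Lp Lpx Lpu Lpp.
Proof.
  intros ID Hbc0 Hbc1 HM.
  destruct (saturation_exists M HM) as [sg [sg' [Csg' [Dsg [Bsg [Bsg' Isg]]]]]].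
  assert (Csg : forall y, continuous sg y) by (intros y; exact (continuous_of_derive _ _ _ (Dsg y))).
  destruct ID as [CF CFx CFu CFp CFpu CFpp DFx DFu DFp DFpu DFpp _ _].
  assert (Csc : forall (U : UniformSpace) (a : U -> R) z, continuous a z ->
     continuous (fun w => sg (a w)) z).
  { intros U a z Ha. apply (continuous_R sg a); auto. }
  assert (Csc' : forall (U : UniformSpace) (a : U -> R) z, continuous a z ->
     continuous (fun w => sg' (a w)) z).
  { intros U a z Ha. apply (continuous_R sg' a); auto. }
  assert (Ccl : forall (U : UniformSpace) (a : U -> R) z, continuous a z ->
     continuous (fun w => clamp (a w)) z).
  { intros U a z Ha. apply (continuous_R clamp a); [apply clamp_cont | auto]. }
  pose (sat := fun (k : R -> R -> R -> R) (x u p : R) => k (clamp x) (sg u) (sg p)).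
  assert (Csat : forall k, cont3 k -> cont3 (sat k)).
  { intros k Ck z. unfold sat. apply (cont3_comp k); [exact Ck | apply Ccl | apply Csc | apply Csc]; cont. }
  pose (F0c := fun x u p : R => F0 f (clamp x) u p).
  pose (G := sat F0c). pose (S := sat Fp).
  assert (Dsat : forall k ku kp, (forall x u p : R, is_derive (fun s => k x s p) u (ku x u p)) ->
     (forall x u p : R, is_derive (fun s => k x u s) p (kp x u p)) ->
     cont3 k -> cont3 ku -> cont3 kp ->
     C1_up (sat k) (fun x u p => sat ku x u p * sg' u) (fun x u p => sat kp x u p * sg' p)).
  { intros k ku kp Du Dp Ck Cku Ckp. split.
    - apply Csat, Ck.
    - intros z. apply continuous_mul; [apply (Csat ku Cku) | apply Csc'; cont].
    - intros z. apply continuous_mul; [apply (Csat kp Ckp) | apply Csc'; cont].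
    - intros x u p. eapply is_derive_eq.
      + apply (is_derive_comp (fun s => k (clamp x) s (sg p)) sg); [apply Du | apply Dsg].
      + unfold scal; simpl; unfold mult; simpl. unfold sat. Rring.
    - intros x u p. eapply is_derive_eq.
      + apply (is_derive_comp (fun s => k (clamp x) (sg u) s) sg); [apply Dp | apply Dsg].
      + unfold scal; simpl; unfold mult; simpl. unfold sat. Rring. }
  assert (HG : C1_up G (fun x u p => sat Fu x u p * sg' u) (fun x u p => sat Fp x u p * sg' p)).
  { apply Dsat; assumption. }
  assert (HS : C1_up S (fun x u p => sat Fpu x u p * sg' u) (fun x u p => sat Fpp x u p * sg' p)).
  { apply Dsat; assumption. }
  assert (Bsat : forall k, cont3 k -> exists K, 0 <= K /\ forall x u p : R, Rabs (sat k x u p) <= K).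
  { intros k Ck. destruct (cont3_bounded k (M + 1) Ck) as [K [HK HB]].
    exists K. split; [exact HK|]. intros x u p. apply HB; [apply clamp_in | apply Bsg | apply Bsg]. }
  destruct (Bsat F0c CF) as [K1 [PK1 B1]]. destruct (Bsat Fu CFu) as [K2 [PK2 B2]].
  destruct (Bsat Fp CFp) as [K3 [PK3 B3]].
  assert (Bm : forall a b K, Rabs a <= K -> Rabs b <= 1 -> Rabs (a * b) <= K).
  { intros a b K Ha Hb. rewrite Rabs_mult.
    generalize (Rabs_pos a) (Rabs_pos b). intros Pa Pb. nra. }
  destruct (transport G _ _ S _ _ (K1 + K2 + K3) HG HS) as [g [gu [gp [Hg Dgx]]]].
  { intros x u p. specialize (B1 x u p). unfold G. lra. }
  { intros x u p. apply Bm; [|apply Bsg']. specialize (B2 x u p). lra. }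
  { intros x u p. apply Bm; [|apply Bsg']. specialize (B3 x u p). lra. }
  destruct Hg as [Cg Cgu Cgp Dgu Dgp].
  assert (CG := up_c _ _ _ HG). assert (CS := up_c _ _ _ HS).
  (* the weight [w = exp g] satisfies [w_x + p w_u + (G w)_p = 0] on the box *)
  pose (w := fun x u p : R => exp (g x u p)).
  pose (gx := fun x u p : R => - (p * gu x u p + G x u p * gp x u p + S x u p)).
  assert (Cgx : cont3 gx) by (intros z; unfold gx; cont).
  assert (Dexp : forall (k : R -> R) t k', is_derive k t k' -> is_derive (fun s => exp (k s)) t (exp (k t) * k')).
  { intros k t k' Hk. eapply is_derive_eq; [apply (is_derive_comp exp k); [apply is_derive_exp | exact Hk]|].
    unfold scal; simpl; unfold mult; simpl. Rring. }
  assert (Hw : C1_xup_everywhere w (fun x u p => w x u p * gx x u p)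
     (fun x u p => w x u p * gu x u p) (fun x u p => w x u p * gp x u p)).
  { unfold w. split; [intros z; cont | intros z; cont | intros z; cont | intros z; cont | | |];
      intros x u p.
    - apply (Dexp (fun s => g s u p)), Dgx.
    - apply (Dexp (fun s => g x s p)), Dgu.
    - apply (Dexp (fun s => g x u s)), Dgp. }
  assert (HJ := primitive_C1 _ _ _ _ Hw).
  set (J := fun x u p => RInt (w x u) 0 p) in HJ.
  set (Jx := fun x u p => RInt ((fun x u p => w x u p * gx x u p) x u) 0 p) in HJ.
  set (Ju := fun x u p => RInt ((fun x u p => w x u p * gu x u p) x u) 0 p) in HJ.
  assert (HI := primitive_C1 _ _ _ _ HJ).
  set (I := fun x u p => RInt (J x u) 0 p) in HI.
  set (Ix := fun x u p => RInt (Jx x u) 0 p) in HI.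
  set (Iu := fun x u p => RInt (Ju x u) 0 p) in HI.
  destruct (boundary_correction bc0 0 J Jx Ju w Hbc0 HJ) as [c0 [c0' [Cc0' [Dc0 Bc0]]]].
  destruct (boundary_correction bc1 1 J Jx Ju w Hbc1 HJ) as [c1 [c1' [Cc1' [Dc1 Bc1]]]].
  assert (Cc0 : forall y, continuous c0 y) by (intros y; exact (continuous_of_derive _ _ _ (Dc0 y))).
  assert (Cc1 : forall y, continuous c1 y) by (intros y; exact (continuous_of_derive _ _ _ (Dc1 y))).
  assert (Hc : forall (c : R -> R) (U : UniformSpace) (a : U -> R) z, (forall y, continuous c y) ->
     continuous a z -> continuous (fun w => c (a w)) z).
  { intros c U a z Hc' Ha. apply (continuous_R c a); auto. }
  (* [k] is the [u]-derivative of the [p]-independent part of [L] *)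
  pose (k := fun x v : R => G x v 0 * w x v 0).
  pose (kx := fun x v : R => sat Fx x v 0 * w x v 0 + G x v 0 * (w x v 0 * gx x v 0)).
  assert (Cw : cont3 w) by apply Hw.
  assert (CsFx := Csat Fx CFx).
  assert (Ck : cont2 k) by (intros z; unfold k; cont).
  assert (Ckx : cont2 kx) by (intros z; unfold kx; cont).
  assert (Dk : forall x v : R, 0 < x < 1 -> is_derive (fun s => k s v) x (kx x v)).
  { intros x v Hx. unfold k, kx. eapply is_derive_eq.
    - apply (is_derive_mult (fun s => G s v 0) (fun s => w s v 0) x (sat Fx x v 0)
         (w x v 0 * gx x v 0)); [| apply (ev_dx _ _ _ _ Hw) | intros; apply Rmult_comm].
      apply (is_derive_ext (fun s => F0c s (sg v) (sg 0))).
      { intros s. unfold G, sat, F0c. rewrite clamp_idem. reflexivity. }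
      unfold sat. rewrite clamp_id by lra. apply DFx, Hx.
    - unfold plus, mult; simpl. Rring. }
  pose (V := fun x u : R => RInt (k x) 0 u).
  pose (phi := fun u : R => RInt (fun v => c1 v - c0 v) 0 u).
  assert (Dphi : forall u : R, is_derive phi u (c1 u - c0 u)).
  { intros u. apply (is_derive_RInt_0 (fun v => c1 v - c0 v)). intros v. cont. }
  assert (Cphi : forall u : R, continuous phi u) by (intros y; exact (continuous_of_derive _ _ _ (Dphi y))).
  pose (L := fun x u p : R => I x u p + V x u + phi u + p * ((1 - x) * c0 u + x * c1 u)).
  pose (Lx := fun x u p : R => Ix x u p + RInt (kx x) 0 u + p * (c1 u - c0 u)).
  pose (Lu := fun x u p : R => Iu x u p + k x u + (c1 u - c0 u) + p * ((1 - x) * c0' u + x * c1' u)).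
  pose (Lp := fun x u p : R => J x u p + ((1 - x) * c0 u + x * c1 u)).
  pose (Lpx := fun x u p : R => Jx x u p + (c1 u - c0 u)).
  pose (Lpu := fun x u p : R => Ju x u p + ((1 - x) * c0' u + x * c1' u)).
  assert (CV := cont2_RInt _ Ck). cbv beta in CV. fold V in CV.
  assert (CVx := cont2_RInt _ Ckx). cbv beta in CVx.
  destruct HI as [CI CIx CIu _ DIx DIu DIp]. destruct HJ as [CJ CJx CJu _ DJx DJu DJp].
  assert (CL : cont3 L) by (intros z; unfold L; cont; apply Hc; auto; cont).
  assert (CLx : cont3 Lx).
  { intros z. unfold Lx. cont; try (apply Hc; auto; cont).
    apply (cont2_comp _ (fun z : R * R * R => fst (fst z)) (fun z : R * R * R => snd (fst z)) z CVx);
    cont. }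
  assert (CLu : cont3 Lu) by (intros z; unfold Lu; cont; apply Hc; auto; cont).
  assert (CLp : cont3 Lp) by (intros z; unfold Lp; cont; apply Hc; auto; cont).
  assert (CLpx : cont3 Lpx) by (intros z; unfold Lpx; cont; apply Hc; auto; cont).
  assert (CLpu : cont3 Lpu) by (intros z; unfold Lpu; cont; apply Hc; auto; cont).
  assert (Dpl : forall (a b : R -> R) t a' b', is_derive a t a' -> is_derive b t b' ->
     is_derive (fun s => a s + b s) t (a' + b')).
  { intros a b t a' b' Ha Hb. apply (is_derive_plus (V := R_NormedModule) a b); assumption. }
  assert (Dmi : forall (a b : R -> R) t a' b', is_derive a t a' -> is_derive b t b' ->
     is_derive (fun s => a s - b s) t (a' - b')).
  { intros a b t a' b' Ha Hb. apply (is_derive_minus (V := R_NormedModule) a b); assumption. }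
  assert (Daff : forall x u : R, is_derive (fun s => (1 - x) * c0 s + x * c1 s) u
     ((1 - x) * c0' u + x * c1' u)).
  { intros x u. apply Dpl; [apply (is_derive_scal c0) | apply (is_derive_scal c1)]; auto. }
  assert (DLu : forall x u p : R, is_derive (fun s => L x s p) u (Lu x u p)).
  { intros x u p. apply Dpl; [apply Dpl; [apply Dpl; [apply DIu|]|apply Dphi]|].
    - apply is_derive_RInt_0. intros y. apply continuous_slice, Ck.
    - apply (is_derive_scal (fun s => (1 - x) * c0 s + x * c1 s)). apply Daff. }
  assert (DLp : forall x u p : R, is_derive (fun s => L x u s) p (Lp x u p)).
  { intros x u p. eapply is_derive_eq.
    - apply Dpl; [apply Dpl; [apply Dpl; [apply DIp|]|]|].
      + apply (is_derive_const (V x u)).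
      + apply (is_derive_const (phi u)).
      + apply (is_derive_ext (fun s => ((1 - x) * c0 u + x * c1 u) * s)); [intros; Rring|].
        apply (is_derive_scal (fun s => s)). apply (is_derive_id (K := R_AbsRing)).
    - unfold Lp, zero, one; simpl. Rring. }
  assert (DLx : forall x u p : R, 0 < x < 1 -> is_derive (fun s => L s u p) x (Lx x u p)).
  { intros x u p Hx. eapply is_derive_eq.
    - apply Dpl; [apply Dpl; [apply Dpl; [apply DIx|]|]|].
      + apply (is_derive_RInt_under k kx).
        * generalize (locally_between 0 1 x Hx). apply filter_imp. intros y Hy t. apply Dk, Hy.
        * intros t. apply Ckx.
        * intros y t. apply continuous_slice, Ck.
      + apply (is_derive_const (phi u)).
      + instantiate (1 := p * (c1 u - c0 u)). auto_derive; [trivial | ring].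
    - unfold Lx, zero; simpl. Rring. }
  assert (HLp : C1_xup_everywhere Lp Lpx Lpu w).
  { split; auto; intros x u p.
    - apply Dpl; [apply DJx|]. auto_derive; [trivial | ring].
    - apply Dpl; [apply DJu | apply Daff].
    - eapply is_derive_eq; [apply Dpl; [apply DJp | apply (is_derive_const ((1 - x) * c0 u + x * c1 u))]|].
      unfold zero; simpl. Rring. }
  exists L, Lu, Lp, Lpx, Lpu, w. split.
  - apply (C1_xup_of_partials L Lx Lu Lp); auto.
  - exact HLp.
  - exact (C1_xup_everywhere_on _ _ _ _ Hw).
  - split; assumption.
  - intros x u p. apply exp_pos.
  - intros x u p Hx Hu Hp.
    assert (EG : F0 f x u p = G x u p).
    { unfold G, sat, F0c. rewrite clamp_idem, (clamp_id x) by lra.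
      destruct (Isg u Hu) as [-> _]. destruct (Isg p Hp) as [-> _]. reflexivity. }
    rewrite EG.
    (* the defect of the Euler-Lagrange identity vanishes at [p = 0] and has
       zero derivative in [p], by the equation for [w] *)
    pose (E := fun s : R => Iu x u s - s * Ju x u s - Jx x u s - G x u s * w x u s).
    destruct (MVT_open E (fun s => - (s * (w x u s * gu x u s) + w x u s * gx x u s
       + (sat Fp x u s * sg' s * w x u s + G x u s * (w x u s * gp x u s)))) 0 p) as [c [Bc Ec]].
    { intros s _. unfold E. eapply is_derive_eq.
      - apply Dmi; [apply Dmi; [apply Dmi|]|].
        + apply (is_derive_RInt_0 (Ju x u)). intros y. cont.
        + apply (is_derive_mult (fun s => s) (Ju x u) s 1 (w x u s * gu x u s));
            [apply (is_derive_id (K := R_AbsRing)) | | intros; apply Rmult_comm].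
          apply (is_derive_RInt_0 (fun s => w x u s * gu x u s)). intros y. cont.
        + apply (is_derive_RInt_0 (fun s => w x u s * gx x u s)). intros y. cont.
        + apply (is_derive_mult (G x u) (w x u) s (sat Fp x u s * sg' s) (w x u s * gp x u s));
            [apply (up_dp _ _ _ HG) | apply (ev_dp _ _ _ _ Hw) | intros; apply Rmult_comm].
      - unfold plus, mult; simpl. Rring. }
    { intros y. unfold E. cont. }
    assert (Hc0 : Rabs c <= M).
    { apply between_Rabs in Bc. rewrite !Rminus_0_r in Bc. lra. }
    destruct (Isg c Hc0) as [_ Ic]. rewrite Ic in Ec. unfold gx in Ec.
    change (S x u c) with (sat Fp x u c) in Ec.
    assert (E0 : E 0 = - k x u).
    { unfold E, k, Iu, Jx. rewrite !(RInt_point (V := R_CompleteNormedModule)).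
      unfold zero; simpl. Rring. }
    rewrite E0 in Ec.
    replace (Lu x u p - Lpx x u p - p * Lpu x u p) with (E p + k x u + G x u p * w x u p)
      by (unfold E, Lu, Lpx, Lpu; ring).
    replace (E p) with (- k x u); [ring|].
    match type of Ec with _ = ?d * _ => replace d with 0 in Ec by ring end.
    lra.
  - destruct bc0; [exact Logic.I|]. intros v. unfold Lp. assert (T := Bc0 v). cbv beta in T. lra.
  - destruct bc1; [exact Logic.I|]. intros v. unfold Lp. assert (T := Bc1 v). cbv beta in T. lra.
Qed.

(** * Riemann integrals of bounded functions on the open interval *)

Definition in_middle (d x : R) : bool :=
  if Rlt_dec d x then (if Rlt_dec x (1 - d) then true else false) else false.

Lemma in_middle_true d x : in_middle d x = true <-> d < x < 1 - d.
Proof.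
  unfold in_middle. destruct (Rlt_dec d x), (Rlt_dec x (1 - d)); split; intros; try lra; discriminate || reflexivity.
Qed.

Lemma is_RInt_middle d c m : 0 < d < 1 / 2 ->
  is_RInt (fun x => if in_middle d x then m else c) 0 1 (2 * d * c + (1 - 2 * d) * m).
Proof.
  intros Hd.
  assert (S : forall a b k, a <= b ->
     (forall x, a < x < b -> (if in_middle d x then m else c) = k) ->
     is_RInt (fun x => if in_middle d x then m else c) a b ((b - a) * k)).
  { intros a b k Hab H. apply (is_RInt_ext (V := R_NormedModule) (fun _ => k)).
    - intros x. rewrite Rmin_left, Rmax_right by exact Hab. intros Hx. symmetry. apply H, Hx.
    - apply (is_RInt_const (V := R_NormedModule)). }
  assert (Hout : forall x, ~ (d < x < 1 - d) -> in_middle d x = false).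
  { intros x Hx. destruct (in_middle d x) eqn:E; [|reflexivity].
    apply in_middle_true in E. contradiction. }
  replace (2 * d * c + (1 - 2 * d) * m)
    with (plus ((d - 0) * c) (plus ((1 - d - d) * m) ((1 - (1 - d)) * c)))
    by (unfold plus; simpl; ring).
  apply (is_RInt_Chasles (V := R_NormedModule) _ 0 d 1);
    [|apply (is_RInt_Chasles (V := R_NormedModule) _ d (1 - d) 1)]; apply S; try lra.
  - intros x Hx. rewrite Hout; [reflexivity | lra].
  - intros x Hx. rewrite (proj2 (in_middle_true d x)); [reflexivity | lra].
  - intros x Hx. rewrite Hout; [reflexivity | lra].
Qed.

(** Darboux' criterion: the Riemann sums of [f] and [g] differ by at most those
    of [h]. *)
Lemma ex_RInt_approx (f : R -> R) a b : a < b ->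
  (forall eps, 0 < eps -> exists (g h : R -> R) (Ih : R),
     ex_RInt g a b /\ is_RInt h a b Ih /\ Ih < eps /\
     forall x, a <= x <= b -> Rabs (f x - g x) <= h x) ->
  ex_RInt f a b.
Proof.
  intros Hab H.
  apply (proj1 (filterlim_locally_cauchy (U := R_CompleteSpace)
    (F := Riemann_fine a b) (fun ptd => scal (sign (b - a)) (Riemann_sum f ptd)))).
  intros eps.
  assert (He : 0 < eps / 8) by (generalize (cond_pos eps); lra).
  destruct (H _ He) as [g [h [Ih [[Ig Hg] [Hh [HI Hfg]]]]]].
  assert (Eg : Riemann_fine a b (fun ptd => Rabs (1 * Riemann_sum g ptd - Ig) < eps / 8)).
  { rewrite <- (sign_eq_1 (b - a)) by lra. exact (Hg _ (locally_ball Ig (mkposreal _ He))). }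
  assert (Eh : Riemann_fine a b (fun ptd => Rabs (1 * Riemann_sum h ptd - Ih) < eps / 8)).
  { rewrite <- (sign_eq_1 (b - a)) by lra. exact (Hh _ (locally_ball Ih (mkposreal _ He))). }
  assert (Ep : Riemann_fine a b (fun ptd => pointed_subdiv ptd /\
      SF_h ptd = Rmin a b /\ seq.last (SF_h ptd) (SF_lx ptd) = Rmax a b)).
  { exists (mkposreal 1 Rlt_0_1). auto. }
  exists (fun ptd => Rabs (scal (sign (b - a)) (Riemann_sum f ptd) - Ig) < eps / 2).
  split.
  - generalize (filter_and _ _ Ep (filter_and _ _ Eg Eh)). apply filter_imp.
    intros ptd [[P1 [P2 P3]] [P4 P5]].
    rewrite Rmin_left in P2 by lra. rewrite Rmax_right in P3 by lra.
    rewrite sign_eq_1 by lra.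
    change (Rabs (1 * Riemann_sum f ptd - Ig) < eps / 2).
    rewrite Rmult_1_l in *.
    assert (N : Rabs (Riemann_sum f ptd - Riemann_sum g ptd) <= Riemann_sum h ptd).
    { replace (Riemann_sum f ptd - Riemann_sum g ptd)
        with (Riemann_sum (fun x => minus (f x) (g x)) ptd)
        by apply (Riemann_sum_minus (V := R_ModuleSpace)).
      apply (Riemann_sum_norm (V := R_NormedModule) (fun x => minus (f x) (g x)) h ptd P1).
      intros t [T1 T2]. apply Hfg. split; [rewrite <- P2; exact T1 | rewrite <- P3; exact T2]. }
    apply Rabs_def2 in P4. apply Rabs_def2 in P5. apply Rabs_le_between in N.
    apply Rabs_def1; lra.
  - intros p q Hp Hq.
    change (Rabs (scal (sign (b - a)) (Riemann_sum f q) - scal (sign (b - a)) (Riemann_sum f p)) < eps).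
    apply Rabs_def2 in Hp. apply Rabs_def2 in Hq. apply Rabs_def1; lra.
Qed.

Lemma small_cut K eps : 0 <= K -> 0 < eps -> exists d, 0 < d < 1 / 2 /\ d * K < eps.
Proof.
  intros HK He. assert (Hq : 0 < eps / (K + 1)) by (apply Rdiv_lt_0_compat; lra).
  exists (Rmin (1 / 4) (eps / (K + 1))).
  assert (A := Rmin_l (1 / 4) (eps / (K + 1))). assert (B := Rmin_r (1 / 4) (eps / (K + 1))).
  assert (P : 0 < Rmin (1 / 4) (eps / (K + 1))) by (apply Rmin_pos; lra).
  split; [lra|].
  apply Rle_lt_trans with (eps / (K + 1) * K); [apply Rmult_le_compat_r; assumption|].
  apply Rlt_le_trans with (eps / (K + 1) * (K + 1)).
  - apply Rmult_lt_compat_l; lra.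
  - right. field. lra.
Qed.

Lemma ex_RInt_bounded_open (f : R -> R) K :
  (forall x, 0 < x < 1 -> continuous f x) -> (forall x, 0 < x < 1 -> Rabs (f x) <= K) ->
  ex_RInt f 0 1.
Proof.
  intros Cf Bf.
  assert (HK : 0 <= K) by (eapply Rle_trans; [apply Rabs_pos | apply (Bf (1 / 2)); lra]).
  pose (f' := fun x => if in_middle 0 x then f x else 0).
  assert (E : forall x, 0 < x < 1 -> f' x = f x).
  { intros x Hx. unfold f'. rewrite (proj2 (in_middle_true 0 x)); [reflexivity | lra]. }
  apply (ex_RInt_ext (V := R_NormedModule) f').
  { intros x. rewrite Rmin_left, Rmax_right by lra. apply E. }
  assert (B' : forall x, Rabs (f' x) <= K).
  { intros x. unfold f'. destruct (in_middle 0 x) eqn:Em; [|rewrite Rabs_R0; exact HK].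
    apply in_middle_true in Em. apply Bf. lra. }
  apply ex_RInt_approx; [lra|]. intros eps He.
  destruct (small_cut (4 * K) eps) as [d [Hd Hs]]; [lra | exact He |].
  (* freeze [f] near the end points *)
  pose (cd := fun x => d + (1 - 2 * d) * clamp ((x - d) / (1 - 2 * d))).
  assert (Hcd : forall x, d <= cd x <= 1 - d).
  { intros x. unfold cd. assert (T := clamp_in ((x - d) / (1 - 2 * d))). nra. }
  assert (Ecd : forall x, d <= x <= 1 - d -> cd x = x).
  { intros x Hx. unfold cd. rewrite clamp_id; [field; lra|]. split.
    - apply Rdiv_le_0_compat; lra.
    - apply (Rmult_le_reg_r (1 - 2 * d)); [lra|]. unfold Rdiv. rewrite Rmult_assoc, Rinv_l; lra. }
  exists (fun x => f (cd x)), (fun x => if in_middle d x then 0 else 2 * K),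
    (2 * d * (2 * K) + (1 - 2 * d) * 0).
  split; [|split; [apply is_RInt_middle; exact Hd | split; [lra|]]].
  - apply ex_RInt_cont. intros x. apply (continuous_R f).
    + apply Cf. specialize (Hcd x). lra.
    + unfold cd. apply continuous_add; [apply (continuous_cst d)|].
      apply continuous_mul; [apply (continuous_cst (1 - 2 * d))|].
      apply (continuous_R clamp); [apply clamp_cont|].
      apply continuous_mul; [|apply (continuous_cst (/ (1 - 2 * d)))].
      apply continuous_sub; [apply continuous_id | apply (continuous_cst d)].
  - intros x Hx. specialize (Hcd x). destruct (in_middle d x) eqn:Em.
    + apply in_middle_true in Em. rewrite Ecd, E, Rminus_diag, Rabs_R0 by lra. lra.
    + rewrite <- (E (cd x)) by lra. eapply Rle_trans; [apply Rabs_triang|].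
      rewrite Rabs_Ropp. generalize (B' x) (B' (cd x)). lra.
Qed.

Lemma RInt_middle_bound (f : R -> R) d c m : 0 < d < 1 / 2 -> ex_RInt f 0 1 ->
  (forall x, 0 < x < 1 -> Rabs (f x) <= if in_middle d x then m else c) ->
  Rabs (RInt f 0 1) <= 2 * d * c + (1 - 2 * d) * m.
Proof.
  intros Hd Hf Hb. assert (Hi := is_RInt_middle d c m Hd).
  assert (Hn := is_RInt_scal (V := R_NormedModule) _ 0 1 (-1) _ Hi).
  set (h := fun x => if in_middle d x then m else c) in *.
  assert (Up : RInt f 0 1 <= RInt h 0 1).
  { apply RInt_le; [lra | exact Hf | eexists; exact Hi |].
    intros x Hx. specialize (Hb x Hx). apply Rabs_le_between in Hb. apply Hb. }
  assert (Lo : RInt (fun x => scal (-1) (h x)) 0 1 <= RInt f 0 1).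
  { apply RInt_le; [lra | eexists; exact Hn | exact Hf |].
    intros x Hx. specialize (Hb x Hx). apply Rabs_le_between in Hb. fold (h x) in Hb.
    change (-1 * h x <= f x). lra. }
  rewrite (is_RInt_unique h _ _ _ Hi) in Up. rewrite (is_RInt_unique (fun x => scal (-1) (h x)) _ _ _ Hn) in Lo.
  unfold scal in Lo; simpl in Lo; unfold mult in Lo; simpl in Lo.
  apply Rabs_le. lra.
Qed.

(** Bounded convergence: on a compact part of (0,1) the convergence is uniform,
    and what remains is small because [k] is bounded. *)
Lemma continuous_RInt_open {A : UniformSpace} (k : A -> R -> R) z0 K :
  locally z0 (fun z => ex_RInt (k z) 0 1 /\ forall x, 0 < x < 1 -> Rabs (k z x) <= K) ->
  (forall x, 0 < x < 1 -> continuous (fun w : A * R => k (fst w) (snd w)) (z0, x)) ->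
  continuous (fun z => RInt (k z) 0 1) z0.
Proof.
  intros Hl Hc. apply continuous_eps. intros eps He.
  destruct (locally_singleton _ _ Hl) as [I0 B0].
  assert (HK : 0 <= K) by (eapply Rle_trans; [apply Rabs_pos | apply (B0 (1 / 2)); lra]).
  destruct (small_cut (4 * K) (eps / 2)) as [d [Hd Hs]]; [lra | lra |].
  assert (He2 : 0 < eps / 2) by lra.
  assert (Hu : forall x, d <= x <= 1 - d ->
     continuous (fun w : A * R => k (fst w) (snd w)) (z0, x)) by (intros x Hx; apply Hc; lra).
  generalize (filter_and _ _ Hl (compact_uniform k z0 d (1 - d) Hu _ He2)).
  apply filter_imp. intros z [[Iz Bz] Uz].
  rewrite <- RInt_sub by assumption.
  apply Rle_lt_trans with (2 * d * (2 * K) + (1 - 2 * d) * (eps / 2)); [|nra].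
  apply RInt_middle_bound; [exact Hd | apply ex_RInt_sub; assumption |].
  intros x Hx. destruct (in_middle d x) eqn:Em.
  - apply in_middle_true in Em. left. apply Uz. lra.
  - eapply Rle_trans; [apply Rabs_triang|]. rewrite Rabs_Ropp.
    generalize (Bz x Hx) (B0 x Hx). lra.
Qed.

Lemma ex_RInt_sub_interval (h : R -> R) lo hi a b :
  ex_RInt h lo hi -> lo <= a -> a <= b -> b <= hi -> ex_RInt h a b.
Proof.
  intros Ih Ha Hab Hb. apply (ex_RInt_Chasles_2 (V := R_CompleteNormedModule) h lo a b); [lra|].
  apply (ex_RInt_Chasles_1 (V := R_CompleteNormedModule) h lo b hi); [lra | exact Ih].
Qed.

(** The fundamental theorem of calculus on [[d,1-d]], with [d] tending to 0:
    [u_xx] is known to be bounded, but need not have limits at the boundary. *)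
Lemma RInt_derive_open (H h : R -> R) K :
  (forall x, continuous H x) -> (forall x, 0 < x < 1 -> is_derive H x (h x)) ->
  (forall x, 0 < x < 1 -> continuous h x) -> (forall x, 0 < x < 1 -> Rabs (h x) <= K) ->
  RInt h 0 1 = H 1 - H 0.
Proof.
  intros CH DH Ch Bh.
  assert (HK : 0 <= K) by (eapply Rle_trans; [apply Rabs_pos | apply (Bh (1 / 2)); lra]).
  assert (Ih := ex_RInt_bounded_open h K Ch Bh).
  apply Rminus_diag_uniq. apply Rabs_eq_0. apply Rle_antisym; [|apply Rabs_pos].
  apply le_epsilon. intros eps He. rewrite Rplus_0_l.
  assert (He4 : 0 < eps / 4) by lra.
  destruct (proj1 (continuous_eps _ _) (CH 0) _ He4) as [d0 H0].
  destruct (proj1 (continuous_eps _ _) (CH 1) _ He4) as [d1 H1].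
  destruct (small_cut (2 * K) (eps / 4)) as [d2 [Hd2 Hs]]; [lra | lra |].
  pose (d := Rmin d2 (Rmin (d0 / 2) (d1 / 2))).
  assert (Pd : 0 < d).
  { assert (P0 := cond_pos d0). assert (P1 := cond_pos d1). repeat apply Rmin_pos; lra. }
  assert (A1 : d <= d2) by apply Rmin_l.
  assert (A2 : d <= d0 / 2) by (eapply Rle_trans; [apply Rmin_r | apply Rmin_l]).
  assert (A3 : d <= d1 / 2) by (eapply Rle_trans; [apply Rmin_r | apply Rmin_r]).
  assert (Pos0 := cond_pos d0). assert (Pos1 := cond_pos d1).
  specialize (H0 d). specialize (H1 (1 - d)).
  assert (B0 : Rabs (H d - H 0) < eps / 4).
  { apply H0. change (Rabs (d - 0) < d0). rewrite Rminus_0_r, Rabs_pos_eq; lra. }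
  assert (B1 : Rabs (H (1 - d) - H 1) < eps / 4).
  { apply H1. change (Rabs (1 - d - 1) < d1). replace (1 - d - 1) with (- d) by ring.
    rewrite Rabs_Ropp, Rabs_pos_eq; lra. }
  assert (Esub := fun a b => ex_RInt_sub_interval h 0 1 a b Ih).
  assert (Bsub : forall a b, 0 <= a -> a <= b -> b <= 1 -> Rabs (RInt h a b) <= (b - a) * K).
  { intros a b Ha Hab Hb.
    assert (T : Rabs (RInt (fun x => if in_middle 0 x then h x else 0) a b) <= (b - a) * K).
    { apply abs_RInt_le_const; [exact Hab | |].
      - apply (ex_RInt_ext (V := R_NormedModule) h); [|apply Esub; assumption].
        intros x. rewrite Rmin_left, Rmax_right by exact Hab. intros Hx.
        rewrite (proj2 (in_middle_true 0 x)); [reflexivity | lra].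
      - intros t Ht. destruct (in_middle 0 t) eqn:Em; [|rewrite Rabs_R0; exact HK].
        apply in_middle_true in Em. apply Bh. lra. }
    rewrite (RInt_ext (fun x => if in_middle 0 x then h x else 0) h) in T; [exact T|].
    intros x. rewrite Rmin_left, Rmax_right by exact Hab. intros Hx.
    rewrite (proj2 (in_middle_true 0 x)); [reflexivity | lra]. }
  assert (C1 := RInt_Chasles (V := R_CompleteNormedModule) h 0 d 1 (Esub 0 d ltac:(lra) ltac:(lra) ltac:(lra))
     (Esub d 1 ltac:(lra) ltac:(lra) ltac:(lra))).
  assert (C2 := RInt_Chasles (V := R_CompleteNormedModule) h d (1 - d) 1
     (Esub d (1 - d) ltac:(lra) ltac:(lra) ltac:(lra)) (Esub (1 - d) 1 ltac:(lra) ltac:(lra) ltac:(lra))).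
  assert (M : RInt h d (1 - d) = H (1 - d) - H d).
  { apply is_RInt_unique. apply (is_RInt_derive (V := R_CompleteNormedModule) H h);
      intros x; rewrite Rmin_left, Rmax_right by lra; intros Hx; [apply DH | apply Ch]; lra. }
  assert (S1 := Bsub 0 d ltac:(lra) ltac:(lra) ltac:(lra)).
  assert (S2 := Bsub (1 - d) 1 ltac:(lra) ltac:(lra) ltac:(lra)).
  unfold plus in C1, C2; simpl in C1, C2.
  assert (S3 : d * K <= d2 * K) by (apply Rmult_le_compat_r; lra).
  apply Rabs_def2 in B0. apply Rabs_def2 in B1.
  apply Rabs_le_between in S1. apply Rabs_le_between in S2.
  change (@eq R (RInt h 0 d + RInt h d 1) (RInt h 0 1)) in C1.
  change (@eq R (RInt h d (1 - d) + RInt h (1 - d) 1) (RInt h d 1)) in C2.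
  rewrite <- C1, <- C2, M. destruct B0, B1, S1, S2. apply Rabs_le. lra.
Qed.

(** * The energy along two profiles *)

(** A solution at a fixed time: [a], [ap], [aq] stand for [u], [u_x], [u_xx].
    The first two are extended continuously beyond the boundary, where the
    third is not controlled. *)
Record profile (M K : R) (a ap aq : R -> R) : Prop := {
  pf_c : forall x, continuous a x;
  pf_cp : forall x, continuous ap x;
  pf_d : forall x, 0 < x < 1 -> is_derive a x (ap x);
  pf_dp : forall x, 0 < x < 1 -> is_derive ap x (aq x);
  pf_cq : forall x, 0 < x < 1 -> continuous aq x;
  pf_b : forall x, 0 < x < 1 -> Rabs (a x) <= M /\ Rabs (ap x) <= M /\ Rabs (aq x) <= K
}.
Arguments pf_c {_ _ _ _ _} _.
Arguments pf_cp {_ _ _ _ _} _.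
Arguments pf_cq {_ _ _ _ _} _.
Arguments pf_b {_ _ _ _ _} _.

Definition interp (th : R) (a b : R -> R) (x : R) : R := a x + th * (b x - a x).

Lemma interp_bound th a b x M : 0 <= th <= 1 -> Rabs (a x) <= M -> Rabs (b x) <= M ->
  Rabs (interp th a b x) <= M.
Proof.
  intros Ht Ha Hb. unfold interp.
  replace (a x + th * (b x - a x)) with ((1 - th) * a x + th * b x) by ring.
  eapply Rle_trans; [apply Rabs_triang|].
  rewrite !Rabs_mult, (Rabs_pos_eq th), (Rabs_pos_eq (1 - th)) by lra. nra.
Qed.

Lemma interp_derive th (a b : R -> R) x a' b' : is_derive a x a' -> is_derive b x b' ->
  is_derive (interp th a b) x (a' + th * (b' - a')).
Proof.
  intros Ha Hb. unfold interp. auto_derive.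
  - repeat split; eexists; eassumption.
  - replace (Derive (fun x => a x) x) with a' by (symmetry; apply is_derive_unique, Ha).
    replace (Derive (fun x => b x) x) with b' by (symmetry; apply is_derive_unique, Hb). ring.
Qed.

Lemma interp_cont th (a b : R -> R) x : continuous a x -> continuous b x ->
  continuous (interp th a b) x.
Proof.
  intros Ha Hb. unfold interp. apply continuous_add; [exact Ha|].
  apply continuous_mul; [apply (continuous_cst th)|]. apply continuous_sub; assumption.
Qed.

Lemma interp_profile M K th a ap aq b bp bq : 0 <= th <= 1 ->
  profile M K a ap aq -> profile M K b bp bq ->
  profile M K (interp th a b) (interp th ap bp) (interp th aq bq).
Proof.
  intros Ht [A1 A2 A3 A4 A5 A6] [B1 B2 B3 B4 B5 B6]. split.
  - intros x. apply interp_cont; auto.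
  - intros x. apply interp_cont; auto.
  - intros x Hx. apply interp_derive; auto.
  - intros x Hx. apply interp_derive; auto.
  - intros x Hx. apply interp_cont; auto.
  - intros x Hx. specialize (A6 x Hx). specialize (B6 x Hx).
    repeat split; apply interp_bound; tauto.
Qed.

(** Minus the Euler-Lagrange expression: [d/dx L_p - L_u]. *)
Definition el_density (Lu Lpx Lpu Lpp : R -> R -> R -> R) (a ap aq : R -> R) (x : R) : R :=
  Lpx x (a x) (ap x) + Lpu x (a x) (ap x) * ap x + Lpp x (a x) (ap x) * aq x - Lu x (a x) (ap x).

Lemma el_density_bound Lu Lpx Lpu Lpp M K :
  cont3 Lu -> cont3 Lpx -> cont3 Lpu -> cont3 Lpp -> 0 <= M ->
  exists C, forall a ap aq, profile M K a ap aq ->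
    forall x, 0 < x < 1 -> Rabs (el_density Lu Lpx Lpu Lpp a ap aq x) <= C.
Proof.
  intros C1 C2 C3 C4 HM.
  destruct (cont3_bounded Lu M C1) as [k1 [P1 B1]]. destruct (cont3_bounded Lpx M C2) as [k2 [P2 B2]].
  destruct (cont3_bounded Lpu M C3) as [k3 [P3 B3]]. destruct (cont3_bounded Lpp M C4) as [k4 [P4 B4]].
  exists (k2 + k3 * M + k4 * K + k1). intros a ap aq HP x Hx.
  destruct (pf_b HP x Hx) as [Ba [Bp Bq]].
  assert (Hx' : 0 <= x <= 1) by lra.
  specialize (B1 x _ _ Hx' Ba Bp). specialize (B2 x _ _ Hx' Ba Bp).
  specialize (B3 x _ _ Hx' Ba Bp). specialize (B4 x _ _ Hx' Ba Bp).
  unfold el_density. unfold Rminus.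
  eapply Rle_trans; [apply Rabs_triang|]. rewrite Rabs_Ropp.
  eapply Rle_trans; [apply Rplus_le_compat_r, Rabs_triang|].
  eapply Rle_trans; [apply Rplus_le_compat_r, Rplus_le_compat_r, Rabs_triang|].
  rewrite !Rabs_mult.
  repeat apply Rplus_le_compat; try assumption;
    apply Rmult_le_compat; try assumption; apply Rabs_pos.
Qed.

Lemma el_density_cont Lu Lpx Lpu Lpp M K a ap aq x :
  cont3 Lu -> cont3 Lpx -> cont3 Lpu -> cont3 Lpp -> profile M K a ap aq -> 0 < x < 1 ->
  continuous (el_density Lu Lpx Lpu Lpp a ap aq) x.
Proof.
  intros C1 C2 C3 C4 [A1 A2 A3 A4 A5 A6] Hx. unfold el_density. cont; auto.
Qed.

(** The energy is differentiated along the segment between two profiles; by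
    the mean value theorem its increment is the first variation at some point
    of the segment, which is then integrated by parts in [x].  For the profiles
    of a solution at two times this replaces the time derivative of [u_x],
    which a classical solution need not have. *)
Lemma energy_increment f bc0 bc1 M K L Lu Lp Lpx Lpu Lpp a ap aq b bp bq :
  lagrangian f bc0 bc1 M L Lu Lp Lpx Lpu Lpp -> 0 <= M ->
  profile M K a ap aq -> profile M K b bp bq ->
  exists th, 0 <= th <= 1 /\
    RInt (fun x => L x (b x) (bp x)) 0 1 - RInt (fun x => L x (a x) (ap x)) 0 1 =
    Lp 1 (interp th a b 1) (interp th ap bp 1) * (b 1 - a 1)
    - Lp 0 (interp th a b 0) (interp th ap bp 0) * (b 0 - a 0)
    - RInt (fun x => el_density Lu Lpx Lpu Lpp (interp th a b) (interp th ap bp) (interp th aq bq) x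
              * (b x - a x)) 0 1.
Proof.
  intros HL HM Pa Pb.
  assert (HUP := lg_up HL). assert (HLp := lg_C1p HL).
  destruct HUP as [CL CLu CLp DLu DLp]. destruct HLp as [_ CLpx CLpu CLpp DLpx DLpu DLpp].
  assert (Ca := pf_c Pa). assert (Cap := pf_cp Pa).
  assert (Cb := pf_c Pb). assert (Cbp := pf_cp Pb).
  pose (var := fun th x => Lu x (interp th a b x) (interp th ap bp x) * (b x - a x)
     + Lp x (interp th a b x) (interp th ap bp x) * (bp x - ap x)).
  assert (Ci : forall (c d : R -> R) (w : R * R), (forall x, continuous c x) -> (forall x, continuous d x) ->
     continuous (fun w : R * R => interp (fst w) c d (snd w)) w).
  { intros c d w Hc Hd. unfold interp.
    assert (H1 : continuous (fun w : R * R => c (snd w)) w) by (apply (continuous_comp snd c); [cont | apply Hc]).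
    assert (H2 : continuous (fun w : R * R => d (snd w)) w) by (apply (continuous_comp snd d); [cont | apply Hd]).
    cont. }
  assert (C1 : forall c d x th, (forall x, continuous c x) -> (forall x, continuous d x) ->
     continuous (interp th c d) x) by (intros; apply interp_cont; auto).
  pose (e := fun th => RInt (fun x => L x (interp th a b x) (interp th ap bp x)) 0 1).
  assert (De : forall th, is_derive e th (RInt (var th) 0 1)).
  { intros th. apply (is_derive_RInt_under (fun th x => L x (interp th a b x) (interp th ap bp x)) var).
    - apply filter_forall. intros s x. unfold var.
      apply (chain2 (L x) (Lu x) (Lp x) (fun s => interp s a b x) (fun s => interp s ap bp x));
        auto; try (intros w; cont); unfold interp; auto_derive; trivial; ring.
    - intros x. unfold var.
      assert (H1 := fun w => Ci a b w Ca Cb). assert (H2 := fun w => Ci ap bp w Cap Cbp).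
      assert (H3 : forall (c : R -> R) (w : R * R), (forall x, continuous c x) -> continuous (fun w : R * R => c (snd w)) w).
      { intros c w Hc. apply (continuous_comp snd c); [cont | apply Hc]. }
      cont; apply H3; auto.
    - intros s x. cont; apply interp_cont; auto. }
  destruct (MVT_open e (fun th => RInt (var th) 0 1) 0 1) as [th [Hth Eth]].
  { intros; apply De. }
  { intros x. exact (continuous_of_derive _ _ _ (De x)). }
  rewrite Rmin_left, Rmax_right in Hth by lra.
  exists th. split; [exact Hth|].
  assert (E1 : e 1 = RInt (fun x => L x (b x) (bp x)) 0 1).
  { apply RInt_ext. intros x _. unfold interp. f_equal; ring. }
  assert (E0 : e 0 = RInt (fun x => L x (a x) (ap x)) 0 1).
  { apply RInt_ext. intros x _. unfold interp. f_equal; ring. }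
  rewrite <- E1, <- E0, Eth, Rminus_0_r, Rmult_1_r.
  assert (Pi := interp_profile M K th a ap aq b bp bq Hth Pa Pb).
  set (c := interp th a b) in *. set (cp := interp th ap bp) in *. set (cq := interp th aq bq) in *.
  set (N := el_density Lu Lpx Lpu Lpp c cp cq).
  (* [H' = h], and [h - var th] is the density [N] times [b - a] *)
  pose (H := fun x => Lp x (c x) (cp x) * (b x - a x)).
  pose (h := fun x => (Lpx x (c x) (cp x) + Lpu x (c x) (cp x) * cp x + Lpp x (c x) (cp x) * cq x)
       * (b x - a x) + Lp x (c x) (cp x) * (bp x - ap x)).
  assert (Cc := pf_c Pi). assert (Ccp := pf_cp Pi).
  destruct (cont3_bounded Lp M CLp) as [k5 [P5 B5]].
  destruct (el_density_bound (fun _ _ _ => 0) Lpx Lpu Lpp M K) as [C HC]; auto.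
  { intros w. cont. }
  destruct (el_density_bound Lu Lpx Lpu Lpp M K) as [C' HC']; auto.
  assert (Bd : forall x, 0 < x < 1 -> Rabs (b x - a x) <= 2 * M /\ Rabs (bp x - ap x) <= 2 * M).
  { intros x Hx. destruct (pf_b Pa x Hx) as [A1 [A2 _]].
    destruct (pf_b Pb x Hx) as [B1 [B2 _]].
    split; (eapply Rle_trans; [apply Rabs_triang|]; rewrite Rabs_Ropp; lra). }
  assert (Ch : forall x, 0 < x < 1 -> continuous h x).
  { intros x Hx. assert (Cq := pf_cq Pi x Hx). unfold h. cont. }
  assert (Bh : forall x, 0 < x < 1 -> Rabs (h x) <= C * (2 * M) + k5 * (2 * M)).
  { intros x Hx. destruct (Bd x Hx) as [D1 D2]. unfold h.
    specialize (HC c cp cq Pi x Hx). unfold el_density in HC. rewrite Rminus_0_r in HC.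
    destruct (pf_b Pi x Hx) as [A1 [A2 _]].
    specialize (B5 x (c x) (cp x) ltac:(lra) A1 A2).
    eapply Rle_trans; [apply Rabs_triang|]. rewrite !Rabs_mult.
    apply Rplus_le_compat; apply Rmult_le_compat; try assumption; apply Rabs_pos. }
  assert (FTC : RInt h 0 1 = H 1 - H 0).
  { apply (RInt_derive_open H h (C * (2 * M) + k5 * (2 * M))); auto.
    - intros x. unfold H. cont.
    - intros x Hx. unfold H, h.
      apply (is_derive_mult (fun x => Lp x (c x) (cp x)) (fun x => b x - a x));
        [ | | intros; apply Rmult_comm].
      + eapply is_derive_eq.
        * apply (chain3 Lp Lpx Lpu Lpp (fun x => x) c cp x 1 (cp x) (cq x)); auto.
          -- apply (is_derive_id (K := R_AbsRing)).
          -- apply Pi, Hx.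
          -- apply Pi, Hx.
        * cbv beta. Rring.
      + apply (is_derive_minus (V := R_NormedModule)); [apply Pb, Hx | apply Pa, Hx]. }
  assert (IN : ex_RInt (fun x => N x * (b x - a x)) 0 1).
  { apply (ex_RInt_bounded_open _ (C' * (2 * M))).
    - intros x Hx.
      assert (CN : continuous N x) by (apply (el_density_cont Lu Lpx Lpu Lpp M K); auto).
      cont.
    - intros x Hx. rewrite Rabs_mult.
      apply Rmult_le_compat; try apply Rabs_pos; [apply HC'; auto | apply Bd, Hx]. }
  assert (Ih : ex_RInt h 0 1) by (apply (ex_RInt_bounded_open h _ Ch Bh)).
  change (Lp 1 (c 1) (cp 1) * (b 1 - a 1)) with (H 1).
  change (Lp 0 (c 0) (cp 0) * (b 0 - a 0)) with (H 0).
  rewrite <- FTC, <- RInt_sub by assumption.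
  apply RInt_ext. intros x _. unfold var, h, N, el_density. fold c cp. Rring.
Qed.

(** * Classical solutions *)

Lemma MVT_segment (f df : R -> R) a b :
  (forall x, Rmin a b <= x <= Rmax a b -> is_derive f x (df x)) ->
  exists c, Rmin a b <= c <= Rmax a b /\ f b - f a = df c * (b - a).
Proof.
  intros Hd. apply MVT_gen.
  - intros x Hx. apply Hd. lra.
  - intros x Hx. apply continuity_pt_filterlim. exact (continuous_of_derive _ _ _ (Hd x Hx)).
Qed.

Lemma segment_in a b c lo hi : lo < a < hi -> lo < b < hi -> Rmin a b <= c <= Rmax a b -> lo < c < hi.
Proof. unfold Rmin, Rmax. destruct (Rle_dec a b); lra. Qed.

Definition ext (v0 v1 : R) (k : R -> R) (x : R) : R :=
  if Rle_dec x 0 then v0 else if Rle_dec 1 x then v1 else k x.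

Lemma ext_in v0 v1 k x : 0 < x < 1 -> ext v0 v1 k x = k x.
Proof. intros H. unfold ext. destruct (Rle_dec x 0), (Rle_dec 1 x); lra. Qed.

Lemma ext_0 v0 v1 k : ext v0 v1 k 0 = v0.
Proof. unfold ext. destruct (Rle_dec 0 0); lra. Qed.

Lemma ext_1 v0 v1 k : ext v0 v1 k 1 = v1.
Proof. unfold ext. destruct (Rle_dec 1 0), (Rle_dec 1 1); lra. Qed.

Lemma ext_cont v0 v1 (k : R -> R) :
  (forall x, 0 < x < 1 -> continuous k x) ->
  filterlim k (within (fun x => 0 < x < 1) (locally 0)) (locally v0) ->
  filterlim k (within (fun x => 0 < x < 1) (locally 1)) (locally v1) ->
  forall x, continuous (ext v0 v1 k) x.
Proof.
  intros Ck L0 L1 x.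
  assert (Hb : forall i v, filterlim k (within (fun x => 0 < x < 1) (locally i)) (locally v) ->
     forall eps, 0 < eps -> locally i (fun y => 0 < y < 1 -> Rabs (k y - v) < eps)).
  { intros i v Hl eps He. apply (Hl (fun y => Rabs (y - v) < eps)).
    exists (mkposreal eps He). intros y Hy; exact Hy. }
  destruct (Rtotal_order x 0) as [H|[->|H]]; [| |destruct (Rtotal_order x 1) as [H1|[->|H1]]].
  - apply (continuous_ext_loc _ (fun _ => v0)); [|apply (continuous_cst v0)].
    generalize (locally_between (x - 1) 0 x ltac:(lra)). apply filter_imp. intros y Hy.
    unfold ext. destruct (Rle_dec y 0); lra.
  - apply continuous_eps. intros eps He. rewrite ext_0.
    assert (A := locally_between (-1) 1 0 ltac:(lra)). assert (A' := Hb 0 v0 L0 eps He).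
    generalize (filter_and _ _ A A').
    apply filter_imp. intros y [Y1 Y2]. unfold ext.
    destruct (Rle_dec y 0); [rewrite Rminus_diag, Rabs_R0; exact He|].
    destruct (Rle_dec 1 y); [lra | apply Y2; lra].
  - apply (continuous_ext_loc _ k); [|apply Ck; lra].
    generalize (locally_between 0 1 x ltac:(lra)). apply filter_imp. intros y Hy.
    symmetry. apply ext_in, Hy.
  - apply continuous_eps. intros eps He. rewrite ext_1.
    assert (A := locally_between 0 2 1 ltac:(lra)). assert (A' := Hb 1 v1 L1 eps He).
    generalize (filter_and _ _ A A').
    apply filter_imp. intros y [Y1 Y2]. unfold ext.
    destruct (Rle_dec y 0); [lra|].
    destruct (Rle_dec 1 y); [rewrite Rminus_diag, Rabs_R0; exact He | apply Y2; lra].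
  - apply (continuous_ext_loc _ (fun _ => v1)); [|apply (continuous_cst v1)].
    generalize (locally_between 1 (x + 1) x ltac:(lra)). apply filter_imp. intros y Hy.
    unfold ext. destruct (Rle_dec y 0), (Rle_dec 1 y); lra.
Qed.

(** The boundary value [v] of [u] is only Lipschitz in time, which suffices
    because the flux it is multiplied by tends to zero. *)
Definition boundary_regular (bc : boundary_condition) (T K : R) (v w : R -> R) : Prop :=
  forall t, 0 < t < T -> continuous v t /\ continuous w t /\ bc_holds bc (v t) (w t) /\
    forall s, 0 < s < T -> Rabs (v s - v t) <= K * Rabs (s - t).

(** A classical solution in the form in which it is used: [v0], [v1] are the
    boundary values of [u], and [w0], [w1] those of [u_x]. *)
Record regular_solution (f : R -> R -> R -> R -> R -> R) (bc0 bc1 : boundary_condition)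
    (T M K : R) (u : R -> R -> R) (v0 w0 v1 w1 : R -> R) : Prop := {
  rs_pf : forall t, 0 < t < T ->
    profile M K (ext (v0 t) (v1 t) (u t)) (ext (w0 t) (w1 t) (u_x u t)) (u_xx u t);
  rs_cu : forall t x, 0 < t < T -> 0 < x < 1 ->
    continuous (fun z : R * R => u (fst z) (snd z)) (t, x);
  rs_cp : forall t x, 0 < t < T -> 0 < x < 1 ->
    continuous (fun z : R * R => u_x u (fst z) (snd z)) (t, x);
  rs_cq : forall t x, 0 < t < T -> 0 < x < 1 ->
    continuous (fun z : R * R => u_xx u (fst z) (snd z)) (t, x);
  rs_ct : forall t x, 0 < t < T -> 0 < x < 1 ->
    continuous (fun z : R * R => u_t u (fst z) (snd z)) (t, x);
  rs_dt : forall t x, 0 < t < T -> 0 < x < 1 -> is_derive (fun s => u s x) t (u_t u t x);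
  rs_bt : forall t x, 0 < t < T -> 0 < x < 1 -> Rabs (u_t u t x) <= K;
  rs_eq : forall t x, 0 < t < T -> 0 < x < 1 ->
    f x (u t x) (u_x u t x) (u_xx u t x) (u_t u t x) = 0;
  rs_bc0 : boundary_regular bc0 T K v0 w0;
  rs_bc1 : boundary_regular bc1 T K v1 w1
}.
Arguments rs_pf {_ _ _ _ _ _ _ _ _ _ _} _.
Arguments rs_cu {_ _ _ _ _ _ _ _ _ _ _} _.
Arguments rs_cp {_ _ _ _ _ _ _ _ _ _ _} _.
Arguments rs_cq {_ _ _ _ _ _ _ _ _ _ _} _.
Arguments rs_ct {_ _ _ _ _ _ _ _ _ _ _} _.
Arguments rs_dt {_ _ _ _ _ _ _ _ _ _ _} _.
Arguments rs_bt {_ _ _ _ _ _ _ _ _ _ _} _.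
Arguments rs_eq {_ _ _ _ _ _ _ _ _ _ _} _.
Arguments rs_bc0 {_ _ _ _ _ _ _ _ _ _ _} _.
Arguments rs_bc1 {_ _ _ _ _ _ _ _ _ _ _} _.

(** Difference quotients of [u] in [x] with a fixed step are jointly
    continuous, and they approximate [u_x] uniformly because [u_xx] is
    bounded. *)
Lemma u_x_jointly_continuous (T K : R) (u : R -> R -> R) :
  (forall t x, 0 < t < T -> 0 < x < 1 -> is_derive (fun y => u t y) x (u_x u t x)) ->
  (forall t x, 0 < t < T -> 0 < x < 1 -> is_derive (fun y => u_x u t y) x (u_xx u t x)) ->
  (forall t x, 0 < t < T -> 0 < x < 1 -> Rabs (u_xx u t x) <= K) ->
  (forall t x, 0 < t < T -> 0 < x < 1 -> continuous (fun z : R * R => u (fst z) (snd z)) (t, x)) ->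
  forall t x, 0 < t < T -> 0 < x < 1 -> continuous (fun z : R * R => u_x u (fst z) (snd z)) (t, x).
Proof.
  intros Dx Dxx BK Cu t x Ht Hx.
  assert (HK : 0 <= K) by (eapply Rle_trans; [apply Rabs_pos | apply (BK t x Ht Hx)]).
  apply continuous_eps. intros eps He.
  destruct (small_cut K (eps / 4)) as [d [Hd Hs]]; [exact HK | lra |].
  pose (e := Rmin d ((1 - x) / 2)).
  assert (Pe : 0 < e) by (apply Rmin_pos; lra).
  assert (E1 : e <= d) by apply Rmin_l. assert (E2 : e <= (1 - x) / 2) by apply Rmin_r.
  assert (EK : e * K < eps / 4).
  { apply Rle_lt_trans with (d * K); [apply Rmult_le_compat_r; assumption | exact Hs]. }
  assert (Hq : forall s y, 0 < s < T -> 0 < y < 1 - e ->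
     Rabs ((u s (y + e) - u s y) / e - u_x u s y) <= e * K).
  { intros s y Hs' Hy.
    destruct (MVT_segment (u s) (u_x u s) y (y + e)) as [c [Hc Ec]].
    { intros z Hz. rewrite Rmin_left, Rmax_right in Hz by lra. apply Dx; lra. }
    rewrite Rmin_left, Rmax_right in Hc by lra.
    rewrite Ec. replace (u_x u s c * (y + e - y) / e) with (u_x u s c) by (field; lra).
    destruct (MVT_segment (u_x u s) (u_xx u s) y c) as [c' [Hc' Ec']].
    { intros z Hz. rewrite Rmin_left, Rmax_right in Hz by lra. apply Dxx; lra. }
    rewrite Rmin_left, Rmax_right in Hc' by lra.
    rewrite Ec', Rabs_mult, Rmult_comm. rewrite (Rabs_pos_eq (c - y)) by lra.
    apply Rmult_le_compat; [lra | apply Rabs_pos | lra | apply BK; lra]. }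
  assert (Cq : continuous (fun z : R * R => (u (fst z) (snd z + e) - u (fst z) (snd z)) * / e) (t, x)).
  { apply continuous_mul; [|apply (continuous_cst (/ e))]. apply continuous_sub; [|apply Cu; assumption].
    apply (continuous_comp (fun z : R * R => (fst z, snd z + e)) (fun z : R * R => u (fst z) (snd z))).
    - cont.
    - apply Cu; simpl; lra. }
  assert (He4 : 0 < eps / 4) by lra.
  assert (Hl : locally (t, x) (fun z : R * R => 0 < fst z < T /\ 0 < snd z < 1 - e)).
  { apply filter_and.
    - exact (continuous_fst t x _ (locally_between 0 T t Ht)).
    - exact (continuous_snd t x _ (locally_between 0 (1 - e) x ltac:(lra))). }
  generalize (filter_and _ _ Hl (proj1 (continuous_eps _ _) Cq _ He4)).
  apply filter_imp. intros [s y] [[Hs' Hy] Hc]. simpl in *.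
  assert (Q1 := Hq s y Hs' Hy). assert (Q2 := Hq t x Ht ltac:(lra)).
  unfold Rdiv in Q1, Q2.
  apply Rabs_le_between in Q1. apply Rabs_le_between in Q2. apply Rabs_def2 in Hc.
  apply Rabs_def1; lra.
Qed.

Lemma within_unit_point (i : R) (P : R -> Prop) : i = 0 \/ i = 1 ->
  locally i (fun y => 0 < y < 1 -> P y) -> exists y, 0 < y < 1 /\ P y.
Proof.
  intros Hi [d Hd]. assert (Pd := cond_pos d).
  pose (e := Rmin (d / 2) (1 / 2)).
  assert (E0 : 0 < e) by (apply Rmin_pos; lra).
  assert (E1 : e <= d / 2) by apply Rmin_l. assert (E2 : e <= 1 / 2) by apply Rmin_r.
  destruct Hi as [-> | ->].
  - exists e. split; [lra|]. apply Hd; [|lra]. change (Rabs (e - 0) < d).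
    rewrite Rminus_0_r, Rabs_pos_eq; lra.
  - exists (1 - e). split; [lra|]. apply Hd; [|lra]. change (Rabs (1 - e - 1) < d).
    replace (1 - e - 1) with (- e) by ring. rewrite Rabs_Ropp, Rabs_pos_eq; lra.
Qed.

(** Interior values [u(.,x)] are Lipschitz in time with the bound of [u_t] as
    constant, and so is their limit at the boundary. *)
Lemma boundary_limits_regular bc T i K (u : R -> R -> R) :
  i = 0 \/ i = 1 ->
  (forall t x, 0 < t < T -> 0 < x < 1 -> is_derive (fun s => u s x) t (u_t u t x)) ->
  (forall t x, 0 < t < T -> 0 < x < 1 -> Rabs (u_t u t x) <= K) ->
  boundary_limits T i bc u ->
  exists v w, boundary_regular bc T K v w /\ forall t, 0 < t < T ->
      filterlim (fun x => u t x) (within (fun x => 0 < x < 1) (locally i)) (locally (v t)) /\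
      filterlim (fun x => u_x u t x) (within (fun x => 0 < x < 1) (locally i)) (locally (w t)).
Proof.
  intros Hi Dt BK [v [w H]]. exists v, w. split.
  2:{ intros t Ht. specialize (H t Ht). tauto. }
  intros t Ht. destruct (H t Ht) as [Cv [Cw [Lt [_ Hbc]]]].
  split; [exact Cv|]. split; [exact Cw|]. split; [exact Hbc|].
  intros s Hs. destruct (H s Hs) as [_ [_ [Ls _]]].
  apply le_epsilon. intros eps He.
  assert (He2 : 0 < eps / 2) by lra.
  assert (A1 := Lt _ (locally_ball (v t) (mkposreal _ He2))).
  assert (A2 := Ls _ (locally_ball (v s) (mkposreal _ He2))).
  destruct (within_unit_point i (fun y => Rabs (u t y - v t) < eps / 2 /\ Rabs (u s y - v s) < eps / 2) Hi)
    as [y [Hy [B1 B2]]].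
  { generalize (filter_and (F := locally i) _ _ A1 A2). apply filter_imp. intros y [C1 C2] Hy.
    split; [apply (C1 Hy) | apply (C2 Hy)]. }
  destruct (MVT_segment (fun s => u s y) (fun s => u_t u s y) t s) as [c [Hc Ec]].
  { intros z Hz. apply Dt; [exact (segment_in t s z 0 T Ht Hs Hz) | exact Hy]. }
  assert (Bc : Rabs (u s y - u t y) <= K * Rabs (s - t)).
  { rewrite Ec, Rabs_mult. apply Rmult_le_compat_r; [apply Rabs_pos|].
    apply BK; [exact (segment_in t s c 0 T Ht Hs Hc) | exact Hy]. }
  apply Rabs_le_between in Bc. apply Rabs_def2 in B1. apply Rabs_def2 in B2.
  apply Rabs_le. lra.
Qed.

Lemma classical_solution_regular f bc0 bc1 T u0 u (B : R * R -> Prop) M :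
  classical_solution f bc0 bc1 T u0 u ->
  (forall t x, 0 < t < T -> 0 < x < 1 -> B (u t x, u_x u t x)) ->
  (forall v p, B (v, p) -> Rabs v <= M /\ Rabs p <= M) ->
  exists K v0 w0 v1 w1, regular_solution f bc0 bc1 T M K u v0 w0 v1 w1.
Proof.
  intros CS HB HM.
  destruct (cs_u _ _ _ _ _ _ CS) as [_ Cu].
  destruct (cs_u_t _ _ _ _ _ _ CS) as [[K1 B1] Ct].
  destruct (cs_u_xx _ _ _ _ _ _ CS) as [[K2 B2] Cxx].
  assert (Cu' : forall t x, 0 < t < T -> 0 < x < 1 -> continuous (fun z : R * R => u (fst z) (snd z)) (t, x)).
  { intros t x Ht Hx. apply continuity_2d_pt_filterlim. apply Cu; assumption. }
  assert (Ct' : forall t x, 0 < t < T -> 0 < x < 1 -> continuous (fun z : R * R => u_t u (fst z) (snd z)) (t, x)).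
  { intros t x Ht Hx. apply continuity_2d_pt_filterlim. apply Ct; assumption. }
  assert (Cxx' : forall t x, 0 < t < T -> 0 < x < 1 -> continuous (fun z : R * R => u_xx u (fst z) (snd z)) (t, x)).
  { intros t x Ht Hx. apply continuity_2d_pt_filterlim. apply Cxx; assumption. }
  assert (Dt : forall t x, 0 < t < T -> 0 < x < 1 -> is_derive (fun s => u s x) t (u_t u t x)).
  { intros t x Ht Hx. apply Derive_correct. apply (cs_ex_t _ _ _ _ _ _ CS); assumption. }
  assert (Dx : forall t x, 0 < t < T -> 0 < x < 1 -> is_derive (fun y => u t y) x (u_x u t x)).
  { intros t x Ht Hx. apply Derive_correct. apply (cs_ex_x _ _ _ _ _ _ CS); assumption. }
  assert (Dxx : forall t x, 0 < t < T -> 0 < x < 1 -> is_derive (fun y => u_x u t y) x (u_xx u t x)).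
  { intros t x Ht Hx. apply Derive_correct. apply (cs_ex_xx _ _ _ _ _ _ CS); assumption. }
  set (K := Rmax K1 K2).
  assert (BK1 : forall t x, 0 < t < T -> 0 < x < 1 -> Rabs (u_t u t x) <= K).
  { intros t x Ht Hx. eapply Rle_trans; [apply B1; assumption | apply Rmax_l]. }
  assert (BK2 : forall t x, 0 < t < T -> 0 < x < 1 -> Rabs (u_xx u t x) <= K).
  { intros t x Ht Hx. eapply Rle_trans; [apply B2; assumption | apply Rmax_r]. }
  destruct (boundary_limits_regular bc0 T 0 K u (or_introl eq_refl) Dt BK1 (cs_bc0 _ _ _ _ _ _ CS))
    as [v0 [w0 [R0 L0]]].
  destruct (boundary_limits_regular bc1 T 1 K u (or_intror eq_refl) Dt BK1 (cs_bc1 _ _ _ _ _ _ CS))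
    as [v1 [w1 [R1 L1]]].
  exists K, v0, w0, v1, w1. split; auto.
  - intros t Ht. destruct (L0 t Ht) as [L00 L01]. destruct (L1 t Ht) as [L10 L11].
    assert (Xl : forall (k k' : R -> R) a b x l, 0 < x < 1 -> is_derive k x l ->
       is_derive (ext a b k) x l).
    { intros k k' a b x l Hx Hk. apply (is_derive_ext_loc k); [|exact Hk].
      generalize (locally_between 0 1 x Hx). apply filter_imp. intros y Hy. symmetry. apply ext_in, Hy. }
    split.
    + apply ext_cont; [|exact L00|exact L10].
      intros x Hx. exact (continuous_of_derive _ _ _ (Dx t x Ht Hx)).
    + apply ext_cont; [|exact L01|exact L11].
      intros x Hx. exact (continuous_of_derive _ _ _ (Dxx t x Ht Hx)).
    + intros x Hx. rewrite ext_in by exact Hx. apply Xl; auto.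
    + intros x Hx. apply Xl; auto.
    + intros x Hx. apply (continuous_slice (fun t x => u_xx u t x)). apply Cxx'; assumption.
    + intros x Hx. rewrite !ext_in by exact Hx.
      destruct (HM _ _ (HB t x Ht Hx)). auto.
  - apply (u_x_jointly_continuous T K); assumption.
  - apply (cs_eq _ _ _ _ _ _ CS).
Qed.

(** * Dissipation of energy *)

(** Convex combinations of two functions with a common limit have that limit,
    however the weight [th], which comes from a mean value theorem, varies. *)
Lemma interp_merge {U : UniformSpace} (a b th : U -> R) z :
  continuous a z -> continuous b z -> a z = b z -> (forall w, 0 <= th w <= 1) ->
  continuous (fun w => a w + th w * (b w - a w)) z.
Proof.
  intros Ca Cb E Hth. apply continuous_eps. intros eps He.
  generalize (filter_and _ _ (proj1 (continuous_eps _ _) Ca eps He)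
                             (proj1 (continuous_eps _ _) Cb eps He)).
  apply filter_imp. intros w [A B]. specialize (Hth w).
  rewrite <- E in B |- *. rewrite Rminus_diag, Rmult_0_r, Rplus_0_r.
  replace (a w + th w * (b w - a w) - a z)
    with ((1 - th w) * (a w - a z) + th w * (b w - a z)) by ring.
  eapply Rle_lt_trans; [apply Rabs_triang|].
  rewrite !Rabs_mult, (Rabs_pos_eq (th w)), (Rabs_pos_eq (1 - th w)) by lra.
  destruct (Rlt_dec (th w) 1); nra.
Qed.

(** Under a Dirichlet condition the boundary value does not move; under a
    Robin condition the flux [L_p] vanishes in the limit. *)
Lemma boundary_flux_vanishes bc T K (v w th : R -> R) i (Lp : R -> R -> R -> R) t :
  cont3 Lp -> natural_boundary bc i Lp -> boundary_regular bc T K v w -> 0 < t < T ->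
  (forall s, 0 <= th s <= 1) ->
  forall eps, 0 < eps -> locally t (fun s => s <> t ->
    Rabs (Lp i (v t + th s * (v s - v t)) (w t + th s * (w s - w t)) * ((v s - v t) / (s - t))) < eps).
Proof.
  intros CLp Hn HB Ht Hth eps He.
  destruct (HB t Ht) as [Cv [Cw [Hbc Hlip]]].
  destruct bc as [|b]; simpl in Hn, Hbc.
  - generalize (locally_between 0 T t Ht). apply filter_imp. intros s Hs _.
    destruct (HB s Hs) as [_ [_ [Hbs _]]]. simpl in Hbs. rewrite Hbc, Hbs.
    unfold Rdiv. rewrite Rminus_diag, Rmult_0_l, Rmult_0_r, Rabs_R0. exact He.
  - assert (C : continuous (fun s => Lp i (v t + th s * (v s - v t)) (w t + th s * (w s - w t))) t).
    { apply (cont3_comp Lp); [exact CLp | apply (continuous_cst i) | |].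
      - apply (interp_merge (fun _ => v t) v th); auto. apply (continuous_cst (v t)).
      - apply (interp_merge (fun _ => w t) w th); auto. apply (continuous_cst (w t)). }
    assert (HK : 0 <= K).
    { destruct (Rle_dec 0 K) as [H|H]; [exact H|exfalso].
      assert (Hs' : 0 < t / 2 < T) by lra.
      specialize (Hlip _ Hs'). assert (0 < Rabs (t / 2 - t)) by (apply Rabs_pos_lt; lra).
      assert (P := Rabs_pos (v (t / 2) - v t)). nra. }
    assert (He' : 0 < eps / (K + 1)) by (apply Rdiv_lt_0_compat; lra).
    generalize (filter_and _ _ (locally_between 0 T t Ht) (proj1 (continuous_eps _ _) C _ He')).
    apply filter_imp. intros s [Hs A] Hst.
    rewrite !Rminus_diag, !Rmult_0_r, !Rplus_0_r, Hbc, Hn, Rminus_0_r in A.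
    rewrite Hbc. set (q := Lp _ _ _) in *.
    assert (Hst' : 0 < Rabs (s - t)) by (apply Rabs_pos_lt; lra).
    assert (D : Rabs ((v s - v t) / (s - t)) <= K).
    { unfold Rdiv. rewrite Rabs_mult, Rabs_inv.
      apply (Rmult_le_reg_r (Rabs (s - t))); [exact Hst'|].
      rewrite Rmult_assoc, Rinv_l, Rmult_1_r by lra. apply Hlip, Hs. }
    rewrite Rabs_mult. apply Rle_lt_trans with (Rabs q * K).
    + apply Rmult_le_compat_l; [apply Rabs_pos | exact D].
    + apply Rle_lt_trans with (Rabs q * (K + 1)).
      * apply Rmult_le_compat_l; [apply Rabs_pos | lra].
      * apply Rmult_lt_compat_r with (r := K + 1) in A; [|lra].
        replace (eps / (K + 1) * (K + 1)) with eps in A by (field; lra). exact A.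
Qed.

Lemma RInt_pos_open (h : R -> R) K x0 :
  (forall x, 0 < x < 1 -> continuous h x) -> (forall x, 0 < x < 1 -> Rabs (h x) <= K) ->
  (forall x, 0 < x < 1 -> 0 <= h x) -> 0 < x0 < 1 -> 0 < h x0 -> 0 < RInt h 0 1.
Proof.
  intros Ch Bh Ph Hx0 H0.
  assert (Ih := ex_RInt_bounded_open h K Ch Bh).
  destruct (filter_and _ _ (locally_between 0 1 x0 Hx0)
     (proj1 (continuous_eps _ _) (Ch x0 Hx0) _ H0)) as [d Hd].
  assert (Pd := cond_pos d). set (a := x0 - d / 2). set (b := x0 + d / 2).
  assert (Hab : forall x, a <= x <= b -> 0 < x < 1 /\ 0 < h x).
  { intros x Hx. destruct (Hd x) as [A B].
    - change (Rabs (x - x0) < d). apply Rabs_def1; unfold a, b in Hx; lra.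
    - split; [exact A|]. apply Rabs_def2 in B. lra. }
  assert (La : a < b) by (unfold a, b; lra).
  destruct (Hab a) as [[A1 A2] _]; [lra|]. destruct (Hab b) as [[B1 B2] _]; [lra|].
  assert (Esub := fun a b => ex_RInt_sub_interval h 0 1 a b Ih).
  assert (C1 := RInt_Chasles (V := R_CompleteNormedModule) h 0 a 1 (Esub 0 a ltac:(lra) ltac:(lra) ltac:(lra))
     (Esub a 1 ltac:(lra) ltac:(lra) ltac:(lra))).
  assert (C2 := RInt_Chasles (V := R_CompleteNormedModule) h a b 1
     (Esub a b ltac:(lra) ltac:(lra) ltac:(lra)) (Esub b 1 ltac:(lra) ltac:(lra) ltac:(lra))).
  change (@eq R (RInt h 0 a + RInt h a 1) (RInt h 0 1)) in C1.
  change (@eq R (RInt h a b + RInt h b 1) (RInt h a 1)) in C2.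
  assert (P1 : 0 <= RInt h 0 a).
  { apply RInt_ge_0; [lra | apply Esub; lra | intros x Hx; apply Ph; lra]. }
  assert (P2 : 0 <= RInt h b 1).
  { apply RInt_ge_0; [lra | apply Esub; lra | intros x Hx; apply Ph; lra]. }
  assert (P3 : 0 < RInt h a b).
  { apply RInt_gt_0; [exact La | |]; intros x Hx; [apply Hab; lra | apply Ch, Hab, Hx]. }
  lra.
Qed.

Lemma interp_same th (a : R -> R) x : interp th a a x = a x.
Proof. unfold interp. ring. Qed.

(** Divide the energy increment between the times [t] and [s] by [s - t].  The
    boundary terms vanish in the limit, and the integrands are bounded and
    converge locally uniformly in (0,1) to the Euler-Lagrange expression times
    [u_t]. *)
Theorem energy_dissipation f bc0 bc1 M K L Lu Lp Lpx Lpu Lpp T u v0 w0 v1 w1 :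
  lagrangian f bc0 bc1 M L Lu Lp Lpx Lpu Lpp -> 0 <= M ->
  regular_solution f bc0 bc1 T M K u v0 w0 v1 w1 ->
  forall t, 0 < t < T ->
  let diss x := Lpp x (u t x) (u_x u t x) * (u_xx u t x - F0 f x (u t x) (u_x u t x)) * u_t u t x in
  ex_RInt (energy_density L u t) 0 1 /\
  (exists C, forall x, 0 < x < 1 -> continuous diss x /\ Rabs (diss x) <= C) /\
  is_derive (energy L u) t (- RInt diss 0 1).
Proof.
  intros HL HM HS t Ht diss.
  destruct (lg_up HL) as [CL CLu CLp _ _].
  destruct (lg_C1p HL) as [_ CLpx CLpu CLpp _ _ _].
  assert (Hpf := rs_pf HS).
  assert (Dt := rs_dt HS).
  assert (Bt := rs_bt HS).
  assert (Cu := rs_cu HS). assert (Cp := rs_cp HS).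
  assert (Cq := rs_cq HS). assert (Ct := rs_ct HS).
  pose (A := fun s => ext (v0 s) (v1 s) (u s)). pose (Ap := fun s => ext (w0 s) (w1 s) (u_x u s)).
  assert (HE : forall s, 0 < s < T -> energy L u s = RInt (fun x => L x (A s x) (Ap s x)) 0 1).
  { intros s Hs. apply RInt_ext. intros x. rewrite Rmin_left, Rmax_right by lra. intros Hx.
    unfold A, Ap, energy_density. rewrite !ext_in by exact Hx. reflexivity. }
  assert (HI : ex_RInt (energy_density L u t) 0 1).
  { apply (ex_RInt_ext (V := R_NormedModule) (fun x => L x (A t x) (Ap t x))).
    - intros x. rewrite Rmin_left, Rmax_right by lra. intros Hx.
      unfold A, Ap, energy_density. rewrite !ext_in by exact Hx. reflexivity.
    - apply ex_RInt_cont. intros x.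
      assert (H1 := pf_c (Hpf t Ht) x). assert (H2 := pf_cp (Hpf t Ht) x).
      fold (A t) in H1. fold (Ap t) in H2. cont. }
  split; [exact HI|].
  destruct (el_density_bound Lu Lpx Lpu Lpp M K) as [C HC]; auto.
  (* completed by [u_t] at [s = t], so that the limit becomes a statement of continuity *)
  pose (D := fun s y => if Req_EM_T s t then u_t u t y else (u s y - u t y) / (s - t)).
  assert (HD : forall s y, 0 < s < T -> 0 < y < 1 -> exists c, Rmin t s <= c <= Rmax t s /\
      0 < c < T /\ D s y = u_t u c y).
  { intros s y Hs Hy. unfold D. destruct (Req_EM_T s t) as [->|Hn].
    - exists t. rewrite Rmin_left, Rmax_left by lra. split; [lra|]. split; [exact Ht | reflexivity].
    - destruct (MVT_segment (fun s => u s y) (fun s => u_t u s y) t s) as [c [Hc Ec]].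
      { intros z Hz. apply Dt; [exact (segment_in t s z 0 T Ht Hs Hz) | exact Hy]. }
      exists c. split; [exact Hc|]. split; [exact (segment_in t s c 0 T Ht Hs Hc)|].
      rewrite Ec. field. lra. }
  assert (BD : forall s y, 0 < s < T -> 0 < y < 1 -> Rabs (D s y) <= K).
  { intros s y Hs Hy. destruct (HD s y Hs Hy) as [c [_ [Hc ->]]]. apply Bt; assumption. }
  assert (CD : forall x, 0 < x < 1 -> continuous (fun w : R * R => D (fst w) (snd w)) (t, x)).
  { intros x Hx. apply continuous_eps. intros eps He.
    destruct (proj1 (locally_pair t x _) (proj1 (continuous_eps _ _) (Ct t x Ht Hx) eps He)) as [d Hd].
    assert (Hl : locally (t, x) (fun z : R * R => 0 < fst z < T /\ 0 < snd z < 1)).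
    { apply filter_and.
      - exact (continuous_fst t x _ (locally_between 0 T t Ht)).
      - exact (continuous_snd t x _ (locally_between 0 1 x Hx)). }
    generalize (filter_and _ _ Hl (locally_ball (t, x) d)).
    apply filter_imp. intros [s y] [[Hs Hy] [Bs By]]. simpl in *.
    destruct (HD s y Hs Hy) as [c [Hc [_ ->]]].
    assert (E : D t x = u_t u t x) by (unfold D; destruct (Req_EM_T t t); [reflexivity | lra]).
    rewrite E. apply (Hd c y); [|exact By].
    change (Rabs (c - t) < d). eapply Rle_lt_trans; [apply between_Rabs, Hc | exact Bs]. }
  assert (Hth : forall s, exists th, 0 <= th <= 1 /\ (0 < s < T ->
    energy L u s - energy L u t =
    Lp 1 (interp th (A t) (A s) 1) (interp th (Ap t) (Ap s) 1) * (A s 1 - A t 1)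
    - Lp 0 (interp th (A t) (A s) 0) (interp th (Ap t) (Ap s) 0) * (A s 0 - A t 0)
    - RInt (fun x => el_density Lu Lpx Lpu Lpp (interp th (A t) (A s)) (interp th (Ap t) (Ap s))
         (interp th (u_xx u t) (u_xx u s)) x * (A s x - A t x)) 0 1)).
  { intros s. destruct (classic (0 < s < T)) as [Hs|Hs].
    - destruct (energy_increment f bc0 bc1 M K L Lu Lp Lpx Lpu Lpp _ _ _ _ _ _ HL HM (Hpf t Ht) (Hpf s Hs))
        as [th [H1 H2]].
      exists th. split; [exact H1|]. intros _. rewrite !HE by assumption. exact H2.
    - exists 0. split; [lra | tauto]. }
  pose (th := fun s => proj1_sig (constructive_indefinite_description _ (Hth s))).
  assert (Hth1 : forall s, 0 <= th s <= 1).
  { intros s. unfold th. destruct (constructive_indefinite_description _ (Hth s)) as [x [H1 H2]]. exact H1. }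
  assert (Hth2 := fun s => proj2 (proj2_sig (constructive_indefinite_description _ (Hth s)))).
  cbv beta in Hth2. change (fun s => proj1_sig (constructive_indefinite_description _ (Hth s))) with th in Hth2.
  pose (N := fun s => el_density Lu Lpx Lpu Lpp (interp (th s) (u t) (u s))
         (interp (th s) (u_x u t) (u_x u s)) (interp (th s) (u_xx u t) (u_xx u s))).
  assert (EN : forall s x, 0 < x < 1 -> el_density Lu Lpx Lpu Lpp (interp (th s) (A t) (A s))
     (interp (th s) (Ap t) (Ap s)) (interp (th s) (u_xx u t) (u_xx u s)) x = N s x).
  { intros s x Hx. unfold N, el_density, interp, A, Ap. rewrite !ext_in by exact Hx. reflexivity. }
  pose (k := fun s x => N s x * D s x).
  (* on the solution, the Euler-Lagrange expression is [L_pp (u_xx - F^0)] *)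
  assert (Ek : forall x, 0 < x < 1 -> k t x = diss x).
  { intros x Hx. unfold k, N, D, diss, el_density. rewrite !interp_same.
    destruct (Req_EM_T t t) as [_|n]; [|lra].
    destruct (pf_b (Hpf t Ht) x Hx) as [B1 [B2 _]]. rewrite ext_in in B1, B2 by exact Hx.
    assert (EL := lg_el HL x _ _ Hx B1 B2). rewrite Rmult_minus_distr_l, <- EL. ring. }
  assert (BN : forall s x, 0 < s < T -> 0 < x < 1 -> Rabs (N s x) <= C).
  { intros s x Hs Hx. rewrite <- EN by exact Hx.
    apply HC; [|exact Hx].
    exact (interp_profile _ _ _ _ _ _ _ _ _ (Hth1 s) (Hpf t Ht) (Hpf s Hs)). }
  assert (Bk : forall s x, 0 < s < T -> 0 < x < 1 -> Rabs (k s x) <= C * K).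
  { intros s x Hs Hx. unfold k. rewrite Rabs_mult.
    apply Rmult_le_compat; try apply Rabs_pos; auto. }
  assert (Cut : forall (g : R -> R -> R) s x, continuous (fun z : R * R => g (fst z) (snd z)) (s, x) ->
      continuous (g s) x) by (intros g s x; apply continuous_slice).
  assert (Ck : forall x, 0 < x < 1 -> continuous (fun w : R * R => k (fst w) (snd w)) (t, x)).
  { intros x Hx.
    assert (Ci : forall g : R -> R -> R, continuous (fun z : R * R => g (fst z) (snd z)) (t, x) ->
      continuous (fun w : R * R => interp (th (fst w)) (g t) (g (fst w)) (snd w)) (t, x)).
    { intros g Hg. apply (interp_merge (fun w : R * R => g t (snd w)) (fun w => g (fst w) (snd w))
        (fun w => th (fst w))); auto.
      apply (continuous_comp snd (g t)); [cont | apply Cut, Hg]. }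
    assert (C1 := Ci u (Cu t x Ht Hx)). assert (C2 := Ci (u_x u) (Cp t x Ht Hx)).
    assert (C3 := Ci (u_xx u) (Cq t x Ht Hx)). assert (C4 := CD x Hx).
    unfold k, N, el_density. cont. }
  assert (Ik : forall s, 0 < s < T -> ex_RInt (k s) 0 1).
  { intros s Hs. apply (ex_RInt_bounded_open _ (C * K)); [|intros x Hx; apply Bk; assumption].
    intros x Hx. apply continuous_mul.
    - apply (continuous_ext_loc _ (el_density Lu Lpx Lpu Lpp (interp (th s) (A t) (A s))
        (interp (th s) (Ap t) (Ap s)) (interp (th s) (u_xx u t) (u_xx u s)))).
      + generalize (locally_between 0 1 x Hx). apply filter_imp. intros y Hy. apply EN, Hy.
      + apply (el_density_cont Lu Lpx Lpu Lpp M K); auto.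
        exact (interp_profile _ _ _ _ _ _ _ _ _ (Hth1 s) (Hpf t Ht) (Hpf s Hs)).
    - unfold D. destruct (Req_EM_T s t) as [_|Hn].
      + apply Cut, Ct; assumption.
      + apply continuous_mul; [|apply (continuous_cst (/ (s - t)))].
        apply continuous_sub; [apply (Cut u s x) | apply (Cut u t x)]; apply Cu; assumption. }
  assert (CI : continuous (fun s => RInt (k s) 0 1) t).
  { apply (continuous_RInt_open k t (C * K)); [|exact Ck].
    generalize (locally_between 0 T t Ht). apply filter_imp. intros s Hs.
    split; [apply Ik, Hs | intros x Hx; apply Bk; assumption]. }
  assert (EI : RInt (k t) 0 1 = RInt diss 0 1).
  { apply RInt_ext. intros x. rewrite Rmin_left, Rmax_right by lra. apply Ek. }
  split.
  { exists (C * K). intros x Hx. split.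
    - apply (continuous_ext_loc _ (k t)).
      + generalize (locally_between 0 1 x Hx). apply filter_imp. intros y Hy. apply Ek, Hy.
      + apply (Cut k t x). apply Ck, Hx.
    - rewrite <- Ek by exact Hx. apply Bk; assumption. }
  apply is_derive_shift.
  pose (q := fun h => if Req_EM_T h 0 then - RInt diss 0 1 else (energy L u (t + h) - energy L u t) / h).
  replace (- RInt diss 0 1) with (q 0) by (unfold q; destruct (Req_EM_T 0 0); [reflexivity | lra]).
  apply (is_derive_of_quotient (fun h => energy L u (t + h)) q).
  2:{ intros h. unfold q. rewrite Rplus_0_r. destruct (Req_EM_T h 0) as [->|Hn]; [rewrite Rplus_0_r; ring | field; exact Hn]. }
  apply continuous_eps. intros eps He.
  assert (He3 : 0 < eps / 3) by lra.
  assert (F0 := boundary_flux_vanishes bc0 T K v0 w0 th 0 Lp t CLp (lg_bc0 HL)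
    (rs_bc0 HS) Ht Hth1 _ He3).
  assert (F1 := boundary_flux_vanishes bc1 T K v1 w1 th 1 Lp t CLp (lg_bc1 HL)
    (rs_bc1 HS) Ht Hth1 _ He3).
  assert (F2 := proj1 (continuous_eps _ _) CI _ He3).
  assert (Cshift : continuous (fun h => t + h) 0).
  { apply continuous_add; [apply (continuous_cst t) | apply continuous_id]. }
  assert (F3 := filter_and _ _ (locally_between 0 T t Ht) (filter_and _ _ F0 (filter_and _ _ F1 F2))).
  rewrite <- (Rplus_0_r t) in F3 at 1.
  generalize (Cshift _ F3). unfold filtermap. apply filter_imp.
  intros h [Hs [G0 [G1 G2]]].
  assert (Eq0 : q 0 = - RInt (k t) 0 1).
  { unfold q. destruct (Req_EM_T 0 0); [rewrite EI; reflexivity | lra]. }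
  rewrite Eq0. unfold q. destruct (Req_EM_T h 0) as [Hh|Hh].
  { rewrite EI, Rminus_diag, Rabs_R0. exact He. }
  set (s := t + h) in *.
  assert (Hst : s <> t) by (unfold s; lra).
  assert (Eh : h = s - t) by (unfold s; Rring).
  specialize (G0 Hst). specialize (G1 Hst).
  assert (EE := Hth2 s Hs). fold (th s) in EE.
  assert (ER : RInt (fun x => el_density Lu Lpx Lpu Lpp (interp (th s) (A t) (A s)) (interp (th s) (Ap t) (Ap s))
         (interp (th s) (u_xx u t) (u_xx u s)) x * (A s x - A t x)) 0 1 = (s - t) * RInt (k s) 0 1).
  { rewrite <- RInt_mul_l by (apply Ik, Hs).
    apply RInt_ext. intros x. rewrite Rmin_left, Rmax_right by lra. intros Hx.
    rewrite EN by exact Hx. unfold k, D. destruct (Req_EM_T s t); [contradiction|].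
    unfold A. rewrite !ext_in by exact Hx.
    match goal with |- @eq _ ?l ?r => change (@eq R l r) end. field. lra. }
  rewrite ER in EE. unfold interp, A, Ap in EE. rewrite !ext_0, !ext_1 in EE.
  set (X0 := Lp 0 _ _) in *. set (X1 := Lp 1 _ _) in *.
  rewrite Eh, EE.
  replace ((X1 * (v1 s - v1 t) - X0 * (v0 s - v0 t) - (s - t) * RInt (k s) 0 1) / (s - t))
    with (X1 * ((v1 s - v1 t) / (s - t)) - X0 * ((v0 s - v0 t) / (s - t)) - RInt (k s) 0 1)
    by (field; lra).
  apply Rabs_def2 in G0. apply Rabs_def2 in G1. apply Rabs_def2 in G2. apply Rabs_def1; lra.
Qed.

Theorem theorem1p1 :
  forall (f : R -> R -> R -> R -> R -> R) (bc0 bc1 : boundary_condition),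
    C1_xupqr f ->
    C1_xupq (fun x u p q => f_p f x u p q 0) ->
    C1_xupq (fun x u p q => f_q f x u p q 0) ->
    C1_xupq (fun x u p q => f_r f x u p q 0) ->
    parabolic f ->
    (forall x u p, 0 <= x <= 1 -> F_dom f x u p 0) ->
    bc_C1 bc0 -> bc_C1 bc1 ->
    forall B : R * R -> Prop, bounded_set B ->
    exists L : R -> R -> R -> R,
      C1_xup L /\ C1_xup (L_p L) /\ C1_xup (L_pp L) /\
      (forall x u p r, 0 <= x <= 1 -> F_dom f x u p r ->
         0 < L_pp L x u p * F1 f x u p r) /\
      forall (T : R) (u0 : R -> R) (u : R -> R -> R),
        classical_solution f bc0 bc1 T u0 u ->
        (forall t x, 0 < t < T -> 0 < x < 1 -> B (u t x, u_x u t x)) ->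
        forall t, 0 < t < T ->
          ex_RInt (energy_density L u t) 0 1 /\
          ex_RInt (dissipation_density f L u t) 0 1 /\
          is_derive (energy L u) t (- RInt (dissipation_density f L u t) 0 1) /\
          (~ equilibrium_at u t -> Derive (energy L u) t < 0).
Proof.
  intros f bc0 bc1 Hf Hfp Hfq _ Hpar Hdom Hbc0 Hbc1 B [M0 HM0].
  destruct (implicit_data_exists f Hf Hfp Hfq Hpar Hdom) as [Fx [Fu [Fp [Fpu [Fpp ID]]]]].
  assert (HMpos := Rabs_pos M0). set (M := Rabs M0) in *.
  assert (HM : forall v p, B (v, p) -> Rabs v <= M /\ Rabs p <= M).
  { intros v p H. destruct (HM0 v p H). assert (T := Rle_abs M0). fold M in T. lra. }
  destruct (lagrangian_exists f bc0 bc1 Fx Fu Fp Fpu Fpp M ID Hbc0 Hbc1 HMpos)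
    as [L [Lu [Lp [Lpx [Lpu [Lpp HL]]]]]].
  assert (ELp : L_p L = Lp).
  { extensionality x. extensionality u. extensionality p. apply is_derive_unique.
    apply (up_dp _ _ _ (lg_up HL)). }
  assert (ELpp : L_pp L = Lpp).
  { extensionality x. extensionality u. extensionality p. unfold L_pp. rewrite ELp.
    apply is_derive_unique. apply (ev_dp _ _ _ _ (lg_C1p HL)). }
  assert (Hpos : forall x u p r, 0 <= x <= 1 -> F_dom f x u p r -> 0 < L_pp L x u p * F1 f x u p r).
  { intros x u p r Hx Hr. rewrite ELpp. apply Rmult_lt_0_compat.
    - apply (lg_pos HL).
    - apply (id_F1 _ _ _ _ _ _ ID); assumption. }
  exists L. split; [apply HL|]. split.
  { rewrite ELp. exact (C1_xup_everywhere_on _ _ _ _ (lg_C1p HL)). }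
  split; [rewrite ELpp; apply HL|]. split; [exact Hpos|].
  intros T u0 u CS HB t Ht.
  destruct (classical_solution_regular f bc0 bc1 T u0 u B M CS HB HM) as [K [v0 [w0 [v1 [w1 RS]]]]].
  destruct (energy_dissipation f bc0 bc1 M K L Lu Lp Lpx Lpu Lpp T u v0 w0 v1 w1 HL HMpos RS t Ht)
    as [HI [[C HC] HD]].
  set (diss := fun x => _) in HC, HD.
  (* [F^1 u_t = u_xx - F^0] on a solution *)
  assert (Ediss : forall x, 0 < x < 1 -> diss x = dissipation_density f L u t x).
  { intros x Hx. unfold diss, dissipation_density, F1. rewrite ELpp, pow2_abs.
    assert (E : F f x (u t x) (u_x u t x) (u_t u t x) = u_xx u t x).
    { apply (id_unique _ _ _ _ _ _ ID); [lra|]. apply (rs_eq RS); assumption. }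
    destruct (Req_EM_T (u_t u t x) 0) as [Z|Z].
    - rewrite Z. ring.
    - rewrite E. field. exact Z. }
  assert (ERI : RInt diss 0 1 = RInt (dissipation_density f L u t) 0 1).
  { apply RInt_ext. intros x. rewrite Rmin_left, Rmax_right by lra. apply Ediss. }
  split; [exact HI|]. split; [|split].
  - apply (ex_RInt_ext (V := R_NormedModule) diss).
    + intros x. rewrite Rmin_left, Rmax_right by lra. apply Ediss.
    + apply (ex_RInt_bounded_open diss C); intros x Hx; apply HC, Hx.
  - rewrite <- ERI. exact HD.
  - intros Hne. rewrite (is_derive_unique _ _ _ HD).
    assert (Hx0 : exists x0, 0 < x0 < 1 /\ u_t u t x0 <> 0).
    { apply NNPP. intros Hn. apply Hne. intros x Hx. apply NNPP. intros Hz. apply Hn. exists x. auto. }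
    destruct Hx0 as [x0 [Hx0 Hz]].
    assert (Hp : forall x, 0 < x < 1 ->
      0 < L_pp L x (u t x) (u_x u t x) * F1 f x (u t x) (u_x u t x) (u_t u t x)).
    { intros x Hx. apply Hpos; [lra|]. exists (u_xx u t x).
      apply (rs_eq RS); assumption. }
    assert (0 < RInt diss 0 1); [|lra].
    apply (RInt_pos_open diss C x0); [intros x Hx; apply HC, Hx | intros x Hx; apply HC, Hx | | exact Hx0 |].
    + intros x Hx. rewrite Ediss by exact Hx. unfold dissipation_density. specialize (Hp x Hx).
      apply Rmult_le_pos; [lra | apply pow2_ge_0].
    + rewrite Ediss by exact Hx0. unfold dissipation_density. apply Rmult_lt_0_compat; [apply Hp, Hx0|].
      apply pow_lt, Rabs_pos_lt, Hz.
Qed.
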